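(* Let $A$ be a commutative unital $C^*$-algebra. Then $A$ is $\aleph_0$-generated with respect to isometries in the $\mathrm{CMet}$-enriched category $\mathcal{C}^*_1$ if and only if it is finite-dimensional; likewise, $A$ is $\aleph_0$-generated with respect to isometries in the $\mathrm{CMet}$-enriched category $\mathcal{C}^*_{c,1}$ if and only if it is finite-dimensional.
   Context: $\mathcal{C}^*_1$ (resp. $\mathcal{C}^*_{c,1}$) is the category of unital (resp. unital commutative) complex $C^*$-algebras with unital $*$-homomorphisms; the zero algebra is allowed. $\mathrm{CMet}$ is the category of complete generalized metric spaces (distances allowed values in $[0,\infty]$) with non-expansive maps as morphisms. $\mathcal{C}^*_1$ and $\mathcal{C}^*_{c,1}$ are enriched over $\mathrm{CMet}$ by metrizing each set of morphisms $\mathrm{hom}(A,B)$ by $d(\varphi,\psi)=\sup_{\|a\|\le 1}\|\varphi(a)-\psi(a)\|$. Let $\mathcal{M}$ be the class of isometric (equivalently, injective) unital $*$-homomorphisms in the category $\mathcal{C}$ in question. An object $c$ is $\aleph_0$-generated with respect to isometries in the $\mathrm{CMet}$-enriched sense if, for every directed diagram $(c_i)_i$ in $\mathcal{C}$ with all connecting morphisms in $\mathcal{M}$, the canonical morphism $\varinjlim_i\mathrm{hom}_{\mathcal{C}}(c,c_i)\to\mathrm{hom}_{\mathcal{C}}(c,\varinjlim_i c_i)$ is an isomorphism in $\mathrm{CMet}$ (the first colimit being taken in $\mathrm{CMet}$). *)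

(* Defs.v *)
From HB Require Import structures.
From mathcomp Require Import all_boot all_order all_algebra.
From mathcomp Require Import complex ring.
From mathcomp Require Import all_classical all_reals all_analysis.

Set Implicit Arguments.
Unset Strict Implicit.
Unset Printing Implicit Defensive.

Import Order.TTheory GRing.Theory Num.Theory.
Import numFieldNormedType.Exports.

Local Open Scope classical_set_scope.
Local Open Scope complex_scope.
Local Open Scope ring_scope.

(* Unital complex C*-algebras.  The multiplication is part of the mixin, and
   not inherited from [GRing.PzRing], because Hierarchy Builder refuses the join
   of [NormedModule] with the ring structures: [numDomainType] inherits from
   both but was not declared above such a join.  [1 = 0] is not excluded.
   The norm of the library takes its values in the scalars [R[i]]. *)
HB.mixin Record isCStarAlgebra (R : realType) (A : Type)
    of CompleteNormedModule R[i] A := {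
  cone : A ;
  cmul : A -> A -> A ;
  star : A -> A ;
  cmulA : associative cmul ;
  cmul1l : left_id cone cmul ;
  cmul1r : right_id cone cmul ;
  cmulDl : left_distributive cmul +%R ;
  cmulDr : right_distributive cmul +%R ;
  cmulZl : forall (k : R[i]) (x y : A), cmul (k *: x) y = k *: cmul x y ;
  cmulZr : forall (k : R[i]) (x y : A), cmul x (k *: y) = k *: cmul x y ;
  ler_norm_cmul : forall x y : A, `|cmul x y| <= `|x| * `|y| ;
  starK : involutive star ;
  starD : {morph star : x y / x + y} ;
  starZ : forall (k : R[i]) (x : A), star (k *: x) = k^*%C *: star x ;
  starM : forall x y : A, star (cmul x y) = cmul (star y) (star x) ;
  cstar_identity : forall x : A, `|cmul (star x) x| = `|x| ^+ 2
}.

#[short(type="cstarAlgType")]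
HB.structure Definition CStarAlgebra (R : realType) :=
  { A of CompleteNormedModule R[i] A & isCStarAlgebra R A }.

HB.mixin Record isStarHom (R : realType) (A B : cstarAlgType R)
    (f : A -> B) := {
  starhom1 : f cone = cone ;
  starhomM : {morph f : x y / cmul x y} ;
  starhomJ : {morph f : x / star x}
}.

#[short(type="starHom")]
HB.structure Definition StarHom (R : realType) (A B : cstarAlgType R) :=
  { f of @GRing.Linear R[i] A B *:%R f & isStarHom R A B f }.

Section comp.
Variables (R : realType) (A B C : cstarAlgType R).
Variables (g : starHom B C) (f : starHom A B).
Let c1 : (g \o f) cone = cone. Proof. by rewrite /= !starhom1. Qed.
Let cM : {morph g \o f : x y / cmul x y}.
Proof. by move=> x y /=; rewrite !starhomM. Qed.
Let cJ : {morph g \o f : x / star x}.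
Proof. by move=> x /=; rewrite !starhomJ. Qed.
HB.instance Definition _ := isStarHom.Build R A C (g \o f) c1 cM cJ.
Definition starhom_comp : starHom A C := g \o f.
End comp.

Lemma starhomP (R : realType) (A B : cstarAlgType R) (f g : starHom A B) :
  f =1 g <-> f = g.
Proof.
split=> [|-> //]; case: f g => [f cf] [g cg] /= /funext fg.
case: _ / fg in cg *; congr StarHom.Pack.
case: cf cg => [a b c] [a' b' c'].
congr StarHom.Class.
- by case: a a' => [p] [q]; congr GRing.isNmodMorphism.Axioms_;
    exact: Prop_irrelevance.
- by case: b b' => [p] [q]; congr GRing.isScalable.Axioms_;
    exact: Prop_irrelevance.
- by case: c c' => [p1 pM pJ] [q1 qM qJ]; congr isStarHom.Axioms_;
    exact: Prop_irrelevance.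
Qed.

Section cstar_norm.
Variables (R : realType) (A : cstarAlgType R).
Implicit Types (x y : A) (u v : nat -> A).

Definition cnorm x : R := complex.Re `|x|.

Lemma normE x : `|x| = (cnorm x)%:C.
Proof. by rewrite RRe_real // normr_real. Qed.

Lemma cmulBl x y z : cmul (x - y) z = cmul x z - cmul y z :> A.
Proof. by rewrite cmulDl -scaleN1r cmulZl scaleN1r. Qed.

Lemma cmulBr x y z : cmul x (y - z) = cmul x y - cmul x z :> A.
Proof. by rewrite cmulDr -scaleN1r cmulZr scaleN1r. Qed.

Lemma starB x y : star (x - y) = star x - star y :> A.
Proof. by rewrite starD -scaleN1r starZ rmorphN1 scaleN1r. Qed.

Lemma ler_norm_star x : `|x| <= `|star x|.
Proof.
have [->|x0] := eqVneq x 0; first by rewrite normr0.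
rewrite -(ler_pM2r (_ : 0 < `|x|)) ?normr_gt0// -expr2 -cstar_identity.
exact: ler_norm_cmul.
Qed.

Lemma norm_star x : `|star x| = `|x|.
Proof. by apply/le_anti; rewrite -{2}[x]starK !ler_norm_star. Qed.

Lemma cvg_star u x : u @ \oo --> x -> star (u n) @[n --> \oo] --> star x.
Proof.
move=> ux; apply/cvgrPdist_lt => e e0.
near do rewrite -starB norm_star.
by move/cvgrPdist_lt : ux; exact.
Unshelve. all: by end_near. Qed.

Lemma cvg_cmul u v x y : u @ \oo --> x -> v @ \oo --> y ->
  cmul (u n) (v n) @[n --> \oo] --> cmul x y.
Proof.
move=> ux vy; apply/cvgrPdist_lt => e e0.
pose s := e + 1 + `|x| + `|y|.
have s0 : 0 < s by rewrite !ltr_wpDr // addr_gt0.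
pose d := e / s.
have d0 : 0 < d by rewrite divr_gt0.
have d1 : d <= 1.
  by rewrite ler_pdivrMr// mul1r /s -!addrA lerDl !addr_ge0.
near=> n.
have -> : cmul x y - cmul (u n) (v n) =
    cmul (x - u n) y + (cmul x (y - v n) - cmul (x - u n) (y - v n)).
  rewrite (cmulBl x (u n) (y - v n)) subKr cmulBl cmulBr.
  by rewrite addrA subrK.
have xu : `|x - u n| < d by near: n; move/cvgrPdist_lt : ux; exact.
have yv : `|y - v n| < d by near: n; move/cvgrPdist_lt : vy; exact.
have h1 : `|cmul (x - u n) y| <= d * `|y|.
  by rewrite (le_trans (ler_norm_cmul _ _))// ler_wpM2r// ltW.
have h2 : `|cmul x (y - v n)| <= `|x| * d.
  by rewrite (le_trans (ler_norm_cmul _ _))// ler_wpM2l// ltW.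
have h3 : `|cmul (x - u n) (y - v n)| <= d.
  rewrite (le_trans (ler_norm_cmul _ _))// -[leRHS]mul1r ler_pM//; last exact: ltW.
  by rewrite (le_trans (ltW xu)).
rewrite (le_lt_trans (ler_normD _ _))//.
rewrite (le_lt_trans (lerD h1 (ler_normB _ _)))//.
rewrite (le_lt_trans (lerD (lexx _) (lerD h2 h3)))//.
have -> : d * `|y| + (`|x| * d + d) = d * (1 + `|x| + `|y|) by ring.
rewrite /d mulrAC ltr_pdivrMr// ltr_pM2l// /s -!addrA ltrDr.
by [].
Unshelve. all: by end_near. Qed.

Lemma cauchy_cvg_cnorm u :
  (forall e : R, 0 < e -> exists N, forall m n, (N <= m)%N -> (N <= n)%N ->
     cnorm (u m - u n) < e) ->
  exists l : A, u @ \oo --> l.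
Proof.
move=> cu; suff : cvgn u by exists (lim (u @ \oo)).
apply/cauchy_cvgP/cauchy_exP => e e0.
have e0' : 0 < complex.Re e by case: e e0 => a b /=; rewrite ltcE /= => /andP[].
have [N uN] := cu _ e0'.
exists (u N), N => // n /= Nn.
rewrite -ball_normE /= normE.
have -> : e = (complex.Re e)%:C by rewrite RRe_real// gtr0_real.
by rewrite ltcR uN.
Qed.

End cstar_norm.

(* Complete generalized metric spaces.  The carrier may be empty. *)
Record cmet (R : realType) := CMet {
  cmet_sort :> Type ;
  cdist : cmet_sort -> cmet_sort -> \bar R ;
  cdist_ge0 : forall x y, (0 <= cdist x y)%E ;
  cdist_eq0 : forall x y, cdist x y = 0%E <-> x = y ;
  cdist_sym : forall x y, cdist x y = cdist y x ;
  cdist_triangle : forall x y z, (cdist x z <= cdist x y + cdist y z)%E ;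
  cdist_complete : forall u : nat -> cmet_sort,
    (forall e : R, 0 < e -> exists N, forall m n,
       (N <= m)%N -> (N <= n)%N -> (cdist (u m) (u n) < e%:E)%E) ->
    exists l, forall e : R, 0 < e -> exists N, forall n,
       (N <= n)%N -> (cdist (u n) l < e%:E)%E
}.

Section cmet_category.
Variable R : realType.

Definition nonexpansive (X Y : cmet R) (f : X -> Y) : Prop :=
  forall x x', (cdist (f x) (f x') <= cdist x x')%E.

Definition cmet_iso (X Y : cmet R) (f : X -> Y) : Prop :=
  nonexpansive f /\
  exists g : Y -> X, [/\ nonexpansive g, cancel f g & cancel g f].

Section colimit.
Context d (I : porderType d) (X : I -> cmet R).
Variable (t : forall i j : I, (i <= j)%O -> X i -> X j).

Definition cmet_cocone (H : cmet R) (leg : forall i, X i -> H) : Prop :=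
  (forall i, nonexpansive (leg i)) /\
  (forall (i j : I) (ij : (i <= j)%O) x, leg j (t ij x) = leg i x).

Definition cmet_colimit (H : cmet R) (leg : forall i, X i -> H) : Prop :=
  cmet_cocone leg /\
  forall (Y : cmet R) (f : forall i, X i -> Y), cmet_cocone f ->
    exists u : H -> Y,
      [/\ nonexpansive u, forall i x, u (leg i x) = f i x &
        forall v : H -> Y, nonexpansive v ->
          (forall i x, v (leg i x) = f i x) -> v =1 u].

End colimit.
End cmet_category.

Section hom_metric.
Variables (R : realType) (A B : cstarAlgType R).
Implicit Types f g h : starHom A B.
Local Open Scope ereal_scope.

Definition hom_dist f g : \bar R :=
  ereal_sup [set (cnorm (f a - g a)%R)%:E | a in [set a : A | (`|a| <= 1)%R]].

Lemma cnorm_ge0 (x : B) : (0 <= cnorm x)%R.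
Proof. by have := normr_ge0 x; rewrite normE lecR. Qed.

Lemma cnorm0 : cnorm (0 : B)%R = 0%R.
Proof. by rewrite /cnorm normr0. Qed.

Lemma cnormB (x y : B) : cnorm (x - y)%R = cnorm (y - x)%R.
Proof. by rewrite /cnorm distrC. Qed.

Lemma cnorm_triangle (x y z : B) :
  (cnorm (x - z)%R <= cnorm (x - y) + cnorm (y - z))%R.
Proof.
have := ler_normD (x - y)%R (y - z)%R.
by rewrite addrA subrK !normE -rmorphD lecR.
Qed.

Lemma hom_dist_ub f g (a : A) : (`|a| <= 1)%R ->
  (cnorm (f a - g a)%R)%:E <= hom_dist f g.
Proof. by move=> a1; apply: ereal_sup_ubound; exists a. Qed.

Lemma cnorm_le_hom_dist f g (a : A) :
  (cnorm (f a - g a)%R)%:E <= (1 + cnorm a)%:E * hom_dist f g.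
Proof.
have r0 : (0 < 1 + cnorm a)%R.
  rewrite ltr_pwDl//; have := normr_ge0 a; by rewrite normE lecR.
pose b : A := (((1 + cnorm a)^-1)%:C *: a)%R.
have b1 : (`|b| <= 1)%R.
  rewrite normrZ ger0_norm ?lecR ?invr_ge0 ?(ltW r0)// normE -rmorphM lecR.
  by rewrite mulrC ler_pdivrMr// mul1r lerDr.
have ab : a = ((1 + cnorm a)%:C *: b)%R.
  by rewrite /b scalerA -rmorphM divff ?gt_eqF// scale1r.
rewrite {1 2}ab [f _]linearZ_LR [g _]linearZ_LR -scalerBr.
rewrite {1}/cnorm normrZ ger0_norm ?lecR ?(ltW r0)// normE -rmorphM/= EFinM.
by apply: lee_wpmul2l; [rewrite lee_fin ltW|exact: hom_dist_ub].
Qed.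

Lemma cnorm_lt_hom_dist f g (a : A) (e : R) : hom_dist f g < e%:E ->
  (cnorm (f a - g a) < (1 + cnorm a) * e)%R.
Proof.
move=> fge; rewrite -lte_fin (le_lt_trans (cnorm_le_hom_dist f g a))//.
rewrite EFinM lte_pmul2l// lte_fin ltr_pwDl//.
by have := normr_ge0 a; rewrite normE lecR.
Qed.

Lemma hom_dist_ge0 f g : 0 <= hom_dist f g.
Proof.
apply: le_trans (hom_dist_ub f g (a := 0%R) _); last by rewrite normr0.
by rewrite lee_fin cnorm_ge0.
Qed.

Lemma hom_dist_le f g (e : R) :
  (forall a : A, (`|a| <= 1)%R -> (cnorm (f a - g a) <= e)%R) ->
  hom_dist f g <= e%:E.
Proof. by move=> h; apply: ge_ereal_sup => _ [a a1 <-]; rewrite lee_fin h. Qed.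

Lemma hom_dist_eq0 f g : hom_dist f g = 0 <-> f = g.
Proof.
split=> [fg0|->]; last first.
  apply/eqP; rewrite eq_le hom_dist_ge0 andbT hom_dist_le// => a _.
  by rewrite subrr cnorm0.
apply/starhomP => a; apply/eqP; rewrite -subr_eq0 -normr_eq0 normE.
have := cnorm_le_hom_dist f g a; rewrite fg0 mule0 lee_fin => h.
by rewrite (@le_anti _ _ (cnorm _) 0%R) ?h ?cnorm_ge0.
Qed.

Lemma hom_dist_sym f g : hom_dist f g = hom_dist g f.
Proof. by congr ereal_sup; apply: eq_imagel => a _; rewrite cnormB. Qed.

Lemma hom_dist_triangle f g h : hom_dist f h <= hom_dist f g + hom_dist g h.
Proof.
apply: ge_ereal_sup => _ [a a1 <-].
apply: (@le_trans _ _ ((cnorm (f a - g a)%R)%:E + (cnorm (g a - h a)%R)%:E)).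
  by rewrite -EFinD lee_fin cnorm_triangle.
by apply: leeD; exact: hom_dist_ub.
Qed.

Lemma hom_dist_complete (u : nat -> starHom A B) :
  (forall e : R, (0 < e)%R -> exists N, forall m n,
     (N <= m)%N -> (N <= n)%N -> hom_dist (u m) (u n) < e%:E) ->
  exists l, forall e : R, (0 < e)%R -> exists N, forall n,
     (N <= n)%N -> hom_dist (u n) l < e%:E.
Proof.
move=> cu.
have /choice[l ul] : forall a, exists y : B, u n a @[n --> \oo] --> y.
  move=> a; apply: cauchy_cvg_cnorm => e e0.
  have r0 : (0 < 1 + cnorm a)%R.
    by rewrite ltr_pwDl//; have := normr_ge0 a; rewrite normE lecR.
  have [N uN] := cu _ (divr_gt0 e0 r0); exists N => m n Nm Nn.
  have := cnorm_lt_hom_dist a (uN _ _ Nm Nn).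
  by rewrite mulrCA divff ?gt_eqF// mulr1.
have uniq (x y : B) (v : nat -> B) : v @ \oo --> x -> v @ \oo --> y -> x = y.
  by move=> vx vy; exact: (cvg_unique _ vx vy).
have lD : linear_for *:%R l.
  move=> k x y; apply: (uniq _ _ _ (ul _)).
  under eq_fun do rewrite linearP.
  exact: (cvgD (cvgZl_tmp (ul x)) (ul y)).
have l1 : l cone = cone.
  apply: (uniq _ _ _ (ul _)); under eq_fun do rewrite starhom1.
  exact: cvg_cst.
have lM : {morph l : x y / cmul x y}.
  move=> x y; apply: (uniq _ _ _ (ul _)); under eq_fun do rewrite starhomM.
  exact: cvg_cmul.
have lJ : {morph l : x / star x}.
  move=> x; apply: (uniq _ _ _ (ul _)); under eq_fun do rewrite starhomJ.
  exact: cvg_star.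
pose L : starHom A B := HB.pack_for (starHom A B) l
  (GRing.isLinear.Build _ _ _ _ l lD) (isStarHom.Build R A B l l1 lM lJ).
exists L => e e0; have e20 : (0 < e / 2)%R by rewrite divr_gt0.
have [N uN] := cu _ e20; exists N => n Nn.
apply: (@le_lt_trans _ _ (e / 2)%:E); last first.
  by rewrite lte_fin ltr_pdivrMr// ltr_pMr// ltr1n.
apply: hom_dist_le => a a1; apply/ler_addgt0Pr => r r0.
have /cvgrPdist_lt/(_ r%:C)[|M _ uM] := ul a; first by rewrite ltcR.
rewrite (le_trans (cnorm_triangle _ (u (maxn N M) a) _))// lerD//.
  rewrite ltW// -lte_fin; apply: le_lt_trans (uN _ _ Nn (leq_maxl N M)).
  exact: hom_dist_ub.
have := uM (maxn N M) (leq_maxr N M).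
by rewrite /= normE ltcR cnormB => /ltW.
Qed.

Definition cmet_hom : cmet R :=
  CMet hom_dist_ge0 hom_dist_eq0 hom_dist_sym hom_dist_triangle
    hom_dist_complete.

End hom_metric.

Section locally_generated.
Variable R : realType.

Record cstar_diagram d (I : porderType d) := CStarDiagram {
  dobj :> I -> cstarAlgType R ;
  dmap : forall i j : I, (i <= j)%O -> starHom (dobj i) (dobj j) ;
  dmap_id : forall (i : I) (ii : (i <= i)%O) x, dmap ii x = x ;
  dmap_comp : forall (i j k : I) (ij : (i <= j)%O) (jk : (j <= k)%O)
    (ik : (i <= k)%O) x, dmap jk (dmap ij x) = dmap ik x
}.

Definition directed_poset d (I : porderType d) : Prop :=
  inhabited I /\ forall i j : I, exists k : I, (i <= k)%O /\ (j <= k)%O.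

Definition isometric (A B : cstarAlgType R) (f : A -> B) : Prop :=
  forall x, `|f x| = `|x|.

(* A predicate [P] on C*-algebras stands for the full subcategory of the
   C*-algebras satisfying [P]. *)
Section colimit.
Variable P : cstarAlgType R -> Prop.
Context d (I : porderType d) (D : cstar_diagram I).

Definition cstar_cocone (L : cstarAlgType R)
    (leg : forall i, starHom (D i) L) : Prop :=
  forall (i j : I) (ij : (i <= j)%O) x, leg j (dmap D ij x) = leg i x.

Definition cstar_colimit (L : cstarAlgType R)
    (leg : forall i, starHom (D i) L) : Prop :=
  [/\ P L, cstar_cocone leg &
    forall (M : cstarAlgType R) (f : forall i, starHom (D i) M),
      P M -> cstar_cocone f ->
      exists u : starHom L M, (forall i x, u (leg i x) = f i x) /\
        forall v : starHom L M, (forall i x, v (leg i x) = f i x) -> v =1 u].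

End colimit.

(* [H] is any colimit in CMet of the hom-spaces [hom(A, D i)]; the requirement
   on [u] characterizes the canonical map [H -> hom(A, L)]. *)
Definition aleph0_generated (P : cstarAlgType R -> Prop)
    (A : cstarAlgType R) : Prop :=
  forall (d : Order.disp_t) (I : porderType d) (D : cstar_diagram I),
    directed_poset I ->
    (forall i, P (D i)) ->
    (forall (i j : I) (ij : (i <= j)%O), isometric (dmap D ij)) ->
  forall (L : cstarAlgType R) (leg : forall i, starHom (D i) L),
    cstar_colimit P leg ->
  forall (H : cmet R) (hleg : forall i, cmet_hom A (D i) -> H),
    cmet_colimit (X := fun i => cmet_hom A (D i))
      (fun i j ij f => starhom_comp (dmap D ij) f) hleg ->
  exists u : H -> cmet_hom A L,
    (forall i (f : starHom A (D i)), u (hleg i f) = starhom_comp (leg i) f) /\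
    cmet_iso u.

(* With [aleph0_generated], these two predicates give the categories of unital,
   resp. unital commutative, C*-algebras. *)
Definition unital_cstar (A : cstarAlgType R) : Prop := True.

Definition commutative_cstar (A : cstarAlgType R) : Prop :=
  commutative (@cmul R A).

Definition finite_dimensional (A : cstarAlgType R) : Prop :=
  exists (n : nat) (e : 'I_n -> A),
    forall x : A, exists c : 'I_n -> R[i], x = \sum_(i < n) c i *: e i.

End locally_generated.

(* Main.v *)
(* If [A] is commutative and finite-dimensional, its characters are finitely many and
   [A] is spanned by orthogonal projections with sum 1. A homomorphism from [A] is
   then a family of orthogonal projections with sum 1, and such a family in a colimit
   is approximated by one at a finite stage: approximate idempotents are corrected
   by Newton iteration, one at a time, inside the corner left by the previous ones.

   This uses that the legs of a colimit of isometries are isometric and jointly dense.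
   The cocone into the reduced product of the diagram along tails is isometric and
   factors through the colimit; and the closure of the union of the ranges of the legs
   is a closed subalgebra, which the universal property forces to be everything.

   Conversely, [A] embeds isometrically into the bounded functions on its set of
   characters. The characters come from maximal preorderings of the self-adjoint part,
   as in the Kadison-Dubois theorem, which avoids spectral theory. The bounded
   functions are the directed colimit of the algebras of functions constant on the
   atoms of a finite partition, so a generated [A] has a homomorphism into one of these
   at distance less than 1/2 from the embedding. It is injective, since a kernel
   vector of norm 1 would be moved by distance 1. *)

(* Both categories are treated at once: [P] selects the objects, and [stable_class] lists what makes
   the auxiliary algebras legitimate objects. A colimit is known only through its universal property
   among objects of [P], so each fact about its legs comes from an object built for that purpose, a
   reduced product or a closed subalgebra. These algebras, the bounded functions and the scalars are
   all separations of seminormed *-algebras, so that the passage to a C*-algebra is made once.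

   In the same way [aleph0_generated] speaks of an arbitrary colimit in CMet. For one implication,
   uniqueness of colimits lets hom(A, L) itself be the model. For the other, a colimit must be
   exhibited before the hypothesis says anything, and the closure of the factorable homomorphisms is
   used.

   Contractivity of *-homomorphisms and the existence of characters both rest on the C*-identity and
   on the square root of 1 - h, obtained from a contraction. *)
From HB Require Import structures.
From mathcomp Require Import all_boot all_order all_algebra.
From mathcomp Require Import complex ring lra finmap.
From mathcomp Require Import all_classical all_reals all_analysis.
Require Import Defs.
Set Implicit Arguments.
Unset Strict Implicit.
Unset Printing Implicit Defensive.

Import Order.TTheory GRing.Theory Num.Theory.
Import numFieldNormedType.Exports.

Local Open Scope classical_set_scope.
Local Open Scope complex_scope.
Local Open Scope ring_scope.

(** * C*-norms as real numbers *)

(* Keyed on the carrier so that [x * y] is [cmul x y]. *)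
HB.instance Definition _ (R : realType) (A : cstarAlgType R) :=
  GRing.Zmodule_isPzRing.Build (CStarAlgebra.sort A) (@cmulA R A) (@cmul1l R A)
    (@cmul1r R A) (@cmulDl R A) (@cmulDr R A).

Lemma geometric_lt (R : realType) (M t e : R) : 0 <= M -> 0 <= t -> t < 1 -> 0 < e ->
  exists N, forall n, (N <= n)%N -> M * t ^+ n < e.
Proof.
move=> M0 t0 t1 e0; have M1 : 0 < M + 1 by rewrite ltr_wpDl.
have /cvgrPdist_lt/(_ _ (divr_gt0 e0 M1))[N _ tN] :=
  @cvg_expr R t (ltac:(by rewrite ger0_norm)).
exists N => n Nn; have := tN n Nn.
rewrite /= sub0r normrN ger0_norm ?exprn_ge0// ltr_pdivlMr// mulrC.
by apply: le_lt_trans; rewrite ler_wpM2r ?exprn_ge0// lerDl.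
Qed.

Section real_norm.
Variables (R : realType) (A : cstarAlgType R).
Implicit Types (x y z : A) (k : R[i]) (r e : R).

Lemma cmulE x y : cmul x y = x * y. Proof. by []. Qed.

Lemma coneE : cone = 1 :> A. Proof. by []. Qed.

Lemma scaleAl k x y : k *: (x * y) = (k *: x) * y.
Proof. by rewrite -[in RHS]cmulE cmulZl. Qed.

Lemma scaleAr k x y : k *: (x * y) = x * (k *: y).
Proof. by rewrite -[in RHS]cmulE cmulZr. Qed.

Lemma norm_le_cnorm x r : (`|x| <= r%:C) = (cnorm x <= r).
Proof. by rewrite normE lecR. Qed.

Lemma cnormD x y : cnorm (x + y) <= cnorm x + cnorm y.
Proof. by rewrite -norm_le_cnorm rmorphD/= -!normE ler_normD. Qed.

Lemma cnormN x : cnorm (- x) = cnorm x.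
Proof. by rewrite /cnorm normrN. Qed.

Lemma cnorm_leB x y : cnorm (x - y) <= cnorm x + cnorm y.
Proof. by rewrite -[cnorm y]cnormN cnormD. Qed.

Lemma cnormM x y : cnorm (x * y) <= cnorm x * cnorm y.
Proof. by rewrite -norm_le_cnorm rmorphM/= -!normE ler_norm_cmul. Qed.

Lemma cnormZ k x : cnorm (k *: x) = complex.Re `|k| * cnorm x.
Proof.
apply: complexI; rewrite -normE normrZ normE rmorphM/=; congr (_ * _).
Qed.

Lemma cnormZr r x : cnorm (r%:C *: x) = `|r| * cnorm x.
Proof. by rewrite cnormZ normc_def /= expr0n addr0 sqrtr_sqr. Qed.

Lemma cnorm_eq0 x : (cnorm x == 0) = (x == 0).
Proof. by rewrite -[x == 0]normr_eq0 normE -(inj_eq (@complexI R)). Qed.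

Lemma cnormJ x : cnorm (star x) = cnorm x.
Proof. by rewrite /cnorm norm_star. Qed.

Lemma cnormJM x : cnorm (star x * x) = cnorm x ^+ 2.
Proof. by apply: complexI; rewrite rmorphXn/= -!normE -cstar_identity. Qed.

Lemma starJM x y : star (x * y) = star y * star x.
Proof. exact: starM. Qed.

Lemma starJB x y : star (x - y) = star x - star y.
Proof. exact: starB. Qed.

Lemma star1 : star 1 = 1 :> A.
Proof. by rewrite -[LHS]mulr1 -[X in _ * X]starK -starJM mulr1 starK. Qed.

Lemma star0 : star 0 = 0 :> A.
Proof. by have := starJB 0 0; rewrite !subrr. Qed.

Lemma starN x : star (- x) = - star x.
Proof. by rewrite -[- x]sub0r starJB star0 sub0r. Qed.

Lemma starZr r x : star (r%:C *: x) = r%:C *: star x.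
Proof. by rewrite starZ; congr (_ *: _); rewrite conjc_real. Qed.

Lemma star_sum (I : Type) (s : seq I) (P : pred I) (F : I -> A) :
  star (\sum_(i <- s | P i) F i) = \sum_(i <- s | P i) star (F i).
Proof. exact: (big_morph _ (@starD R A) star0). Qed.

(** The C*-identity makes [cnorm 1] idempotent, so 0 or 1; the value 0 occurs in the zero algebra,
    whence an inequality. *)
Lemma cnorm1_le1 : cnorm (1 : A) <= 1.
Proof.
have := cnormJM (1 : A); rewrite star1 mulr1 => /eqP.
rewrite -subr_eq0 expr2 -{1}[cnorm 1]mulr1 -mulrBr mulf_eq0 subr_eq0.
by case/orP => /eqP; [move=> ->|move=> <-].
Qed.

Lemma cnorm_le1 x : cnorm x <= 1 -> `|x| <= 1.
Proof. by rewrite normE -(rmorph1 (real_complex R)) lecR. Qed.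

Lemma cnorm_sum (I : Type) (s : seq I) (P : pred I) (F : I -> A) :
  cnorm (\sum_(i <- s | P i) F i) <= \sum_(i <- s | P i) cnorm (F i).
Proof.
elim/big_ind2: _ => [|x1 x2 y1 y2 h1 h2|//]; first by rewrite cnorm0.
by rewrite (le_trans (cnormD _ _))// lerD.
Qed.

Lemma cnorm_eps_eq x y :
  (exists2 C : R, 0 <= C & forall e : R, 0 < e -> cnorm (x - y) <= C * e) -> x = y.
Proof.
move=> [C C0 h]; apply/eqP; rewrite -subr_eq0 -cnorm_eq0 eq_le cnorm_ge0 andbT.
apply/ler_addgt0Pl => e e0; rewrite addr0.
have C1 : 0 < C + 1 by rewrite ltr_wpDl.
apply: (le_trans (h (e / (C + 1)) (divr_gt0 e0 C1))).
by rewrite mulrCA ler_piMr ?(ltW e0)// ler_pdivrMr// mul1r lerDl.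
Qed.

(** Convergence with real radii: norms take values in [R[i]], and so do the radii of the balls
    behind [-->]. [ncvgP] is the bridge. *)
Definition ncvg (u : nat -> A) (l : A) :=
  forall e : R, 0 < e -> exists N, forall n, (N <= n)%N -> cnorm (u n - l) < e.

Lemma ncvgP (u : nat -> A) (l : A) : ncvg u l <-> u @ \oo --> l.
Proof.
split=> [ul|/cvgrPdist_lt ul].
  apply/cvgrPdist_lt => e e0.
  have Re_e : 0 < complex.Re e by case: e e0 => a b; rewrite ltcE /= => /andP[].
  have [N uN] := ul _ Re_e.
  exists N => // n /= Nn.
  by rewrite distrC normE -[e]RRe_real ?gtr0_real// ltcR uN.
move=> e e0; have [|N _ uN] := ul e%:C; first by rewrite ltcR.
by exists N => n Nn; have := uN n Nn; rewrite /= distrC normE ltcR.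
Qed.

Lemma ncvg_unique (u : nat -> A) (l l' : A) : ncvg u l -> ncvg u l' -> l = l'.
Proof.
by move=> /ncvgP ul /ncvgP ul'; exact: (cvg_unique _ ul ul').
Qed.

Lemma ncvgM (u v : nat -> A) (l l' : A) :
  ncvg u l -> ncvg v l' -> ncvg (fun n => u n * v n) (l * l').
Proof. by move=> /ncvgP ul /ncvgP ul'; apply/ncvgP; exact: cvg_cmul. Qed.

Lemma ncvgD (u v : nat -> A) (l l' : A) :
  ncvg u l -> ncvg v l' -> ncvg (fun n => u n + v n) (l + l').
Proof. by move=> /ncvgP ul /ncvgP ul'; apply/ncvgP; exact: cvgD. Qed.

Lemma ncvgZ k (u : nat -> A) (l : A) :
  ncvg u l -> ncvg (fun n => k *: u n) (k *: l).
Proof. by move=> /ncvgP ul; apply/ncvgP; exact: cvgZl_tmp. Qed.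

Lemma ncvgB (u v : nat -> A) (l l' : A) :
  ncvg u l -> ncvg v l' -> ncvg (fun n => u n - v n) (l - l').
Proof. by move=> /ncvgP ul /ncvgP ul'; apply/ncvgP; exact: cvgB. Qed.

Lemma ncvgJ (u : nat -> A) (l : A) :
  ncvg u l -> ncvg (fun n => star (u n)) (star l).
Proof. by move=> /ncvgP ul; apply/ncvgP; exact: cvg_star. Qed.

Lemma ncvg_cst (l : A) : ncvg (fun=> l) l.
Proof. by move=> e e0; exists 0%N => n _; rewrite subrr cnorm0. Qed.

Lemma ncvgS (u : nat -> A) (l : A) : ncvg u l -> ncvg (fun n => u n.+1) l.
Proof.
move=> ul e /ul[N uN]; exists N => n Nn; apply: uN; exact: leq_trans Nn _.
Qed.

Lemma eq_ncvg (u v : nat -> A) (l : A) : u =1 v -> ncvg u l -> ncvg v l.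
Proof. by move=> /funext ->. Qed.

Lemma cnorm_le_lim (u : nat -> A) (l x : A) r :
  ncvg u l -> (forall n, cnorm (u n - x) <= r) -> cnorm (l - x) <= r.
Proof.
move=> ul ur; apply/ler_addgt0Pl => e e0; have [N uN] := ul e e0.
rewrite (le_trans (cnorm_triangle _ (u N) _))// lerD// cnormB ltW//.
exact: uN.
Qed.

Lemma geometric_ncvg (u : nat -> A) (M t : R) : 0 <= M -> 0 <= t -> t < 1 ->
  (forall n, cnorm (u n.+1 - u n) <= M * t ^+ n) ->
  exists2 l, ncvg u l & forall n, cnorm (l - u n) <= M / (1 - t) * t ^+ n.
Proof.
move=> M0 t0 t1 uM; have s0 : 0 < 1 - t by rewrite subr_gt0.
have key n m : cnorm (u (n + m)%N - u n) <= M / (1 - t) * t ^+ n.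
  (* A telescoping bound, which unlike the uniform one survives the induction on [m]. *)
  suff: cnorm (u (n + m)%N - u n) <= M / (1 - t) * (t ^+ n - t ^+ (n + m)).
    move/le_trans; apply; rewrite ler_wpM2l// ?divr_ge0 ?(ltW s0)//.
    by rewrite lerBlDr lerDl exprn_ge0.
  elim: m => [|m IH]; first by rewrite addn0 !subrr cnorm0 mulr0.
  rewrite (le_trans (cnorm_triangle _ (u (n + m)%N) _))//.
  rewrite addnS (le_trans (lerD (uM _) IH))//.
  have -> : M * t ^+ (n + m) = M / (1 - t) * (t ^+ (n + m) - t ^+ (n + m).+1).
    by rewrite exprS; field; rewrite gt_eqF.
  by rewrite -mulrDr [X in _ * X <= _]addrC addrA subrK.
have K0 : 0 <= M / (1 - t) by rewrite divr_ge0 ?(ltW s0).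
have [|l ul] := @cauchy_cvg_cnorm R A u.
  move=> e e0.
  have e20 : 0 < e / 2 by rewrite divr_gt0.
  have [N tN] := geometric_lt K0 t0 t1 e20.
  have key' m : (N <= m)%N -> cnorm (u m - u N) < e / 2.
    by move=> Nm; rewrite -(subnKC Nm) (le_lt_trans (key _ _))// tN.
  exists N => m n Nm Nn.
  rewrite (le_lt_trans (cnorm_triangle _ (u N) _))//.
  by rewrite [ltRHS](splitr e) ltrD ?key'// cnormB key'.
exists l => [|n]; first exact/ncvgP.
apply: (cnorm_le_lim (u := fun m => u (n + m)%N)) => [e e0|m]; last exact: key.
have [N uN] := (ncvgP u l).2 ul e e0; exists N => m Nm.
by apply: uN; rewrite (leq_trans Nm)// leq_addl.
Qed.

End real_norm.

Definition selfadj (R : realType) (A : cstarAlgType R) (x : A) := star x = x.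

(** * Contractivity of *-homomorphisms *)

Lemma subr_sq_split (K : pzRingType) (x y : K) :
  x * x - y * y = x * (x - y) + (x - y) * y.
Proof. by rewrite mulrBr mulrBl addrA subrK. Qed.

Section sqrt.
Variables (R : realType) (A : cstarAlgType R).
Implicit Types (x y z h : A).

Local Notation half := ((2^-1 : R)%:C).

Lemma half_add x : half *: (x + x) = x.
Proof.
rewrite -[x in x + x]scale1r -scalerDl scalerA -(rmorph1 (real_complex R)).
by rewrite -rmorphD -rmorphM/= mulVf// scale1r.
Qed.

(* [y] is the fixed point of the contraction [y |-> (h + y^2) / 2] of the ball
   of radius [cnorm h], so that [(1 - y)^2 = 1 - h]. *)
Lemma sqrt_1sub h : cnorm h < 1 -> exists w : A,
  [/\ w * w = 1 - h, selfadj h -> selfadj w &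
      forall z, z * h = h * z -> z * w = w * z].
Proof.
move=> h1; pose r := cnorm h; have r0 : 0 <= r := cnorm_ge0 h.
pose F y := half *: (h + y * y).
pose u n := iter n F 0.
(* The ball is stable because [(r + r^2) / 2 <= r] for [r < 1]. *)
have Fr y : cnorm y <= r -> cnorm (F y) <= r.
  move=> yr; rewrite cnormZr ger0_norm ?invr_ge0//.
  rewrite ler_pdivrMl// mulr_natl mulr2n (le_trans (cnormD _ _))// lerD2l.
  rewrite (le_trans (cnormM _ _))// (le_trans (ler_pM _ _ yr yr)) ?cnorm_ge0//.
  by rewrite ler_piMr// ltW.
have ur n : cnorm (u n) <= r.
  by elim: n => [|n IH]; [rewrite cnorm0|exact: Fr].
have FB y z : cnorm y <= r -> cnorm z <= r -> cnorm (F y - F z) <= r * cnorm (y - z).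
  move=> yr zr; rewrite -scalerBr cnormZr ger0_norm ?invr_ge0//.
  rewrite opprD addrACA subrr add0r subr_sq_split.
  rewrite ler_pdivrMl// mulr_natl mulr2n (le_trans (cnormD _ _))//.
  apply: lerD; apply: le_trans (cnormM _ _) _.
    by rewrite ler_wpM2r ?cnorm_ge0.
  by rewrite mulrC ler_wpM2r ?cnorm_ge0.
have uB n : cnorm (u n.+1 - u n) <= 1 * r ^+ n.
  rewrite mul1r; elim: n => [|n IH]; first by rewrite subr0 expr0 (le_trans (ur 1%N))// ltW.
  apply: (@le_trans _ _ (r * cnorm (u n.+1 - u n))); last by rewrite exprS ler_wpM2l.
  exact: (FB (u n.+1) (u n)).
have [y uy _] := geometric_ncvg ler01 r0 h1 uB.
have yF : y = F y.
  apply: (ncvg_unique (ncvgS uy)); apply: ncvgZ; apply: ncvgD (ncvgM uy uy).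
  exact: ncvg_cst.
exists (1 - y); split.
- have yy : y + y = h + y * y.
    have {1 2}-> := yF; rewrite /F -scalerDl -(rmorphD (real_complex R))/=.
    by rewrite (_ : 2^-1 + 2^-1 = 1) ?scale1r//; lra.
  rewrite mulrBr mulr1 mulrBl mul1r -addrA -opprD; congr (1 - _).
  by rewrite addrA yy addrK.
- move=> hs; rewrite /selfadj starJB star1; congr (1 - _).
  apply: (ncvg_unique (ncvgJ uy)); apply: eq_ncvg uy => n.
  by elim: n => [|n IH]; rewrite ?star0//= /F starZr starD hs starJM -IH.
- move=> z zh; rewrite mulrBr mulrBl mulr1 mul1r; congr (z - _).
  apply: (ncvg_unique (ncvgM (ncvg_cst z) uy)).
  apply: eq_ncvg (ncvgM uy (ncvg_cst z)) => n.
  elim: n => [|n IH]; rewrite ?mulr0 ?mul0r//= /F -scaleAl -scaleAr.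
  by rewrite mulrDl mulrDr zh -/(u n) -mulrA IH mulrA IH mulrA.
Qed.

End sqrt.

Lemma conjc_i (R : realType) : 'i%C^*%C = - 'i%C :> R[i].
Proof. by apply/eqP; rewrite eq_complex /= oppr0 !eqxx. Qed.

Section contractive.
Variables (R : realType) (A B : cstarAlgType R) (f : starHom A B).

Lemma starhom1E : f 1 = 1. Proof. exact: starhom1. Qed.

Lemma starhomME x y : f (x * y) = f x * f y. Proof. exact: starhomM. Qed.

Lemma starhomJE x : f (star x) = star (f x). Proof. exact: starhomJ. Qed.

Lemma starhomDE x y : f (x + y) = f x + f y. Proof. exact: linearD. Qed.

Lemma starhomBE x y : f (x - y) = f x - f y. Proof. exact: linearB. Qed.

Lemma starhom0E : f 0 = 0. Proof. exact: linear0. Qed.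

Lemma starhomZE k x : f (k *: x) = k *: f x. Proof. exact: linearZ. Qed.

Lemma starhom_sumE (I : Type) (s : seq I) (P : pred I) (F : I -> A) :
  f (\sum_(i <- s | P i) F i) = \sum_(i <- s | P i) f (F i).
Proof. exact: linear_sum. Qed.

(* A self-adjoint [h] of norm less than 1 is the real part of the unitary
   [h + i sqrt(1 - h^2)]. *)
Lemma starhom_sa_lt1 (h : A) : selfadj h -> cnorm h < 1 -> cnorm (f h) <= 1.
Proof.
move=> hs h1; have hh1 : cnorm (h * h) < 1.
  rewrite (le_lt_trans (cnormM _ _))// (le_lt_trans _ h1)// ler_piMr ?cnorm_ge0//.
  exact: ltW.
have [w [ww ws wc]] := sqrt_1sub hh1.
have {}ws : star w = w by apply: ws; rewrite /selfadj starJM hs.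
have hw : h * w = w * h by apply: wc; rewrite mulrA.
pose v := h + 'i%C *: w.
have vs : star v = h - 'i%C *: w.
  by rewrite starD starZ hs ws conjc_i scaleNr.
have vv : star v * v = 1.
  rewrite vs mulrBl !mulrDr -!scaleAl -!scaleAr hw ww scalerA.
  rewrite [X in _ - (_ + X)](_ : _ = - (1 - h * h)); last first.
    by rewrite -expr2 sqr_i scaleN1r.
  by rewrite opprD opprK addrA addrK addrC subrK.
have fv1 : cnorm (f v) <= 1.
  rewrite -(ler_pXn2r (_ : 0 < 2)%N) ?nnegrE ?cnorm_ge0// expr1n.
  rewrite -cnormJM -starhomJE -starhomME vv starhom1E.
  exact: cnorm1_le1.
have -> : h = ((2^-1 : R)%:C) *: (v + star v).
  by rewrite vs addrACA subrr addr0 half_add.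
rewrite starhomZE cnormZr ger0_norm ?invr_ge0// ler_pdivrMl// mulr1.
rewrite starhomDE starhomJE (le_trans (cnormD _ _))// cnormJ.
by rewrite (_ : 2 = 1 + 1)// lerD.
Qed.

(** The C*-identity reduces the claim to the self-adjoint [star x * x]. Dividing it by [e + cnorm h]
    instead of [cnorm h] brings the norm strictly below 1 and allows [h = 0]. *)
Lemma starhom_contractive (x : A) : cnorm (f x) <= cnorm x.
Proof.
rewrite -(ler_pXn2r (_ : 0 < 2)%N) ?nnegrE ?cnorm_ge0//.
rewrite -!cnormJM -starhomJE -starhomME.
set h := star x * x; have hs : selfadj h by rewrite /selfadj starJM starK.
apply/ler_addgt0Pl => e e0; have s0 : 0 < e + cnorm h by rewrite ltr_wpDr ?cnorm_ge0.
have := @starhom_sa_lt1 ((e + cnorm h)^-1%:C *: h).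
rewrite starhomZE !cnormZr ger0_norm ?invr_ge0 ?(ltW s0)// ler_pdivrMl// mulr1; apply.
  by rewrite /selfadj starZr hs.
by rewrite ltr_pdivrMl// mulr1 ltrDr.
Qed.

End contractive.

Section projection.
Variables (R : realType) (A : cstarAlgType R).
Implicit Types (x y p q : A).

Definition projection p := selfadj p /\ p * p = p.

Lemma cnorm_projection p : projection p -> cnorm p < 1 -> p = 0.
Proof.
move=> [ps pp] p1; have := cnormJM p; rewrite ps pp expr2 => pE.
apply/eqP; rewrite -cnorm_eq0; apply/negP => /negP p0.
have : cnorm p * 1 = cnorm p * cnorm p by rewrite mulr1.
by move/(mulfI p0) => p1'; move: p1; rewrite -p1' ltxx.
Qed.

End projection.

(** * Projections near approximate projections *)

(** Identities between polynomials in one element of a noncommutative ring are pulled back to Z[X],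
    where [ring] applies. *)
Lemma poly_eval_nz (K : nzRingType) (x : K) :
  exists ev : {rmorphism {poly int} -> K}, ev 'X = x.
Proof.
have cx : commr_rmorph (intr : int -> K) x by move=> n; exact: commr_int.
by exists (horner_morph cx : {rmorphism {poly int} -> K}); exact: horner_morphX.
Qed.

(** The trivial ring is treated by hand, since the zero algebra is allowed. *)
Lemma poly_eval (K : pzRingType) (x : K) :
  exists ev : {rmorphism {poly int} -> K}, ev 'X = x.
Proof.
have [K0|K1] := eqVneq (1 : K) 0.
  have all0 (y z : K) : y = z by rewrite -[y]mulr1 -[z]mulr1 K0 !mulr0.
  have add0 : nmod_morphism (fun _ : {poly int} => 0 : K).
    by split=> // y z; exact: all0.
  have mul0 : monoid_morphism (fun _ : {poly int} => 0 : K).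
    by split; [exact: all0|move=> y z; exact: all0].
  pose f : {rmorphism {poly int} -> K} := HB.pack (fun _ : {poly int} => 0 : K)
    (GRing.isNmodMorphism.Build _ _ _ add0) (GRing.isMonoidMorphism.Build _ _ _ mul0).
  by exists f; exact: all0.
pose K' : nzRingType := HB.pack (GRing.PzRing.sort K)
  (GRing.PzSemiRing_isNonZero.Build (GRing.PzRing.sort K) K1).
exact: (@poly_eval_nz K' x).
Qed.

(* The Newton iteration [x |-> 3 x^2 - 2 x^3] for idempotents. *)
Lemma newton_idempotent (K : pzRingType) (x : K) :
  let t := x * x - x in let n := x * x * (3 - 2 * x) in
  [/\ n * n - n = t * t * (4 * t - 3), n - x = (1 - 2 * x) * t &
      n = x * (x * (3 - 2 * x))].
Proof.
move=> /=; have [ev <-] := poly_eval x.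
rewrite -(rmorph_nat ev 2) -(rmorph_nat ev 3) -(rmorph_nat ev 4) -(rmorph1 ev).
by split; rewrite -?(rmorphM, rmorphB); congr (ev _); ring.
Qed.

Section near_projection.
Variables (R : realType) (A : cstarAlgType R).
Implicit Types (x z : A).

Lemma cnorm_nat n : cnorm (n%:R : A) <= n%:R.
Proof.
elim: n => [|n IH]; first by rewrite cnorm0.
by rewrite -!natr1 (le_trans (cnormD _ _))// lerD// cnorm1_le1.
Qed.

Lemma cnormM_le x z (a b : R) : cnorm x <= a -> cnorm z <= b -> cnorm (x * z) <= a * b.
Proof. by move=> xa zb; rewrite (le_trans (cnormM _ _))// ler_pM ?cnorm_ge0. Qed.

Lemma cnormB_le x z (a b : R) : cnorm x <= a -> cnorm z <= b -> cnorm (x - z) <= a + b.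
Proof. by move=> xa zb; rewrite (le_trans (cnorm_leB _ _))// lerD. Qed.

(** A Newton step turns the defect t into t^2 (4 t - 3), at most a quarter of it in norm when |t| <=
    1/16, and moves y by |(1 - 2 y) t| <= 5 |t| while |y| <= 2. The moves sum to at most 5 / (1 -
    1/4) = 20/3 <= 8 times the first defect, and 3/2 + 20/3 * 1/16 < 2 keeps the iterates in range.
    A step has y as a left factor, so whatever kills [x] from the left kills [p]; this keeps a
    corrected projection inside a corner. *)
Lemma near_projection x : selfadj x -> cnorm x <= 3 / 2 ->
  cnorm (x * x - x) <= 1 / 16 -> exists p,
  [/\ projection p, cnorm (p - x) <= 8 * cnorm (x * x - x) &
      forall z, z * x = 0 -> z * p = 0].
Proof.
move=> xs x32; set d := cnorm (x * x - x) => d16.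
have d0 : 0 <= d := cnorm_ge0 _.
pose F (y : A) := y * y * (3 - 2 * y).
pose u n := iter n F x.
pose t y : A := y * y - y.
have FB y : cnorm y <= 2 -> cnorm (F y - y) <= 5 * cnorm (t y).
  move=> y2; have [_ -> _] := newton_idempotent y.
  apply: cnormM_le => //; rewrite (_ : 5 = 1 + 2 * 2); last by ring.
  by apply: cnormB_le (cnorm1_le1 A) _; apply: cnormM_le => //; exact: cnorm_nat.
have Ft y : cnorm (t y) <= 1 / 16 -> cnorm (t (F y)) <= cnorm (t y) / 4.
  move=> ty; have [tF _ _] := newton_idempotent y.
  rewrite /t tF -/(t y) (le_trans (@cnormM_le _ _ (cnorm (t y) * cnorm (t y)) 4 _ _))//.
  - exact: cnormM.
  - rewrite (_ : 4 = 1 + 3 :> R); last by ring.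
    apply: cnormB_le; last exact: cnorm_nat.
    rewrite (le_trans (cnormM_le (cnorm_nat 4) ty))//; lra.
  - by have := cnorm_ge0 (t y); nra.
have key n : cnorm (u n - x) <= 20 / 3 * d * (1 - 4^-1 ^+ n) /\
    cnorm (t (u n)) <= d * 4^-1 ^+ n.
  have e0 m : 0 <= (4^-1 : R) ^+ m by rewrite exprn_ge0.
  elim: n => [|n [IH1 IH2]]; first by rewrite subrr cnorm0 subrr mulr0 expr0 mulr1.
  have e1 : (4^-1 : R) ^+ n <= 1 by apply: exprn_ile1; lra.
  have u2 : cnorm (u n) <= 2.
    rewrite -[u n](subrK x) (le_trans (cnormD _ _))//.
    have := e0 n; nra.
  have tu : cnorm (t (u n)) <= 1 / 16.
    by rewrite (le_trans IH2)// (le_trans _ d16)// ler_piMr.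
  split; last first.
    by rewrite exprS (le_trans (Ft _ tu))//; lra.
  rewrite (le_trans (cnorm_triangle _ (u n) _))//.
  rewrite (le_trans (lerD (FB _ u2) IH1))// exprS.
  have := e0 n; nra.
have uB n : cnorm (u n.+1 - u n) <= 5 * d * 4^-1 ^+ n.
  have [IH1 IH2] := key n.
  have u2 : cnorm (u n) <= 2.
    rewrite -[u n](subrK x) (le_trans (cnormD _ _))//.
    have : 0 <= (4^-1 : R) ^+ n by rewrite exprn_ge0.
    by nra.
  by rewrite (le_trans (FB _ u2))// -mulrA ler_wpM2l.
have d50 : 0 <= 5 * d by rewrite mulr_ge0.
have t40 : 0 <= 4^-1 :> R by lra.
have t41 : 4^-1 < 1 :> R by lra.
have [p up pu] := geometric_ncvg d50 t40 t41 uB.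
have us n : star (u n) = u n.
  elim: n => //= n IH; rewrite {1}/F !starJM starJB starJM IH.
  have sn k : star k%:R = k%:R :> A.
    by elim: k => [|k IHk]; rewrite ?star0// -natr1 starD IHk star1.
  rewrite !sn /F -/(u n).
  (* [star] has reversed the products, but both sides are the same polynomial in [u n]. *)
  have [ev <-] := poly_eval (u n).
  rewrite -(rmorph_nat ev 2) -(rmorph_nat ev 3).
  by rewrite -?(rmorphM, rmorphB); congr (ev _); ring.
exists p; split.
- split.
    by apply: (ncvg_unique _ up); apply: eq_ncvg (ncvgJ up) => n; exact: us.
  have tp : ncvg (fun n => t (u n)) (p * p - p).
    exact: ncvgB (ncvgM up up) up.
  apply/eqP; rewrite -subr_eq0; apply/eqP; apply: (ncvg_unique tp) => e e0.
  have [N tN] := geometric_lt d0 t40 t41 e0.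
  exists N => n Nn; rewrite subr0 (le_lt_trans _ (tN n Nn))//.
  by have [] := key n.
- by apply: (le_trans (pu 0%N)); rewrite expr0 mulr1 ler_pdivrMr; lra.
- move=> z zx; apply: (ncvg_unique (ncvgM (ncvg_cst z) up)).
  apply: eq_ncvg (ncvg_cst 0) => n; apply/esym.
  elim: n => //= n IH; have [_ _ nE] := newton_idempotent (u n).
  have -> : z * F (u n) = (z * u n) * (u n * (3 - 2 * u n)) by rewrite -mulrA -nE.
  by rewrite IH mul0r.
Qed.

End near_projection.

(** * Separation of a C*-seminorm *)

(* A *-algebra with a subalgebra [pmem] that is complete for a C*-seminorm. *)
Record pre_cstar (R : realType) := PreCstar {
  pcar :> lmodType R[i] ;
  pone : pcar ;
  pmul : pcar -> pcar -> pcar ;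
  pstar : pcar -> pcar ;
  pmem : set pcar ;
  pnorm : pcar -> R ;
  pmulA : associative pmul ;
  pmul1 : left_id pone pmul ;
  pmulr1 : right_id pone pmul ;
  pmulDl : left_distributive pmul +%R ;
  pmulDr : right_distributive pmul +%R ;
  pmulZl : forall k x y, pmul (k *: x) y = k *: pmul x y ;
  pmulZr : forall k x y, pmul x (k *: y) = k *: pmul x y ;
  pstarK : involutive pstar ;
  pstarD : {morph pstar : x y / x + y} ;
  pstarZ : forall k x, pstar (k *: x) = k^*%C *: pstar x ;
  pstarM : forall x y, pstar (pmul x y) = pmul (pstar y) (pstar x) ;
  pmem0 : pmem 0 ;
  pmemD : forall x y, pmem x -> pmem y -> pmem (x + y) ;
  pmemZ : forall k x, pmem x -> pmem (k *: x) ;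
  pmem1 : pmem pone ;
  pmemM : forall x y, pmem x -> pmem y -> pmem (pmul x y) ;
  pmemJ : forall x, pmem x -> pmem (pstar x) ;
  pnorm_ge0 : forall x, pmem x -> 0 <= pnorm x ;
  pnormD : forall x y, pmem x -> pmem y -> pnorm (x + y) <= pnorm x + pnorm y ;
  pnormZ : forall k x, pmem x -> pnorm (k *: x) = complex.Re `|k| * pnorm x ;
  pnormM : forall x y, pmem x -> pmem y -> pnorm (pmul x y) <= pnorm x * pnorm y ;
  pnormJ : forall x, pmem x -> pnorm (pstar x) = pnorm x ;
  pnormJM : forall x, pmem x -> pnorm (pmul (pstar x) x) = pnorm x ^+ 2 ;
  pcomplete : forall u : nat -> pcar, (forall n, pmem (u n)) ->
    (forall n, pnorm (u n.+1 - u n) <= 2^-1 ^+ n) ->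
    exists2 l, pmem l & forall e : R, 0 < e ->
      exists N, forall n, (N <= n)%N -> pnorm (u n - l) < e
}.

Section separation.
Variables (R : realType) (V : pre_cstar R).
Implicit Types x y z : V.
Local Notation S := (@pmem R V).
Local Notation p := (@pnorm R V).

(* A canonical representative of [x] modulo null vectors: the separation is the
   subtype of the canonical members, not a quotient. *)
Definition sep_rep x : V := xget 0 [set y | S y /\ p (x - y) = 0].

Definition separation := {x : V | S x /\ sep_rep x = x}.

Lemma pmemN x : S x -> S (- x).
Proof. by move=> Sx; rewrite -scaleN1r; exact: pmemZ. Qed.

Lemma pmemB x y : S x -> S y -> S (x - y).
Proof. by move=> Sx Sy; apply: pmemD => //; exact: pmemN. Qed.

Lemma pnorm0 : p 0 = 0.
Proof. by rewrite -(scale0r 0) pnormZ ?normr0 ?mul0r//; exact: pmem0. Qed.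

Lemma pnormN x : S x -> p (- x) = p x.
Proof. by move=> Sx; rewrite -scaleN1r pnormZ// normrN normr1 mul1r. Qed.

Lemma pnormB x y : S x -> S y -> p (x - y) = p (y - x).
Proof. by move=> Sx Sy; rewrite -opprB pnormN//; exact: pmemB. Qed.

Lemma pnorm_triangle x y z : S x -> S y -> S z -> p (x - z) <= p (x - y) + p (y - z).
Proof.
move=> Sx Sy Sz; rewrite (le_trans _ (pnormD (pmemB Sx Sy) (pmemB Sy Sz)))//.
by rewrite addrA subrK.
Qed.

Lemma pnull_trans x y z : S x -> S y -> S z ->
  p (x - y) = 0 -> p (y - z) = 0 -> p (x - z) = 0.
Proof.
move=> Sx Sy Sz xy yz; apply/eqP; rewrite eq_le pnorm_ge0 ?andbT; last exact: pmemB.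
by rewrite (le_trans (pnorm_triangle Sx Sy Sz))// xy yz addr0.
Qed.

Lemma pnull_norm x y : S x -> S y -> p (x - y) = 0 -> p x = p y.
Proof.
move=> Sx Sy xy.
have h a b : S a -> S b -> p (a - b) = 0 -> p a <= p b.
  move=> Sa Sb ab; rewrite -[a](subrK b) (le_trans (pnormD _ _))//.
    exact: pmemB.
  by rewrite ab add0r.
by apply/eqP; rewrite eq_le !h// pnormB.
Qed.

Lemma sep_repP x : S x -> S (sep_rep x) /\ p (x - sep_rep x) = 0.
Proof.
move=> Sx; rewrite /sep_rep; case: xgetP => [y -> //|/(_ x)[]].
by split=> //; rewrite subrr pnorm0.
Qed.

(** The two sets of candidates coincide by the triangle inequality, and [xget] depends on the set
    alone. *)
Lemma eq_sep_rep x y : S x -> S y -> p (x - y) = 0 -> sep_rep x = sep_rep y.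
Proof.
move=> Sx Sy xy; congr xget; apply/seteqP; split=> z [Sz xz]; split => //.
  by apply: (pnull_trans Sy Sx Sz) => //; rewrite pnormB.
exact: (pnull_trans Sx Sy Sz).
Qed.

(** Sending non-members to 0 makes [sep] a total function. *)
Definition sep_dom x : V := if pselect (S x) then x else 0.

Lemma sep_domP x : S (sep_dom x).
Proof. by rewrite /sep_dom; case: pselect => [//|n] /=; exact: pmem0. Qed.

Lemma sep_domE x : S x -> sep_dom x = x.
Proof. by rewrite /sep_dom; case: pselect. Qed.

Lemma sep_subproof x : S (sep_rep (sep_dom x)) /\
  sep_rep (sep_rep (sep_dom x)) = sep_rep (sep_dom x).
Proof.
have Sx := sep_domP x; have [Sr xr] := sep_repP Sx.
by split=> //; apply: eq_sep_rep => //; rewrite pnormB.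
Qed.

Definition sep x : separation := exist _ _ (sep_subproof x).

Lemma eq_sep x y : S x -> S y -> p (x - y) = 0 -> sep x = sep y.
Proof.
by move=> Sx Sy xy; apply: eq_exist; rewrite !sep_domE//; exact: eq_sep_rep.
Qed.

Lemma sep_val (a : separation) : sep (sval a) = a.
Proof.
by case: a => x [Sx rx]; apply: eq_exist => /=; rewrite sep_domE.
Qed.

Lemma sval_mem (a : separation) : S (sval a). Proof. by case: a => x []. Qed.

Lemma sval_sep x : S x -> p (x - sval (sep x)) = 0.
Proof. by move=> Sx /=; rewrite sep_domE//; have [] := sep_repP Sx. Qed.

Lemma sval_sep' x : S x -> p (sval (sep x) - x) = 0.
Proof. by move=> Sx; rewrite pnormB ?sval_sep//; exact: sval_mem. Qed.

Lemma sep_surj (a : separation) : exists2 x, S x & sep x = a.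
Proof. by exists (sval a); [exact: sval_mem|exact: sep_val]. Qed.

Lemma pmulBl x y z : pmul (x - y) z = pmul x z - pmul y z.
Proof. by rewrite pmulDl -[- y]scaleN1r pmulZl scaleN1r. Qed.

Lemma pmulBr x y z : pmul x (y - z) = pmul x y - pmul x z.
Proof. by rewrite pmulDr -[- z]scaleN1r pmulZr scaleN1r. Qed.

Definition sep_add (a b : separation) := sep (sval a + sval b).
Definition sep_opp (a : separation) := sep (- sval a).
Definition sep_scale (k : R[i]) (a : separation) := sep (k *: sval a).
Definition sep_mul (a b : separation) := sep (pmul (sval a) (sval b)).
Definition sep_star (a : separation) := sep (pstar (sval a)).
Definition sep_norm (a : separation) : R[i] := (p (sval a))%:C.

Lemma sep_addE x y : S x -> S y -> sep_add (sep x) (sep y) = sep (x + y).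
Proof.
move=> Sx Sy; have [Sx' Sy'] := (sval_mem (sep x), sval_mem (sep y)).
apply: eq_sep; [exact: pmemD|exact: pmemD|].
have -> : sval (sep x) + sval (sep y) - (x + y) =
   (sval (sep x) - x) + (sval (sep y) - y) by rewrite opprD addrACA.
apply/eqP; rewrite eq_le pnorm_ge0 ?andbT; last by apply: pmemD; exact: pmemB.
rewrite (le_trans (pnormD (pmemB Sx' Sx) (pmemB Sy' Sy)))//.
by rewrite [p _]pnormB// [X in _ + X]pnormB// !sval_sep// addr0.
Qed.

Lemma sep_scaleE k x : S x -> sep_scale k (sep x) = sep (k *: x).
Proof.
move=> Sx; have Sx' := sval_mem (sep x).
apply: eq_sep; [exact: pmemZ|exact: pmemZ|].
by rewrite -scalerBr pnormZ; [rewrite pnormB// sval_sep// mulr0|exact: pmemB].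
Qed.

Lemma sep_oppE x : S x -> sep_opp (sep x) = sep (- x).
Proof.
move=> Sx; rewrite -scaleN1r -sep_scaleE//.
by rewrite /sep_opp -scaleN1r.
Qed.

Lemma sep_mulE x y : S x -> S y -> sep_mul (sep x) (sep y) = sep (pmul x y).
Proof.
move=> Sx Sy; have [Sx' Sy'] := (sval_mem (sep x), sval_mem (sep y)).
apply: eq_sep; [exact: pmemM|exact: pmemM|].
have -> : pmul (sval (sep x)) (sval (sep y)) - pmul x y =
   pmul (sval (sep x) - x) (sval (sep y)) + pmul x (sval (sep y) - y).
  by rewrite pmulBl pmulBr addrA subrK.
have [Bx By] := (pmemB Sx' Sx, pmemB Sy' Sy).
apply/eqP; rewrite eq_le pnorm_ge0 ?andbT; last by apply: pmemD; exact: pmemM.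
rewrite (le_trans (pnormD _ _))//; [exact: pmemM|exact: pmemM|].
rewrite (le_trans (lerD (pnormM Bx Sy') (pnormM Sx By)))//.
by rewrite !sval_sep'// mul0r mulr0 addr0.
Qed.

Lemma sep_starE x : S x -> sep_star (sep x) = sep (pstar x).
Proof.
move=> Sx; have Sx' := sval_mem (sep x).
apply: eq_sep; [exact: pmemJ|exact: pmemJ|].
have -> : pstar (sval (sep x)) - pstar x = pstar (sval (sep x) - x).
  by rewrite pstarD -[- x]scaleN1r pstarZ rmorphN1 scaleN1r.
by rewrite pnormJ; [rewrite pnormB// sval_sep|exact: pmemB].
Qed.

Lemma sep_normE x : S x -> sep_norm (sep x) = (p x)%:C.
Proof.
move=> Sx; have Sx' := sval_mem (sep x).
by congr (_%:C); apply/esym; apply: pnull_norm => //; exact: sval_sep.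
Qed.

Local Ltac sepE := rewrite ?(sep_addE, sep_scaleE, sep_oppE, sep_mulE, sep_starE)//;
  do ?[exact: pmemD|exact: pmemZ|exact: pmemM|exact: pmemJ|exact: pmem0|exact: pmem1].

HB.instance Definition _ := gen_eqMixin separation.
HB.instance Definition _ := gen_choiceMixin separation.

Lemma sep_addA : associative sep_add.
Proof.
move=> a b c; have [x Sx <-] := sep_surj a; have [y Sy <-] := sep_surj b.
by have [z Sz <-] := sep_surj c; sepE; rewrite addrA.
Qed.

Lemma sep_addC : commutative sep_add.
Proof. by move=> a b; rewrite /sep_add addrC. Qed.

Lemma sep_add0 : left_id (sep 0) sep_add.
Proof. by move=> a; have [x Sx <-] := sep_surj a; sepE; rewrite add0r. Qed.

Lemma sep_addN : left_inverse (sep 0) sep_opp sep_add.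
Proof.
move=> a; have [x Sx <-] := sep_surj a; sepE; first by rewrite addNr.
exact: pmemN.
Qed.

HB.instance Definition _ :=
  GRing.isZmodule.Build separation sep_addA sep_addC sep_add0 sep_addN.

Lemma sepD x y : S x -> S y -> sep (x + y) = sep x + sep y.
Proof. by move=> Sx Sy; rewrite -sep_addE. Qed.

Lemma sepN x : S x -> sep (- x) = - sep x.
Proof. by move=> Sx; rewrite -sep_oppE. Qed.

Lemma sepB x y : S x -> S y -> sep (x - y) = sep x - sep y.
Proof. by move=> Sx Sy; rewrite sepD ?sepN//; exact: pmemN. Qed.

Lemma sep_scaleA k l (a : separation) :
  sep_scale k (sep_scale l a) = sep_scale (k * l) a.
Proof. by have [x Sx <-] := sep_surj a; sepE; rewrite scalerA. Qed.

Lemma sep_scale1 : left_id 1 sep_scale.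
Proof. by move=> a; have [x Sx <-] := sep_surj a; sepE; rewrite scale1r. Qed.

Lemma sep_scaleDr : right_distributive sep_scale +%R.
Proof.
move=> k a b; have [x Sx <-] := sep_surj a; have [y Sy <-] := sep_surj b.
by rewrite -[_ + _]/(sep_add _ _) -[RHS]/(sep_add _ _); sepE; rewrite scalerDr.
Qed.

Lemma sep_scaleDl (a : separation) : {morph sep_scale^~ a : k l / k + l}.
Proof.
move=> k l; have [x Sx <-] := sep_surj a.
by rewrite -[RHS]/(sep_add _ _); sepE; rewrite scalerDl.
Qed.

HB.instance Definition _ := GRing.Zmodule_isLmodule.Build R[i] separation
  sep_scaleA sep_scale1 sep_scaleDr sep_scaleDl.

Lemma sep_normD (a b : separation) : sep_norm (a + b) <= sep_norm a + sep_norm b.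
Proof.
have [x Sx <-] := sep_surj a; have [y Sy <-] := sep_surj b.
rewrite -[_ + _ in leLHS]/(sep_add _ _) sep_addE// !sep_normE//; last exact: pmemD.
by rewrite -rmorphD lecR pnormD.
Qed.

Lemma sep_normZ k (a : separation) : sep_norm (k *: a) = `|k| * sep_norm a.
Proof.
have [x Sx <-] := sep_surj a; rewrite -[_ *: _]/(sep_scale _ _) sep_scaleE//.
rewrite !sep_normE//; last exact: pmemZ.
by rewrite pnormZ// -[ `|k| in RHS]RRe_real ?normr_real// -rmorphM.
Qed.

Lemma sep_norm0 (a : separation) : sep_norm a = 0 -> a = 0.
Proof.
have [x Sx <-] := sep_surj a; rewrite sep_normE// => /complexI x0.
by apply: eq_sep => //; [exact: pmem0|rewrite subr0].
Qed.

HB.instance Definition _ :=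
  Lmodule_isNormed.Build R[i] separation sep_normD sep_normZ sep_norm0.

(** Centres [a n] of balls of radius 2^-(n+2) belonging to the filter have consecutive distances
    below 2^-(n+2) + 2^-(n+3) <= 2^-n, the rate for which [pcomplete] provides a limit. *)
Lemma sep_complete (F : set_system separation) : ProperFilter F -> cauchy F -> cvg F.
Proof.
move=> PF cF.
have c0 n : 0 < (2^-1 ^+ n.+2)%:C :> R[i] by rewrite ltcR exprn_gt0.
have /choice[a aF] : forall n, exists a : separation, F (ball a (2^-1 ^+ n.+2)%:C).
  by move=> n; exact: ((cauchyP F).1 cF _ (c0 n)).
have norm_sep x : S x -> `|sep x| = (p x)%:C by exact: sep_normE.
have aB n m : `|a n - a m| < (2^-1 ^+ n.+2 + 2^-1 ^+ m.+2)%:C.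
  have [b [nb mb]] := filter_ex (filterI (aF n) (aF m)).
  rewrite -ball_normE/= in nb; rewrite -ball_normE/= in mb.
  rewrite -(subrK b (a n)) -addrA (le_lt_trans (ler_normD _ _))//.
  by rewrite rmorphD/= ltrD// distrC.
have Sa n : S (sval (a n)) := sval_mem (a n).
have pB n m : (p (sval (a n) - sval (a m)))%:C = `|a n - a m|.
  by rewrite -norm_sep ?sepB ?sep_val//; exact: pmemB.
have [n|l Sl al] := pcomplete Sa.
  rewrite -lecR pB (le_trans (ltW (aB _ _)))// lecR !exprS.
  have : 0 <= (2^-1 : R) ^+ n by rewrite exprn_ge0.
  by lra.
apply/cvg_ex; exists (sep l); apply/cvg_ballP => e e0.
have [e' e'0 ->] : exists2 e' : R, 0 < e' & e = e'%:C.
  exists (complex.Re e); last by rewrite RRe_real// gtr0_real.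
  by case: e e0 => x y; rewrite ltcE /= => /andP[].
have e20 : 0 < e' / 2 by rewrite divr_gt0.
have [N1 aN1] := al _ e20.
have h20 : 0 <= 2^-1 :> R by lra.
have h21 : 2^-1 < 1 :> R by lra.
have [N2 aN2] := geometric_lt ler01 h20 h21 e20.
pose n := maxn N1 N2; apply: filterS (aF n) => b.
rewrite -!ball_normE/= => ab.
rewrite -(subrK (a n) (sep l)) -addrA (le_lt_trans (ler_normD _ _))//.
rewrite (splitr e') rmorphD/= ltrD//.
  rewrite distrC -[a n]sep_val -sepB// norm_sep; last exact: pmemB.
  by rewrite ltcR aN1// leq_maxl.
rewrite (lt_le_trans ab)// lecR (le_trans _ (ltW (aN2 n (leq_maxr _ _))))//.
by rewrite mul1r ler_wiXn2l ?(ltW h21)// leqW// leqW.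
Qed.

HB.instance Definition _ := Uniform_isComplete.Build separation sep_complete.

Lemma sep_mulA : associative sep_mul.
Proof.
move=> a b c; have [x Sx <-] := sep_surj a; have [y Sy <-] := sep_surj b.
by have [z Sz <-] := sep_surj c; sepE; rewrite pmulA.
Qed.

Lemma sep_mul1 : left_id (sep (@pone R V)) sep_mul.
Proof. by move=> a; have [x Sx <-] := sep_surj a; sepE; rewrite pmul1. Qed.

Lemma sep_mulr1 : right_id (sep (@pone R V)) sep_mul.
Proof. by move=> a; have [x Sx <-] := sep_surj a; sepE; rewrite pmulr1. Qed.

Lemma sep_mulDl : left_distributive sep_mul +%R.
Proof.
move=> a b c; have [x Sx <-] := sep_surj a; have [y Sy <-] := sep_surj b.
have [z Sz <-] := sep_surj c.
by rewrite -[_ + _]/(sep_add _ _) -[RHS]/(sep_add _ _); sepE; rewrite pmulDl.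
Qed.

Lemma sep_mulDr : right_distributive sep_mul +%R.
Proof.
move=> a b c; have [x Sx <-] := sep_surj a; have [y Sy <-] := sep_surj b.
have [z Sz <-] := sep_surj c.
by rewrite -[_ + _]/(sep_add _ _) -[RHS]/(sep_add _ _); sepE; rewrite pmulDr.
Qed.

Lemma sep_mulZl (k : R[i]) (a b : separation) : sep_mul (k *: a) b = k *: sep_mul a b.
Proof.
have [x Sx <-] := sep_surj a; have [y Sy <-] := sep_surj b.
by rewrite -[_ *: _]/(sep_scale _ _) -[RHS]/(sep_scale _ _); sepE; rewrite pmulZl.
Qed.

Lemma sep_mulZr (k : R[i]) (a b : separation) : sep_mul a (k *: b) = k *: sep_mul a b.
Proof.
have [x Sx <-] := sep_surj a; have [y Sy <-] := sep_surj b.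
by rewrite -[_ *: _]/(sep_scale _ _) -[RHS]/(sep_scale _ _); sepE; rewrite pmulZr.
Qed.

Lemma sep_normM (a b : separation) : `|sep_mul a b| <= `|a| * `|b|.
Proof.
have [x Sx <-] := sep_surj a; have [y Sy <-] := sep_surj b; sepE.
rewrite -![ `|_|]/(sep_norm _) !sep_normE//; last exact: pmemM.
by rewrite -rmorphM lecR pnormM.
Qed.

Lemma sep_starK : involutive sep_star.
Proof. by move=> a; have [x Sx <-] := sep_surj a; sepE; rewrite pstarK. Qed.

Lemma sep_starD : {morph sep_star : a b / a + b}.
Proof.
move=> a b; have [x Sx <-] := sep_surj a; have [y Sy <-] := sep_surj b.
by rewrite -[_ + _]/(sep_add _ _) -[RHS]/(sep_add _ _); sepE; rewrite pstarD.
Qed.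

Lemma sep_starZ (k : R[i]) (a : separation) : sep_star (k *: a) = k^*%C *: sep_star a.
Proof.
have [x Sx <-] := sep_surj a.
by rewrite -[_ *: _]/(sep_scale _ _) -[RHS]/(sep_scale _ _); sepE; rewrite pstarZ.
Qed.

Lemma sep_starM (a b : separation) :
  sep_star (sep_mul a b) = sep_mul (sep_star b) (sep_star a).
Proof.
have [x Sx <-] := sep_surj a; have [y Sy <-] := sep_surj b.
by sepE; rewrite pstarM.
Qed.

Lemma sep_normJM (a : separation) : `|sep_mul (sep_star a) a| = `|a| ^+ 2.
Proof.
have [x Sx <-] := sep_surj a; sepE.
rewrite -![ `|_|]/(sep_norm _) !sep_normE//; last by apply: pmemM => //; exact: pmemJ.
by rewrite pnormJM// rmorphXn.
Qed.

HB.instance Definition _ := isCStarAlgebra.Build R separation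
  sep_mulA sep_mul1 sep_mulr1 sep_mulDl sep_mulDr sep_mulZl sep_mulZr sep_normM
  sep_starK sep_starD sep_starZ sep_starM sep_normJM.

Definition sep_alg : cstarAlgType R := separation.

Definition sepq x : sep_alg := sep x.

Lemma sepqD x y : S x -> S y -> sepq (x + y) = sepq x + sepq y.
Proof. exact: sepD. Qed.

Lemma sepqB x y : S x -> S y -> sepq (x - y) = sepq x - sepq y.
Proof. exact: sepB. Qed.

Lemma sepqZ k x : S x -> sepq (k *: x) = k *: sepq x.
Proof. by move=> Sx; rewrite -[RHS]/(sep_scale k (sep x)) sep_scaleE. Qed.

Lemma sepqM x y : S x -> S y -> sepq (pmul x y) = sepq x * sepq y.
Proof. by move=> Sx Sy; rewrite -[RHS]/(sep_mul (sep x) (sep y)) sep_mulE. Qed.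

Lemma sepq1 : sepq (@pone R V) = 1. Proof. by []. Qed.

Lemma sepqJ x : S x -> sepq (pstar x) = star (sepq x).
Proof. by move=> Sx; rewrite -[RHS]/(sep_star (sep x)) sep_starE. Qed.

Lemma cnorm_sepq x : S x -> cnorm (sepq x) = p x.
Proof. by move=> Sx; rewrite /cnorm -[ `|_|]/(sep_norm (sep x)) sep_normE. Qed.

Lemma sepq_surj (a : sep_alg) : exists2 x, S x & sepq x = a.
Proof. exact: sep_surj. Qed.

End separation.

(** * Colimits along isometric dense legs *)

Section cmet_colimits.
Variable R : realType.
Local Open Scope ereal_scope.

Lemma cdistxx (X : cmet R) (x : X) : cdist x x = 0.
Proof. exact/cdist_eq0. Qed.

Lemma cdist_eps_eq (X : cmet R) (x y : X) :
  (forall e : R, (0 < e)%R -> cdist x y <= e%:E) -> x = y.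
Proof.
move=> h; apply/cdist_eq0/eqP; rewrite eq_le cdist_ge0 andbT.
by apply/lee_addgt0Pr => e e0; rewrite add0e h.
Qed.

Lemma cdist_le3 (X : cmet R) (a b c d : X) (x y z : \bar R) :
  cdist a b <= x -> cdist b c <= y -> cdist c d <= z -> cdist a d <= x + y + z.
Proof.
move=> ab bc cd; rewrite (le_trans (cdist_triangle _ c _))// leeD//.
by rewrite (le_trans (cdist_triangle _ b _))// leeD.
Qed.

Context d (I : porderType d) (X : I -> cmet R).
Variable (t : forall i j : I, (i <= j)%O -> X i -> X j).

(** [aleph0_generated] quantifies over every colimit [H]; by uniqueness it suffices to recognize
    hom(A, L) as one of them. *)
Lemma cmet_colimit_iso (H K : cmet R) (hleg : forall i, X i -> H)
    (kleg : forall i, X i -> K) :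
  cmet_colimit t hleg -> cmet_colimit t kleg ->
  exists u : H -> K, (forall i x, u (hleg i x) = kleg i x) /\ cmet_iso u.
Proof.
move=> [Hc Hu] [Kc Ku].
have [u [nu uE _]] := Hu _ _ Kc; have [v [nv vE _]] := Ku _ _ Hc.
have [h [_ _ hU]] := Hu _ _ Hc; have [k [_ _ kU]] := Ku _ _ Kc.
have id_ne (Y : cmet R) : nonexpansive (fun y : Y => y) by move=> y y'.
have comp_ne (Y Z T : cmet R) (f : Y -> Z) (g : Z -> T) :
    nonexpansive f -> nonexpansive g -> nonexpansive (fun y => g (f y)).
  by move=> nf ng y y'; exact: le_trans (ng _ _) (nf _ _).
exists u; split=> //; split=> //; exists v; split=> // x.
- rewrite (hU (fun y => v (u y)))//; last by move=> i y; rewrite uE vE.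
    by rewrite -(hU (fun y => y)).
  exact: comp_ne.
- rewrite (kU (fun y => u (v y)))//; last by move=> i y; rewrite vE uE.
    by rewrite -(kU (fun y => y)).
  exact: comp_ne.
Qed.

Hypothesis dirI : directed_poset I.
Variables (K : cmet R) (leg : forall i, X i -> K).
Hypothesis legE : forall (i j : I) (ij : (i <= j)%O) x, leg (t ij x) = leg x.
Hypothesis leg_iso : forall i (x x' : X i), cdist (leg x) (leg x') = cdist x x'.
Hypothesis leg_dense : forall (y : K) (e : R), (0 < e)%R ->
  exists i (x : X i), cdist (leg x) y < e%:E.

Section extension.
Variables (Y : cmet R) (f : forall i, X i -> Y).
Hypothesis cf : cmet_cocone t f.

Lemma cocone_le i j (x : X i) (x' : X j) : cdist (f x) (f x') <= cdist (leg x) (leg x').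
Proof.
have [k [ik jk]] := dirI.2 i j.
rewrite -(cf.2 _ _ ik) -(cf.2 _ _ jk) -(legE ik) -(legE jk) leg_iso.
exact: cf.1.
Qed.

(** The closure of the graph of the map given on the images of the legs. It is shown to be total and
    nonexpansive as a relation, hence a function, so independence of approximating sequences never
    has to be checked. *)
Definition ext_graph (y : K) (z : Y) := forall e : R, (0 < e)%R ->
  exists i (x : X i), cdist (leg x) y < e%:E /\ cdist (f x) z < e%:E.

Lemma ext_graph_le y z y' z' : ext_graph y z -> ext_graph y' z' ->
  cdist z z' <= cdist y y'.
Proof.
move=> yz yz'; have [->|yfin] := eqVneq (cdist y y') +oo; first by rewrite leey.
have {}yfin : cdist y y' \is a fin_num.
  by rewrite ge0_fin_numE ?cdist_ge0// lt_neqAle yfin leey.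
apply/lee_addgt0Pr => e e0; rewrite -(fineK yfin).
(* Four approximations are made: of [y], [y'], [z] and [z']. *)
have e40 : (0 < e / 4)%R by rewrite divr_gt0.
have [i [x [xy xz]]] := yz _ e40; have [j [x' [xy' xz']]] := yz' _ e40.
have xx' : cdist (f x) (f x') <= (e / 4)%:E + cdist y y' + (e / 4)%:E.
  rewrite (le_trans (cocone_le _ _))//; apply: cdist_le3 (lexx _) _; first exact: ltW.
  by rewrite cdist_sym ltW.
have := cdist_le3 (_ : cdist z (f x) <= (e / 4)%:E) xx' (ltW xz').
rewrite cdist_sym ltW// => /(_ isT)/le_trans; apply.
by rewrite -(fineK yfin) -!EFinD lee_fin; lra.
Qed.

Lemma ext_graph_ex y : exists z, ext_graph y z.
Proof.
have c0 n : (0 < 2^-1 ^+ n :> R)%R by rewrite exprn_gt0.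
have /choice[a ay] : forall n, exists s : {i : I & X i},
    cdist (leg (projT2 s)) y < (2^-1 ^+ n)%:E.
  by move=> n; have [i [x xy]] := leg_dense y (c0 n); exists (existT _ i x).
have h20 : (0 <= 2^-1 :> R)%R by lra.
have h21 : (2^-1 < 1 :> R)%R by lra.
have small (e : R) : (0 < e)%R -> exists N, forall n, (N <= n)%N ->
    cdist (leg (projT2 (a n))) y < e%:E.
  move=> e0; have [N h] := geometric_lt ler01 h20 h21 e0; exists N => n Nn.
  by apply: (lt_trans (ay n)); rewrite lte_fin; have := h n Nn; rewrite mul1r.
have [e e0|z az] := @cdist_complete R Y (fun n => f (projT2 (a n))).
  have e20 : (0 < e / 2)%R by rewrite divr_gt0.
  have [N h] := small _ e20; exists N => m n Nm Nn.
  rewrite (le_lt_trans (cocone_le _ _))// (le_lt_trans (cdist_triangle _ y _))//.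
  by rewrite [e]splitr EFinD lteD ?h// cdist_sym h.
exists z => e e0; have [N1 h1] := small e e0; have [N2 h2] := az e e0.
exists (projT1 (a (maxn N1 N2))), (projT2 (a (maxn N1 N2))).
by rewrite h1 ?leq_maxl// h2// leq_maxr.
Qed.

(** Isometric and jointly dense legs make [K] the completion of the directed union of the [X i], so
    cocones extend uniquely by continuity. *)
Lemma cmet_extension : exists u : K -> Y,
  [/\ nonexpansive u, forall i (x : X i), u (leg x) = f x &
    forall v : K -> Y, nonexpansive v -> (forall i (x : X i), v (leg x) = f x) -> v =1 u].
Proof.
have /choice[u uG] := ext_graph_ex.
have G_uniq y z : ext_graph y z -> z = u y.
  move=> yz; apply: cdist_eps_eq => e e0.
  by rewrite (le_trans (ext_graph_le yz (uG y)))// cdistxx lee_fin ltW.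
exists u; split.
- by move=> y y'; exact: ext_graph_le.
- move=> i x; apply/esym/G_uniq => e e0; exists i, x.
  by rewrite !cdistxx lte_fin.
- move=> v nv vE y; apply: G_uniq => e e0; have [i [x xy]] := leg_dense y e0.
  by exists i, x; split=> //; rewrite -vE (le_lt_trans (nv _ _)).
Qed.

End extension.

Lemma isometric_dense_colimit : cmet_colimit t leg.
Proof.
split; last by move=> Y f cf; exact: cmet_extension.
by split=> [i x x'|//]; rewrite leg_iso.
Qed.

End cmet_colimits.

Section cstar_cmet.
Variables (R : realType) (A : cstarAlgType R).
Local Open Scope ereal_scope.
Implicit Types x y z : A.

Let dist x y : \bar R := (cnorm (x - y))%:E.

Let dist_ge0 x y : 0 <= dist x y. Proof. by rewrite lee_fin cnorm_ge0. Qed.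

Let dist_eq0 x y : dist x y = 0 <-> x = y.
Proof.
split=> [[/eqP]|->]; last by rewrite /dist subrr cnorm0.
by rewrite cnorm_eq0 subr_eq0 => /eqP.
Qed.

Let dist_sym x y : dist x y = dist y x. Proof. by rewrite /dist cnormB. Qed.

Let dist_triangle x y z : dist x z <= dist x y + dist y z.
Proof. by rewrite -EFinD lee_fin cnorm_triangle. Qed.

Let dist_complete (u : nat -> A) :
  (forall e : R, (0 < e)%R -> exists N, forall m n, (N <= m)%N -> (N <= n)%N ->
     dist (u m) (u n) < e%:E) ->
  exists l, forall e : R, (0 < e)%R -> exists N, forall n, (N <= n)%N ->
     dist (u n) l < e%:E.
Proof.
move=> cu; have [l /ncvgP ul] := @cauchy_cvg_cnorm R A u cu.
by exists l.
Qed.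

(** Lets [cmet_extension] produce the underlying map of a *-homomorphism. *)
Definition cmet_cstar : cmet R :=
  CMet dist_ge0 dist_eq0 dist_sym dist_triangle dist_complete.

End cstar_cmet.

Lemma isometric_cnorm (R : realType) (A B : cstarAlgType R) (f : A -> B) x :
  isometric f -> cnorm (f x) = cnorm x.
Proof. by move=> fi; rewrite /cnorm fi. Qed.

Section cstar_colimits.
Variables (R : realType) (P : cstarAlgType R -> Prop).
Context d (I : porderType d) (D : cstar_diagram R I).
Hypothesis dirI : directed_poset I.
Variables (L : cstarAlgType R) (leg : forall i, starHom (D i) L).
Hypotheses (PL : P L) (legE : cstar_cocone leg).

Definition leg_closure : set L :=
  [set y | forall e : R, 0 < e -> exists i (x : D i), cnorm (leg i x - y) < e].

(** The two approximating sequences share their indices, so that sums and products of approximants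
    stay in the image of one leg and algebraic identities pass to the limit. *)
Lemma leg_closure_seq2 (y z : L) : leg_closure y -> leg_closure z ->
  exists (i : nat -> I) (a b : forall n, D (i n)),
  ncvg (fun n => leg (i n) (a n)) y /\ ncvg (fun n => leg (i n) (b n)) z.
Proof.
move=> yd zd; have c0 n : 0 < 2^-1 ^+ n :> R by rewrite exprn_gt0.
have /choice[s ss] : forall n, exists s : {i : I & (D i * D i)%type},
    cnorm (leg (projT1 s) (projT2 s).1 - y) < 2^-1 ^+ n /\
    cnorm (leg (projT1 s) (projT2 s).2 - z) < 2^-1 ^+ n.
  move=> n.
  have [i [a ay]] := yd _ (c0 n); have [j [b bz]] := zd _ (c0 n).
  have [k [ik jk]] := dirI.2 i j.
  by exists (existT _ k (dmap D ik a, dmap D jk b)); rewrite /= !legE.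
have h20 : 0 <= 2^-1 :> R by lra.
have h21 : 2^-1 < 1 :> R by lra.
exists (fun n => projT1 (s n)), (fun n => (projT2 (s n)).1), (fun n => (projT2 (s n)).2).
by split=> e e0; have [N h] := geometric_lt ler01 h20 h21 e0; exists N => n Nn;
  have := h n Nn; rewrite mul1r; apply: lt_trans; have [] := ss n.
Qed.

Hypothesis leg_iso : forall i, isometric (leg i).
Hypothesis leg_dense : forall y, leg_closure y.

(** Since *-homomorphisms are contractive, a cocone is nonexpansive and extends as a map of metric
    spaces. The extension respects the operations by density, and is unique already among
    nonexpansive maps. *)
Lemma isometric_dense_cstar_colimit : cstar_colimit P leg.
Proof.
split=> // M f PM cf.
have cfM : cmet_cocone (X := fun i => cmet_cstar (D i)) (fun i j ij => dmap D ij)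
    (fun i => f i : cmet_cstar (D i) -> cmet_cstar M).
  split=> [i x x'|//]; rewrite /= lee_fin -starhomBE; exact: starhom_contractive.
have [|y e e0|u [nu uE uU]] := cmet_extension dirI (K := cmet_cstar L)
    (leg := fun i => leg i : cmet_cstar (D i) -> cmet_cstar L) legE _ _ cfM.
- by move=> i x x'; rewrite /= -starhomBE isometric_cnorm.
- by have [i [x xy]] := leg_dense y e0; exists i, x; rewrite /= lte_fin.
have ucvg (v : nat -> L) l : ncvg v l -> ncvg (fun n => u (v n) : M) (u l).
  move=> vl e e0; have [N h] := vl e e0; exists N => n Nn.
  by apply: le_lt_trans (h n Nn); have := nu (v n) l; rewrite /= lee_fin.
have u1 : u cone = cone :> M.
  by have [i0] := dirI.1; rewrite !coneE -(starhom1E (leg i0)) uE starhom1E.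
have uL : linear_for *:%R (u : L -> M).
  move=> k x y; have [i [a [b [ax bY]]]] := leg_closure_seq2 (leg_dense x) (leg_dense y).
  apply: (ncvg_unique (ucvg _ _ (ncvgD (ncvgZ k ax) bY))).
  have := ncvgD (ncvgZ k (ucvg _ _ ax)) (ucvg _ _ bY).
  by apply: eq_ncvg => n; rewrite !uE -!starhomZE -!starhomDE uE.
have uM : {morph (u : L -> M) : x y / cmul x y}.
  move=> x y; have [i [a [b [ax bY]]]] := leg_closure_seq2 (leg_dense x) (leg_dense y).
  apply: (ncvg_unique (ucvg _ _ (ncvgM ax bY))).
  have := ncvgM (ucvg _ _ ax) (ucvg _ _ bY).
  by apply: eq_ncvg => n; rewrite !uE -!starhomME uE.
have uJ : {morph (u : L -> M) : x / star x}.
  move=> x; have [i [a [b [ax bY]]]] := leg_closure_seq2 (leg_dense x) (leg_dense x).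
  apply: (ncvg_unique (ucvg _ _ (ncvgJ ax))).
  have := ncvgJ (ucvg _ _ ax).
  by apply: eq_ncvg => n; rewrite !uE -!starhomJE uE.
pose U : starHom L M := HB.pack_for (starHom L M) (u : L -> M)
  (GRing.isLinear.Build _ _ _ _ (u : L -> M) uL)
  (isStarHom.Build R L M (u : L -> M) u1 uM uJ).
exists U; split=> [i x|v vE]; first exact: uE.
apply: uU => // x x'; rewrite /= lee_fin -starhomBE; exact: starhom_contractive.
Qed.

End cstar_colimits.

(** * Subalgebras and reduced products *)

Lemma dependent_choice (I : Type) (D : I -> Type) (P : forall i, D i -> Prop) :
  (forall i, exists x : D i, P i x) -> exists f : forall i, D i, forall i, P i (f i).
Proof. by move=> h; exists (fun i => sval (cid (h i))) => i; exact: svalP. Qed.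

Lemma Re_norm_ge0 (R : realType) (k : R[i]) : 0 <= complex.Re `|k|.
Proof. by have := normr_ge0 k; rewrite -{1}[ `|k|]RRe_real ?normr_real// lecR. Qed.

Lemma Re_normM (R : realType) (k l : R[i]) :
  complex.Re `|k * l| = complex.Re `|k| * complex.Re `|l|.
Proof. exact: Normc.normcM. Qed.

Lemma isometric_inj (R : realType) (A B : cstarAlgType R) (f : starHom A B) :
  isometric f -> injective f.
Proof.
move=> fi x y fxy; apply/eqP; rewrite -subr_eq0 -normr_eq0 -fi starhomBE fxy subrr.
by rewrite normr0.
Qed.

Section homs.
Variables (R : realType) (A B L : cstarAlgType R).

Lemma starhom_ex (f : A -> B) : linear_for *:%R f -> f 1 = 1 ->
  {morph f : x y / x * y} -> {morph f : x / star x} ->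
  exists g : starHom A B, forall x, g x = f x.
Proof.
move=> fL f1 fM fJ.
by exists (HB.pack_for (starHom A B) f (GRing.isLinear.Build _ _ _ _ f fL)
  (isStarHom.Build R A B f f1 fM fJ)).
Qed.

Lemma cnorm_isometric (f : A -> B) : (forall x, cnorm (f x) = cnorm x) -> isometric f.
Proof. by move=> h x; rewrite !normE h. Qed.

(** Preimages are chosen pointwise; injectivity of [i] makes the choice a homomorphism. *)
Lemma lift_isometric (i : starHom B L) (f : starHom A L) : isometric i ->
  (forall a, exists b, i b = f a) -> exists g : starHom A B, forall a, i (g a) = f a.
Proof.
move=> ii /choice[g gE]; have inj := isometric_inj ii.
have [||||h hE] := @starhom_ex g.
- by move=> k x y; apply: inj; rewrite starhomDE starhomZE !gE starhomDE starhomZE.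
- by apply: inj; rewrite gE !starhom1E.
- by move=> x y; apply: inj; rewrite starhomME !gE starhomME.
- by move=> x; apply: inj; rewrite starhomJE !gE starhomJE.
by exists h => a; rewrite hE.
Qed.

End homs.

Section subalgebra.
Variables (R : realType) (L : cstarAlgType R) (S : set L).
Hypotheses (S1 : S 1) (SD : forall x y, S x -> S y -> S (x + y))
  (SZ : forall k x, S x -> S (k *: x)) (SM : forall x y, S x -> S y -> S (x * y))
  (SJ : forall x, S x -> S (star x))
  (Sclosed : forall u l, (forall n, S (u n)) -> ncvg u l -> S l).

Let S0 : S 0. Proof. by rewrite -(scale0r (1 : L)); exact: SZ. Qed.

Let complete (u : nat -> L) : (forall n, S (u n)) ->
  (forall n, cnorm (u n.+1 - u n) <= 2^-1 ^+ n) ->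
  exists2 l, S l & forall e : R, 0 < e ->
    exists N, forall n, (N <= n)%N -> cnorm (u n - l) < e.
Proof.
move=> Su uB; have h20 : 0 <= 2^-1 :> R by lra.
have h21 : 2^-1 < 1 :> R by lra.
have [n|l ul _] := geometric_ncvg (u := u) ler01 h20 h21; first by rewrite mul1r.
by exists l => //; exact: Sclosed ul.
Qed.

Let pre : pre_cstar R := @PreCstar R L 1 (@cmul R L) (@star R L) S (@cnorm R L)
  (@mulrA _) (@mul1r _) (@mulr1 _) (@mulrDl _) (@mulrDr _)
  (@cmulZl R L) (@cmulZr R L) (@starK R L) (@starD R L) (@starZ R L) (@starM R L)
  S0 SD SZ S1 SM SJ (fun x _ => cnorm_ge0 x) (fun x y _ _ => cnormD x y)
  (fun k x _ => cnormZ k x) (fun x y _ _ => cnormM x y) (fun x _ => cnormJ x)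
  (fun x _ => cnormJM x) complete.

(** The norm has no null vectors on [S], so the separation of [S] is a copy of [S], and the
    inclusion takes a class to its only member in [S]. *)
Lemma subalgebra_ex : exists (B : cstarAlgType R) (i : starHom B L),
  isometric i /\ forall x, S x <-> exists b, i b = x.
Proof.
pose q : L -> sep_alg pre := @sepq R pre.
have q_surj (b : sep_alg pre) : exists2 x, S x & q x = b := sepq_surj b.
have cnq x : S x -> cnorm (q x) = cnorm x by move=> Sx; exact: (@cnorm_sepq R pre).
have qB x y : S x -> S y -> q x = q y -> x = y.
  move=> Sx Sy qxy; apply/eqP; rewrite -subr_eq0 -cnorm_eq0 -cnq.
    by rewrite /q (@sepqB R pre)// -/(q x) qxy subrr cnorm0.
  by rewrite -scaleN1r; apply: SD => //; exact: SZ.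
have qD x y : S x -> S y -> q (x + y) = q x + q y := @sepqD R pre x y.
have qZ k x : S x -> q (k *: x) = k *: q x := @sepqZ R pre k x.
have qM x y : S x -> S y -> q (x * y) = q x * q y := @sepqM R pre x y.
have qJ x : S x -> q (star x) = star (q x) := @sepqJ R pre x.
have /choice[i iE] : forall b, exists x, S x /\ q x = b.
  by move=> b; have [x Sx xb] := q_surj b; exists x.
have Si b : S (i b) := (iE b).1.
have qi b : q (i b) = b := (iE b).2.
have [||||h hE] := @starhom_ex R (sep_alg pre) L i.
- move=> k x y; apply: qB => //; first by apply: SD => //; exact: SZ.
  by rewrite qi qD ?qZ ?qi//; exact: SZ.
- by apply: qB => //; rewrite qi; exact: (@sepq1 R pre).
- move=> x y; apply: qB => //; first exact: SM.
  by rewrite qi qM// !qi.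
- move=> x; apply: qB => //; first exact: SJ.
  by rewrite qi qJ// qi.
exists (sep_alg pre), h; split=> [|x]; last first.
  split=> [Sx|[b <-]]; last by rewrite hE.
  by exists (q x); rewrite hE; apply: qB => //; rewrite qi.
by apply: cnorm_isometric => b; rewrite hE -cnq// qi.
Qed.

End subalgebra.

Section dprod.
Variables (K : pzRingType) (I : Type) (D : I -> lmodType K).

Definition dprod := forall i, D i.
Implicit Types x y : dprod.

HB.instance Definition _ := gen_eqMixin dprod.
HB.instance Definition _ := gen_choiceMixin dprod.

Definition dprod_add x y : dprod := fun i => x i + y i.
Definition dprod_opp x : dprod := fun i => - x i.
Definition dprod_scale (k : K) x : dprod := fun i => k *: x i.

Let addA : associative dprod_add.
Proof. by move=> x y z; apply/functional_extensionality_dep => i; exact: addrA. Qed.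
Let addC : commutative dprod_add.
Proof. by move=> x y; apply/functional_extensionality_dep => i; exact: addrC. Qed.
Let add0 : left_id (fun i => 0) dprod_add.
Proof. by move=> x; apply/functional_extensionality_dep => i; exact: add0r. Qed.
Let addN : left_inverse (fun i => 0) dprod_opp dprod_add.
Proof. by move=> x; apply/functional_extensionality_dep => i; exact: addNr. Qed.

HB.instance Definition _ := GRing.isZmodule.Build dprod addA addC add0 addN.

Let scaleA k l x : dprod_scale k (dprod_scale l x) = dprod_scale (k * l) x.
Proof. by apply/functional_extensionality_dep => i; exact: scalerA. Qed.
Let scale1 : left_id 1 dprod_scale.
Proof. by move=> x; apply/functional_extensionality_dep => i; exact: scale1r. Qed.
Let scaleDr : right_distributive dprod_scale +%R.
Proof. by move=> k x y; apply/functional_extensionality_dep => i; exact: scalerDr. Qed.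
Let scaleDl x : {morph dprod_scale^~ x : k l / k + l}.
Proof. by move=> k l; apply/functional_extensionality_dep => i; exact: scalerDl. Qed.

HB.instance Definition _ :=
  GRing.Zmodule_isLmodule.Build K dprod scaleA scale1 scaleDr scaleDl.

End dprod.

Section reduced_product.
Variables (R : realType) (I : Type) (D : I -> cstarAlgType R).
Variables (F : set_system I) (FF : Filter F).

Local Notation V := (dprod (fun i => D i : lmodType R[i])).
Implicit Types x y : V.

Definition rp_mem : set V := [set x | exists r, F [set i | cnorm (x i) <= r]].
(** The condition [0 <= r] keeps the set bounded below even when [F] contains the empty set, as
    happens over an empty index type: the zero algebra has no characters. *)
Definition rp_bounds x : set R := [set r | 0 <= r /\ F [set i | cnorm (x i) <= r]].
(** The limit superior of the norms along [F]; the supremum norm when only the whole index set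
    belongs to [F]. *)
Definition rp_norm x : R := inf (rp_bounds x).
Definition rp_mul x y : V := fun i => x i * y i.
Definition rp_star x : V := fun i => star (x i).

Lemma rp_memP x : rp_mem x -> exists r, rp_bounds x r.
Proof.
move=> [r Fr]; exists `|r|; split=> //; apply: filterS Fr => i /le_trans; apply.
exact: ler_norm.
Qed.

Lemma rp_norm_le x r : rp_bounds x r -> rp_norm x <= r.
Proof. by move=> xr; apply: ge_inf => //; exists 0 => s []. Qed.

Lemma rp_norm_ge0 x : rp_mem x -> 0 <= rp_norm x.
Proof. by move=> /rp_memP[r xr]; apply: lb_le_inf; [exists r|move=> s []]. Qed.

Lemma rp_norm_near x r : rp_mem x -> rp_norm x < r -> rp_bounds x r.
Proof.
move=> xm xr; split; first by rewrite ltW// (le_lt_trans (rp_norm_ge0 xm)).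
have [|s [s0 Fs] sr] := inf_lt _ xr.
  by have [s ?] := rp_memP xm; exists s.
by apply: filterS Fs => i /le_trans; apply; exact: ltW.
Qed.

Lemma rp_norm_near_add x e : rp_mem x -> 0 < e -> rp_bounds x (rp_norm x + e).
Proof. by move=> xm e0; apply: rp_norm_near; rewrite ?ltrDl. Qed.

Lemma rp_norm_bound x y (C : R) : 0 <= C -> rp_mem x ->
  F [set i | cnorm (y i) <= C * cnorm (x i)] -> rp_norm y <= C * rp_norm x.
Proof.
move=> C0 xm Fxy; apply/ler_addgt0Pr => e e0.
have C1 : 0 < C + 1 by rewrite ltr_wpDl.
have [r0 Fr] := rp_norm_near_add xm (divr_gt0 e0 C1).
apply: (le_trans (rp_norm_le (r := C * (rp_norm x + e / (C + 1))) _)).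
  split; first by rewrite mulr_ge0.
  by apply: filterS2 Fxy Fr => i /= /le_trans yx xr; apply: yx; rewrite ler_wpM2l.
by rewrite mulrDr lerD2l mulrCA ler_piMr ?(ltW e0)// ler_pdivrMr// mul1r lerDl.
Qed.

Lemma rp_mem_bound x y (C : R) : 0 <= C -> rp_mem x ->
  F [set i | cnorm (y i) <= C * cnorm (x i)] -> rp_mem y.
Proof.
move=> C0 /rp_memP[r [r0 Fr]] Fxy; exists (C * r).
by apply: filterS2 Fxy Fr => i /= /le_trans yx xr; apply: yx; rewrite ler_wpM2l.
Qed.

Lemma rp_norm_sub0 x y : F [set i | x i = y i] -> rp_norm (x - y) = 0.
Proof.
move=> Fxy; have b0 : rp_bounds (x - y) 0.
  split=> //; apply: filterS Fxy => i /= xy.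
  by rewrite -[(x - y) i]/(x i - y i) xy subrr cnorm0.
by apply/eqP; rewrite eq_le rp_norm_le// rp_norm_ge0//; exists 0; case: b0.
Qed.

Lemma rp_memD x y : rp_mem x -> rp_mem y -> rp_mem (x + y).
Proof.
move=> [r Fr] [s Fs]; exists (r + s); apply: filterS2 Fr Fs => i /= xr ys.
by rewrite (le_trans (cnormD _ _))// lerD.
Qed.

Lemma rp_memZ k x : rp_mem x -> rp_mem (k *: x).
Proof.
move=> xm; apply: (rp_mem_bound (C := complex.Re `|k|) _ xm).
  exact: Re_norm_ge0.
by apply: filterE => i /=; rewrite cnormZ.
Qed.

Lemma rp_memM x y : rp_mem x -> rp_mem y -> rp_mem (rp_mul x y).
Proof.
move=> /rp_memP[r [r0 Fr]] /rp_memP[s [s0 Fs]]; exists (r * s).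
by apply: filterS2 Fr Fs => i /= xr ys; exact: cnormM_le.
Qed.

Lemma rp_memJ x : rp_mem x -> rp_mem (rp_star x).
Proof.
move=> xm; apply: (rp_mem_bound ler01 xm).
by apply: filterE => i /=; rewrite cnormJ mul1r.
Qed.

Lemma rp_mem1 : rp_mem (fun i => 1).
Proof. by exists 1; apply: filterE => i /=; exact: cnorm1_le1. Qed.

Lemma rp_mem0 : rp_mem 0.
Proof. by exists 0; apply: filterE => i /=; rewrite cnorm0. Qed.

Lemma rp_normD x y : rp_mem x -> rp_mem y -> rp_norm (x + y) <= rp_norm x + rp_norm y.
Proof.
move=> xm ym; apply/ler_addgt0Pr => e e0.
have e20 : 0 < e / 2 by rewrite divr_gt0.
have [r0 Fr] := rp_norm_near_add xm e20.
have [s0 Fs] := rp_norm_near_add ym e20.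
rewrite (le_trans (rp_norm_le (r := rp_norm x + e / 2 + (rp_norm y + e / 2)) _))//.
  split; first by rewrite addr_ge0.
  apply: filterS2 Fr Fs => i /= xr ys.
  by rewrite (le_trans (cnormD _ _))// lerD.
by rewrite addrACA -splitr.
Qed.

Lemma rp_normZ k x : rp_mem x -> rp_norm (k *: x) = complex.Re `|k| * rp_norm x.
Proof.
have le l y : rp_mem y -> rp_norm (l *: y) <= complex.Re `|l| * rp_norm y.
  move=> ym; apply: rp_norm_bound => //; first exact: Re_norm_ge0.
  by apply: filterE => i /=; rewrite cnormZ.
move=> xm; apply/eqP; rewrite eq_le le//.
have [->|k0] := eqVneq k 0.
  by rewrite normr0 mul0r rp_norm_ge0//; exact: rp_memZ.
have := le k^-1 (k *: x) (rp_memZ k xm).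
rewrite scalerA mulVf// scale1r => h.
rewrite (le_trans (ler_wpM2l (Re_norm_ge0 k) h))// mulrA.
have -> : complex.Re `|k| * complex.Re `|k^-1| = 1.
  by rewrite -Re_normM divff// normr1.
by rewrite mul1r.
Qed.

Lemma rp_normM x y : rp_mem x -> rp_mem y ->
  rp_norm (rp_mul x y) <= rp_norm x * rp_norm y.
Proof.
move=> xm ym; apply/ler_addgt0Pr => e e0.
set a := rp_norm x; set b := rp_norm y.
have a0 : 0 <= a := rp_norm_ge0 xm; have b0 : 0 <= b := rp_norm_ge0 ym.
(* As [c <= 1], the product (a + c) (b + c) = a b + c (a + b + c) exceeds a b by at most c (a + b +
   1) <= e. *)
pose c := Num.min 1 (e / (a + b + 1)).
have s0 : 0 < a + b + 1 by rewrite ltr_wpDl// addr_ge0.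
have c0 : 0 < c by rewrite lt_min ltr01 divr_gt0.
have c1 : c <= 1 by rewrite ge_min lexx.
have ce : c * (a + b + 1) <= e.
  by rewrite -ler_pdivlMr// ge_min lexx orbT.
have [r0 Fr] := rp_norm_near_add xm c0.
have [t0 Fs] := rp_norm_near_add ym c0.
rewrite (le_trans (rp_norm_le (r := (a + c) * (b + c)) _))//.
  split; first by rewrite mulr_ge0.
  by apply: filterS2 Fr Fs => i /= xr ys; exact: cnormM_le.
by nra.
Qed.

Lemma rp_normJ x : rp_mem x -> rp_norm (rp_star x) = rp_norm x.
Proof.
move=> _; congr inf; rewrite /rp_bounds; congr ([set r | _ /\ F _]).
by apply/funext => r; apply/funext => i /=; rewrite cnormJ.
Qed.

Lemma rp_normJM x : rp_mem x -> rp_norm (rp_mul (rp_star x) x) = rp_norm x ^+ 2.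
Proof.
move=> xm; have xJm := rp_memJ xm; have xJMm := rp_memM xJm xm.
apply/eqP; rewrite eq_le; apply/andP; split.
  by apply: (le_trans (rp_normM xJm xm)); rewrite rp_normJ// expr2.
apply/ler_addgt0Pr => e e0; set q := rp_norm (rp_mul _ _).
have q0 : 0 <= q := rp_norm_ge0 xJMm.
have [r0 Fr] := rp_norm_near_add xJMm e0.
rewrite -[leRHS]sqr_sqrtr// ler_pXn2r ?nnegrE ?sqrtr_ge0 ?rp_norm_ge0//.
apply: rp_norm_le; split; first exact: sqrtr_ge0.
apply: filterS Fr => i /=; rewrite cnormJM => h.
by rewrite -[cnorm (x i)]ger0_norm ?cnorm_ge0// -sqrtr_sqr ler_wsqrtr.
Qed.

(* The increments of the sequence are set to zero wherever they are large, which
   changes no class and makes the partial sums converge in every factor. *)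
Lemma rp_complete (u : nat -> V) : (forall n, rp_mem (u n)) ->
  (forall n, rp_norm (u n.+1 - u n) <= 2^-1 ^+ n) ->
  exists2 l, rp_mem l & forall e : R, 0 < e ->
    exists N, forall n, (N <= n)%N -> rp_norm (u n - l) < e.
Proof.
(* The factor 2 puts the seminorm of an increment strictly below [b n], so that [b n] is an eventual
   bound. *)
move=> um uB; pose b n : R := 2 * 2^-1 ^+ n.
pose c n i : D i := if cnorm ((u n.+1 - u n) i) <= b n then (u n.+1 - u n) i else 0.
pose y n i : D i := u 0%N i + \sum_(k < n) c k i.
have h20 : 0 <= 2^-1 :> R by lra.
have h21 : 2^-1 < 1 :> R by lra.
have b0 n : 0 <= b n by rewrite mulr_ge0// exprn_ge0.
have yB i n : cnorm (y n.+1 i - y n i) <= 2 * 2^-1 ^+ n.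
  rewrite /y big_ord_recr/= addrA [_ + c _ _]addrC addrK /c; case: ifP => // _.
  by rewrite cnorm0 b0.
have /dependent_choice[l ul] : forall i, exists l : D i,
    forall n, cnorm (l - y n i) <= 4 * 2^-1 ^+ n.
  move=> i; have [l _ lB] := geometric_ncvg (ler0n R 2) h20 h21 (yB i).
  exists l => n; rewrite (le_trans (lB n))// ler_wpM2r ?exprn_ge0//.
  by rewrite ler_pdivrMr; lra.
have yu n : F [set i | y n i = u n i].
  elim: n => [|n IH]; first by apply: filterE => i /=; rewrite /y big_ord0 addr0.
  have [_ Fn] : rp_bounds (u n.+1 - u n) (b n).
    apply: rp_norm_near; first by apply: rp_memD => //; rewrite -scaleN1r; exact: rp_memZ.
    by rewrite (le_lt_trans (uB n))// /b ltr_pMl ?ltr1n// exprn_gt0.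
  apply: filterS2 IH Fn => i /= IH Fn.
  rewrite /y big_ord_recr/= addrA -/(y n i) IH /c Fn.
  by rewrite -[(u n.+1 - u n) i]/(u n.+1 i - u n i) addrC subrK.
pose l' : V := l.
have lu n : F [set i | cnorm ((u n - l') i) <= 4 * 2^-1 ^+ n].
  apply: filterS (yu n) => i /= yui; rewrite -[(u n - l') i]/(u n i - l i) -yui.
  by rewrite cnormB.
exists l'.
  have [r Fr] := um 0%N.
  exists (r + 4 * 2^-1 ^+ 0); apply: filterS2 Fr (lu 0%N) => i /= ur lr.
  have -> : l' i = u 0%N i - (u 0%N - l') i.
    by rewrite -[(u 0%N - l') i]/(u 0%N i - l i) opprB addrC subrK.
  exact: cnormB_le.
move=> e e0; have [N h] := geometric_lt (ler0n R 4) h20 h21 e0; exists N => n Nn.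
rewrite (le_lt_trans _ (h n Nn))//; apply: rp_norm_le; split; last exact: lu.
by rewrite mulr_ge0// exprn_ge0.
Qed.

End reduced_product.

(** * Legs of colimits are isometric and dense *)

Section reduced_product_algebra.
Variables (R : realType) (I : Type) (D : I -> cstarAlgType R).
Variables (F : set_system I) (FF : Filter F).

Local Notation V := (dprod (fun i => D i : lmodType R[i])).
Local Notation funext_dep := functional_extensionality_dep.
Implicit Types x y : V.

Let mulA : associative (@rp_mul R I D).
Proof. by move=> x y z; apply/funext_dep => i; exact: mulrA. Qed.
Let mul1 : left_id ((fun=> 1) : V) (@rp_mul R I D).
Proof. by move=> x; apply/funext_dep => i; exact: mul1r. Qed.
Let mulx1 : right_id ((fun=> 1) : V) (@rp_mul R I D).
Proof. by move=> x; apply/funext_dep => i; exact: mulr1. Qed.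
Let mulDl : left_distributive (@rp_mul R I D) +%R.
Proof. by move=> x y z; apply/funext_dep => i; exact: mulrDl. Qed.
Let mulDr : right_distributive (@rp_mul R I D) +%R.
Proof. by move=> x y z; apply/funext_dep => i; exact: mulrDr. Qed.
Let mulZl k x y : rp_mul (k *: x) y = k *: rp_mul x y.
Proof. by apply/funext_dep => i; exact/esym/scaleAl. Qed.
Let mulZr k x y : rp_mul x (k *: y) = k *: rp_mul x y.
Proof. by apply/funext_dep => i; exact/esym/scaleAr. Qed.
Let starKx : involutive (@rp_star R I D).
Proof. by move=> x; apply/funext_dep => i; exact: starK. Qed.
Let starDx : {morph (@rp_star R I D) : x y / x + y}.
Proof. by move=> x y; apply/funext_dep => i; exact: starD. Qed.
Let starZx k x : rp_star (k *: x) = k^*%C *: rp_star x.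
Proof. by apply/funext_dep => i; exact: starZ. Qed.
Let starMx x y : rp_star (rp_mul x y) = rp_mul (rp_star y) (rp_star x).
Proof. by apply/funext_dep => i; exact: starM. Qed.

Definition rp_pre : pre_cstar R := @PreCstar R V (fun=> 1) (@rp_mul R I D)
  (@rp_star R I D) (rp_mem F) (rp_norm F) mulA mul1 mulx1 mulDl mulDr mulZl mulZr
  starKx starDx starZx starMx (rp_mem0 D FF) (@rp_memD R I D F FF)
  (@rp_memZ R I D F FF) (rp_mem1 D FF) (@rp_memM R I D F FF) (@rp_memJ R I D F FF)
  (@rp_norm_ge0 R I D F FF) (@rp_normD R I D F FF) (@rp_normZ R I D F FF)
  (@rp_normM R I D F FF) (@rp_normJ R I D F) (@rp_normJM R I D F FF)
  (@rp_complete R I D F FF).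

Definition redprod : cstarAlgType R := sep_alg rp_pre.

Definition rp x : redprod := sepq (V := rp_pre) x.

Lemma rpD x y : rp_mem F x -> rp_mem F y -> rp (x + y) = rp x + rp y.
Proof. exact: (@sepqD R rp_pre). Qed.

Lemma rpZ k x : rp_mem F x -> rp (k *: x) = k *: rp x.
Proof. exact: (@sepqZ R rp_pre). Qed.

Lemma rpM x y : rp_mem F x -> rp_mem F y -> rp (rp_mul x y) = rp x * rp y.
Proof. exact: (@sepqM R rp_pre). Qed.

Lemma rpJ x : rp_mem F x -> rp (rp_star x) = star (rp x).
Proof. exact: (@sepqJ R rp_pre). Qed.

Lemma rp1 : rp (fun=> 1) = 1. Proof. exact: (@sepq1 R rp_pre). Qed.

Lemma rpB x y : rp_mem F x -> rp_mem F y -> rp (x - y) = rp x - rp y.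
Proof. exact: (@sepqB R rp_pre). Qed.

Lemma cnorm_rp x : rp_mem F x -> cnorm (rp x) = rp_norm F x.
Proof. exact: (@cnorm_sepq R rp_pre). Qed.

Lemma rp_surj (b : redprod) : exists2 x, rp_mem F x & rp x = b.
Proof. exact: (@sepq_surj R rp_pre). Qed.

Lemma eq_rp x y : rp_mem F x -> rp_mem F y -> F [set i | x i = y i] -> rp x = rp y.
Proof. by move=> xm ym xy; apply: (@eq_sep R rp_pre) => //; exact: rp_norm_sub0. Qed.

Lemma redprod_commutative : (forall i, commutative_cstar (D i)) ->
  commutative_cstar redprod.
Proof.
move=> cD a b; have [x xm <-] := rp_surj a; have [y ym <-] := rp_surj b.
rewrite !cmulE -!rpM//; congr rp; apply/funext_dep => i; exact: cD.
Qed.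

End reduced_product_algebra.

(* Closure properties shared by the classes of all and of commutative
   C*-algebras. *)
Record stable_class (R : realType) (P : cstarAlgType R -> Prop) : Prop := StableClass {
  stable_isometric : forall (A B : cstarAlgType R) (f : starHom A B),
    isometric f -> P B -> P A ;
  stable_redprod : forall (I : Type) (D : I -> cstarAlgType R) (F : set_system I)
    (FF : Filter F), (forall i, P (D i)) -> P (redprod D FF) ;
  stable_commutative : forall A : cstarAlgType R, commutative_cstar A -> P A
}.

Lemma stable_unital (R : realType) : stable_class (@unital_cstar R).
Proof. by []. Qed.

Lemma stable_commutative_cstar (R : realType) : stable_class (@commutative_cstar R).
Proof.
split=> // [A B f fi cB x y|I D F FF cD]; last exact: redprod_commutative.
by apply: (isometric_inj fi); rewrite !cmulE !starhomME -!cmulE cB.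
Qed.

Section colimit_legs.
Variables (R : realType) (P : cstarAlgType R -> Prop) (SP : stable_class P).
Context d (I : porderType d) (D : cstar_diagram R I).
Hypothesis dirI : directed_poset I.
Hypothesis PD : forall i, P (D i).
Hypothesis D_iso : forall (i j : I) (ij : (i <= j)%O), isometric (dmap D ij).

Definition tails : set_system I := [set U | exists i, forall j, (i <= j)%O -> U j].

Lemma tails_filter : Filter tails.
Proof.
split.
- by have [i0] := dirI.1; exists i0.
- move=> U V [i Ui] [j Vj]; have [k [ik jk]] := dirI.2 i j.
  by exists k => l kl; split; [apply: Ui|apply: Vj]; exact: le_trans kl.
- by move=> U V UV [i Ui]; exists i => j /Ui; exact: UV.
Qed.

(** The value 0 off the tail of [i] does not affect the class in the reduced product. *)
Definition tail_section i (a : D i) : dprod (fun i => D i : lmodType R[i]) :=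
  fun j => if pselect (i <= j)%O is left ij then dmap D ij a else 0.

Lemma tail_sectionE i (a : D i) j (ij : (i <= j)%O) : tail_section a j = dmap D ij a.
Proof.
by rewrite /tail_section; case: pselect => // ij'; congr (dmap D _ a); exact: bool_irrelevance.
Qed.

Lemma tail_section_mem i (a : D i) : rp_mem tails (tail_section a).
Proof.
exists (cnorm a); exists i => j ij; rewrite /= (tail_sectionE a ij).
exact: starhom_contractive.
Qed.

Let FF := tails_filter.

Lemma tail_hom_ex i : exists f : starHom (D i) (redprod D FF),
  forall a, f a = rp FF (tail_section a).
Proof.
have m (a : D i) := tail_section_mem a.
have mD (a b : D i) : rp_mem tails (tail_section a + tail_section b) by exact: rp_memD.
have mZ k (a : D i) : rp_mem tails (k *: tail_section a) by exact: rp_memZ.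
have mM (a b : D i) : rp_mem tails (rp_mul (tail_section a) (tail_section b)).
  exact: rp_memM.
have mJ (a : D i) : rp_mem tails (rp_star (tail_section a)) by exact: rp_memJ.
apply: starhom_ex => [k x y||x y|x].
- rewrite -rpZ// -rpD//; apply: eq_rp => //; first exact: rp_memD.
  exists i => j ij /=; rewrite (tail_sectionE _ ij) starhomDE starhomZE.
  by rewrite -!(tail_sectionE _ ij).
- rewrite -rp1; apply: eq_rp => //; first exact: rp_mem1.
  by exists i => j ij /=; rewrite (tail_sectionE _ ij) starhom1E.
- rewrite -rpM//; apply: eq_rp => //.
  by exists i => j ij /=; rewrite /rp_mul !(tail_sectionE _ ij) starhomME.
- rewrite -rpJ//; apply: eq_rp => //.
  by exists i => j ij /=; rewrite /rp_star !(tail_sectionE _ ij) starhomJE.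
Qed.

Variables (L : cstarAlgType R) (leg : forall i, starHom (D i) L).
Hypothesis colim : cstar_colimit P leg.

Lemma colimit_isometric i : isometric (leg i).
Proof.
have [PL legE U] := colim.
have [f fE] := dependent_choice tail_hom_ex.
have [i' j ij x|u [uE _]] := U _ f (stable_redprod SP FF PD).
  rewrite !fE; apply: eq_rp; [exact: tail_section_mem|exact: tail_section_mem|].
  exists j => k jk; rewrite /= (tail_sectionE _ jk) (tail_sectionE _ (le_trans ij jk)).
  exact: dmap_comp.
(* One inequality is contractivity of the leg. For the other, [f i a] is the image of [leg i a]
   under the contraction [u], and its norm is at least [cnorm a]. *)
apply: cnorm_isometric => a; apply/eqP; rewrite eq_le starhom_contractive/=.
apply: (@le_trans _ _ (cnorm (f i a))); last by rewrite -uE starhom_contractive.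
rewrite fE cnorm_rp; last exact: tail_section_mem.
have [r ar] := rp_memP FF (tail_section_mem a).
(* An eventual bound holds at some index above [i], where the section has norm exactly [cnorm a]. *)
apply: lb_le_inf; first by exists r.
move=> s [_ [j sj]]; have [k [ik jk]] := dirI.2 i j.
by have := sj k jk; rewrite /= (tail_sectionE _ ik) isometric_cnorm.
Qed.

Lemma colimit_dense (y : L) : leg_closure leg y.
Proof.
have [PL legE U] := colim.
pose S : set L := leg_closure leg.
have S_leg i a : S (leg i a) by move=> r r0; exists i, a; rewrite subrr cnorm0.
have Sclosed u l : (forall n, S (u n)) -> ncvg u l -> S l.
  move=> Su ul r r0; have r20 : 0 < r / 2 by rewrite divr_gt0.
  have [N h] := ul _ r20; have [i [a ax]] := Su N _ r20.
  exists i, a; rewrite (le_lt_trans (cnorm_triangle _ (u N) _))// (splitr r) ltrD//.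
  exact: h.
have seq2 := leg_closure_seq2 dirI legE.
have [|x z Sx Sz|k x Sx|x z Sx Sz|x Sx||B [j [ji jS]]] := @subalgebra_ex R L S.
- by have [i0] := dirI.1; rewrite -(starhom1E (leg i0)).
- have [i [a [b [ax bz]]]] := seq2 _ _ Sx Sz.
  by apply: Sclosed (ncvgD ax bz) => n; rewrite -starhomDE.
- have [i [a [b [ax _]]]] := seq2 _ _ Sx Sx.
  by apply: Sclosed (ncvgZ k ax) => n; rewrite -starhomZE.
- have [i [a [b [ax bz]]]] := seq2 _ _ Sx Sz.
  by apply: Sclosed (ncvgM ax bz) => n; rewrite -starhomME.
- have [i [a [b [ax _]]]] := seq2 _ _ Sx Sx.
  by apply: Sclosed (ncvgJ ax) => n; rewrite -starhomJE.
- exact: Sclosed.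
have /dependent_choice[g gE] : forall i, exists g : starHom (D i) B,
    forall a, j (g a) = leg i a.
  by move=> i; apply: lift_isometric => // a; apply/jS.
have [k l kl x|u [uE _]] := U B g (stable_isometric SP ji PL).
  by apply: (isometric_inj ji); rewrite !gE legE.
(* The identity and [j] after [u] both factor the legs through [L], so both equal the unique such
   [w], and [j] is surjective. *)
have [w [wE wU]] := U L leg PL legE.
have [|||id1 idE'] := @starhom_ex R L L idfun _ erefl; [by []|by []|by []|].
have idE : id1 =1 w by apply: wU => i x; rewrite idE'.
have juE : starhom_comp j u =1 w.
  by apply: wU => i x; rewrite /= uE gE.
have : S y; last by exact.
by apply/jS; exists (u y); rewrite [LHS](juE y) -idE idE'.
Qed.

End colimit_legs.

(** * Characters of commutative C*-algebras *)

(* An alias carrying a commutative ring structure, so that [ring] applies. *)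
Definition comalg (R : realType) (A : cstarAlgType R) (cA : commutative_cstar A) :
  Type := A.

Section comalg_instances.
Variables (R : realType) (A : cstarAlgType R) (cA : commutative_cstar A).

HB.instance Definition _ := CStarAlgebra.copy (comalg cA) A.
HB.instance Definition _ := GRing.PzRing.copy (comalg cA) A.
HB.instance Definition _ := GRing.PzRing_hasCommutativeMul.Build (comalg cA) cA.

End comalg_instances.

Definition character (R : realType) (A : cstarAlgType R) (chi : A -> R[i]) : Prop :=
  [/\ forall (k : R[i]) x y, chi (k *: x + y) = k * chi x + chi y, chi 1 = 1,
    forall x y, chi (x * y) = chi x * chi y &
    forall x, chi (star x) = (chi x)^*%C].

Section scalar_elements.
Variables (R : realType) (A : cstarAlgType R).
Implicit Types (k l : R[i]) (r s : R).

(** Turns the scalar action into multiplication by an element, which [ring] on [comalg] can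
    handle. *)
Definition sc k : A := k *: (1 : A).

Lemma scD k l : sc (k + l) = sc k + sc l. Proof. exact: scalerDl. Qed.
Lemma scB k l : sc (k - l) = sc k - sc l. Proof. exact: scalerBl. Qed.
Lemma scN k : sc (- k) = - sc k. Proof. exact: scaleNr. Qed.
Lemma sc0 : sc 0 = 0. Proof. exact: scale0r. Qed.
Lemma sc1 : sc 1 = 1. Proof. exact: scale1r. Qed.
Lemma sc_mul k (x : A) : sc k * x = k *: x.
Proof. by rewrite /sc -scaleAl mul1r. Qed.
Lemma scM k l : sc (k * l) = sc k * sc l.
Proof. by rewrite sc_mul /sc scalerA. Qed.
Lemma star_sc k : star (sc k) = sc k^*%C.
Proof. by rewrite /sc starZ star1. Qed.

Lemma sc_ii : sc 'i%C * sc 'i%C = -1.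
Proof. by rewrite -scM -expr2 sqr_i scN sc1. Qed.

Definition rc r : A := sc r%:C.

Lemma rcD r s : rc (r + s) = rc r + rc s. Proof. by rewrite /rc rmorphD scD. Qed.
Lemma rcB r s : rc (r - s) = rc r - rc s. Proof. by rewrite /rc rmorphB scB. Qed.
Lemma rcN r : rc (- r) = - rc r. Proof. by rewrite /rc rmorphN scN. Qed.
Lemma rc0 : rc 0 = 0. Proof. exact: sc0. Qed.
Lemma rc1 : rc 1 = 1. Proof. exact: sc1. Qed.
Lemma rcM r s : rc (r * s) = rc r * rc s. Proof. by rewrite /rc rmorphM scM. Qed.
Lemma rc_mul r (x : A) : rc r * x = r%:C *: x. Proof. exact: sc_mul. Qed.
Lemma rc_sa r : selfadj (rc r).
Proof. by rewrite /selfadj star_sc conjc_real. Qed.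
Lemma cnorm_rc r : 0 <= r -> cnorm (rc r) <= r.
Proof. by move=> r0; rewrite cnormZr ger0_norm// ler_piMr// cnorm1_le1. Qed.
Lemma rcV r : r != 0 -> rc r * rc r^-1 = 1.
Proof. by move=> r0; rewrite -rcM divff// rc1. Qed.
Lemma rc_sqrt r : 0 <= r -> rc (Num.sqrt r) * rc (Num.sqrt r) = rc r.
Proof. by move=> r0; rewrite -rcM -expr2 sqr_sqrtr. Qed.

End scalar_elements.

Section selfadjoint.
Variables (R : realType) (A : cstarAlgType R).
Implicit Types x y : A.

Lemma selfadjD x y : selfadj x -> selfadj y -> selfadj (x + y).
Proof. by rewrite /selfadj starD => -> ->. Qed.

Lemma selfadjB x y : selfadj x -> selfadj y -> selfadj (x - y).
Proof. by rewrite /selfadj starJB => -> ->. Qed.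

Lemma selfadjN x : selfadj x -> selfadj (- x).
Proof. by rewrite /selfadj starN => ->. Qed.

Lemma selfadjZ (r : R) x : selfadj x -> selfadj (r%:C *: x).
Proof. by rewrite /selfadj starZr => ->. Qed.

Lemma selfadj1 : selfadj (1 : A). Proof. exact: star1. Qed.

Lemma cnorm_sa_sq x : selfadj x -> cnorm (x * x) = cnorm x ^+ 2.
Proof. by move=> xs; rewrite -cnormJM xs. Qed.

Lemma selfadj_decomposition (a : A) :
  exists x y, [/\ selfadj x, selfadj y & a = x + 'i%C *: y].
Proof.
pose h := (2^-1 : R)%:C.
exists (h *: (a + star a)), (h *: (- 'i%C *: (a - star a))); split.
- by apply: selfadjZ; rewrite /selfadj starD starK addrC.
- have ci : (- 'i%C)^*%C = 'i%C :> R[i].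
    by apply/eqP; rewrite eq_complex /= !oppr0 opprK !eqxx.
  apply: selfadjZ; rewrite /selfadj starZ starJB starK ci.
  by rewrite -opprB scalerN scaleNr.
- have ih : 'i%C * h * - 'i%C = h by rewrite mulrN mulrAC -expr2 sqr_i mulN1r opprK.
  by rewrite !scalerA ih -scalerDr addrACA subrr addr0 half_add.
Qed.

End selfadjoint.

Section gelfand.
Variables (R : realType) (A0 : cstarAlgType R) (cA : commutative_cstar A0).
Local Notation A := (comalg cA).
Implicit Types x y z a b p q : A.

(* [x^2 + y^2 = z^* z] for [z = x + i y]. *)
Lemma cnorm_sum_squares x y : selfadj x -> selfadj y ->
  cnorm (x * x) <= cnorm (x * x + y * y).
Proof.
move=> xs ys; pose z : A := x + 'i%C *: y.
have zs : star z = x - 'i%C *: y by rewrite starD starZ xs ys conjc_i scaleNr.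
have -> : x * x + y * y = star z * z.
  have -> : y * y = - ((sc A 'i%C * y) * (sc A 'i%C * y)).
    have -> : sc A 'i%C * y * (sc A 'i%C * y) = (sc A 'i%C * sc A 'i%C) * (y * y) by ring.
    by rewrite sc_ii mulN1r opprK.
  by rewrite zs /z -sc_mul; ring.
rewrite cnormJM cnorm_sa_sq// ler_pXn2r ?nnegrE ?cnorm_ge0//.
have {1}-> : x = (2^-1 : R)%:C *: (z + star z).
  by rewrite zs /z addrACA subrr addr0 half_add.
rewrite cnormZr ger0_norm ?invr_ge0// ler_pdivrMl// mulr_natl mulr2n.
by rewrite (le_trans (cnormD _ _))// cnormJ.
Qed.

Inductive sos : A -> Prop :=
| sos0 : sos 0
| sos_cons x y : selfadj x -> sos y -> sos (x * x + y).

Lemma sos_sq x : selfadj x -> sos (x * x).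
Proof. by move=> xs; rewrite -[x * x]addr0; exact: sos_cons sos0. Qed.

Lemma sosD p q : sos p -> sos q -> sos (p + q).
Proof.
by move=> sp sq; elim: sp => [|x y xs _ IH]; rewrite ?add0r// -addrA; exact: sos_cons.
Qed.

Lemma selfadj_mul x y : selfadj x -> selfadj y -> selfadj (x * y).
Proof. by rewrite /selfadj starJM => -> ->; exact: mulrC. Qed.

Lemma sosM p q : sos p -> sos q -> sos (p * q).
Proof.
move=> sp sq; elim: sp => [|x y xs _ IH]; first by rewrite mul0r; exact: sos0.
rewrite mulrDl; apply: sosD => //.
elim: sq => [|x' y' xs' _ IH']; first by rewrite mulr0; exact: sos0.
rewrite mulrDr; apply: sosD => //.
have -> : x * x * (x' * x') = (x * x') * (x * x') by ring.
by apply: sos_sq; exact: selfadj_mul.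
Qed.

Lemma sos_sa p : sos p -> selfadj p.
Proof.
elim=> [|x y xs _ IH]; first exact: star0.
by apply: selfadjD => //; exact: selfadj_mul.
Qed.

Lemma sos_rc r : 0 <= r -> sos (rc A r).
Proof. by move=> r0; rewrite -rc_sqrt//; apply: sos_sq; exact: rc_sa. Qed.

Lemma sos_hs a : sos (star a * a).
Proof.
have [x [y [xs ys ->]]] := selfadj_decomposition a.
have -> : star (x + 'i%C *: y) * (x + 'i%C *: y) = x * x + y * y.
  rewrite starD starZ xs ys conjc_i scaleNr -sc_mul.
  have -> : (x - sc A 'i%C * y) * (x + sc A 'i%C * y) =
    x * x - (sc A 'i%C * sc A 'i%C) * (y * y) by ring.
  by rewrite sc_ii mulN1r opprK.
by apply: sosD; exact: sos_sq.
Qed.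

(** [rc A r - x] is [r] times [1 - x / r], and both factors have self-adjoint square roots. *)
Lemma square_1sub x r : selfadj x -> cnorm x < r ->
  exists2 w, selfadj w & w * w = rc A r - x.
Proof.
move=> xs xr; have r0 : 0 < r by rewrite (le_lt_trans (cnorm_ge0 x)).
have [|w [ww ws _]] := @sqrt_1sub R A (r^-1%:C *: x).
  by rewrite cnormZr ger0_norm ?invr_ge0 ?(ltW r0)// ltr_pdivrMl// mulr1.
exists (rc A (Num.sqrt r) * w).
  by apply: selfadj_mul; [exact: rc_sa|apply: ws; exact: selfadjZ].
have -> : rc A (Num.sqrt r) * w * (rc A (Num.sqrt r) * w) =
  (rc A (Num.sqrt r) * rc A (Num.sqrt r)) * (w * w) by ring.
rewrite rc_sqrt ?(ltW r0)// ww -rc_mul mulrBr mulr1 mulrA rcV ?gt_eqF//.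
by rewrite mul1r.
Qed.

(** A norm form of positivity that is stable under sums by the triangle inequality. For one square,
    [s - x^2] is a square [w^2], and [cnorm_sum_squares] bounds |w^2| by |w^2 + x^2| = |s 1| <=
    s. *)
Lemma sos_near p : sos p -> exists2 r, 0 <= r & cnorm (rc A r - p) <= r.
Proof.
elim=> [|x y xs _ [r r0 yr]].
  by exists 0 => //; rewrite rc0 subrr cnorm0.
pose s := cnorm (x * x) + 1.
have s0 : 0 < s by rewrite ltr_wpDl// cnorm_ge0.
have [|w ws ww] := @square_1sub (x * x) s (selfadj_mul xs xs); first by rewrite ltrDl.
exists (s + r); first by rewrite addr_ge0// ltW.
rewrite rcD opprD addrACA (le_trans (cnormD _ _))// lerD//.
rewrite -ww (le_trans (cnorm_sum_squares ws xs))// ww subrK cnorm_rc//.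
exact: ltW.
Qed.

(** [p + e] is (r + e) - (r - p) with |r - p| <= r < r + e, so [square_1sub] applies. *)
Lemma sos_square_eps p (e : R) : sos p -> 0 < e ->
  exists2 w, selfadj w & w * w = p + rc A e.
Proof.
move=> sp e0; have [r r0 pr] := sos_near sp.
have [||w ws ww] := @square_1sub (rc A r - p) (r + e).
- by apply: selfadjB; [exact: rc_sa|exact: sos_sa].
- by rewrite (le_lt_trans pr)// ltrDl.
exists w => //; rewrite ww rcD; ring.
Qed.

Lemma sos_mono p q : sos p -> sos q -> cnorm p <= cnorm (p + q).
Proof.
move=> sp sq; apply/ler_addgt0Pr => e e0.
(* [p] and [q] are squares minus e/3; one such error is paid for [p] and two for [p + q]. *)
have e30 : 0 < e / 3 by rewrite divr_gt0.
have [v vs vv] := sos_square_eps sp e30; have [w ws ww] := sos_square_eps sq e30.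
have ce : cnorm (rc A (e / 3)) <= e / 3 by rewrite cnorm_rc// ltW.
have -> : p = v * v - rc A (e / 3) by rewrite vv addrK.
rewrite (le_trans (cnorm_leB _ _))//.
have -> : v * v - rc A (e / 3) + q = v * v + w * w - (rc A (e / 3) + rc A (e / 3)).
  by rewrite ww; ring.
have h1 := cnorm_sum_squares vs ws.
set X := v * v + w * w in h1 *; set Y := rc A (e / 3) + rc A (e / 3).
have hX : cnorm X <= cnorm (X - Y) + cnorm Y by rewrite -{1}(subrK Y X) cnormD.
have hY : cnorm Y <= e / 3 + e / 3 by rewrite (le_trans (cnormD _ _))// lerD.
lra.
Qed.

Record preordering (T : set A) : Prop := Preordering {
  preord_sa : forall x, T x -> selfadj x ;
  preord_sq : forall x, selfadj x -> T (x * x) ;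
  preordD : forall x y, T x -> T y -> T (x + y) ;
  preordM : forall x y, T x -> T y -> T (x * y)
}.

Lemma sos_preordering : preordering sos.
Proof. split; [exact: sos_sa|exact: sos_sq|exact: sosD|exact: sosM]. Qed.

Definition adjoin (T : set A) x : set A :=
  [set y | exists p q, [/\ T p, T q & y = p + x * q]].

Section preordering_theory.
Variables (T : set A) (preT : preordering T).

Lemma preord_sos x : sos x -> T x.
Proof.
elim=> [|y z ys _ IH]; last by apply: preordD => //; exact: preord_sq.
by rewrite -(mul0r 0); apply: preord_sq => //; exact: star0.
Qed.

Lemma preord0 : T 0. Proof. by apply: preord_sos; exact: sos0. Qed.

Lemma preord1 : T 1.
Proof. by rewrite -(mul1r 1); apply: preord_sq => //; exact: star1. Qed.

Lemma adjoin_preordering x : selfadj x -> preordering (adjoin T x).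
Proof.
move=> xs; split.
- move=> _ [p [q [Tp Tq ->]]]; apply: selfadjD; first exact: preord_sa Tp.
  by apply: selfadj_mul => //; exact: preord_sa Tq.
- move=> y ys; exists (y * y), 0; split; [exact: preord_sq|exact: preord0|].
  by rewrite mulr0 addr0.
- move=> _ _ [p [q [Tp Tq ->]]] [p' [q' [Tp' Tq' ->]]].
  exists (p + p'), (q + q'); split; [exact: preordD|exact: preordD|ring].
- move=> _ _ [p [q [Tp Tq ->]]] [p' [q' [Tp' Tq' ->]]].
  exists (p * p' + x * x * (q * q')), (p * q' + q * p'); split; last ring.
    apply: preordD => //; first exact: preordM.
    by apply: preordM => //; [exact: preord_sq|exact: preordM].
  by apply: preordD => //; exact: preordM.
Qed.

Lemma adjoin_sub x : T `<=` adjoin T x.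
Proof. by move=> y Ty; exists y, 0; split=> //; [exact: preord0|rewrite mulr0 addr0]. Qed.

Lemma adjoin_mem x : adjoin T x x.
Proof. by exists 0, 1; split; [exact: preord0|exact: preord1|rewrite mulr1 add0r]. Qed.

End preordering_theory.

Lemma maximal_preordering (T0 : set A) : preordering T0 -> ~ T0 (-1) ->
  exists T, [/\ preordering T, T0 `<=` T, ~ T (-1) &
    forall x, selfadj x -> ~ adjoin T x (-1) -> T x].
Proof.
move=> pre0 n0.
(* [T0] is added to every member so that the empty chain is covered too. *)
pose P := [set X : set A | preordering (X `|` T0) /\ ~ (X `|` T0) (-1)].
have [|M [[preM nM] maxM]] := @Zorn_bigcup A P.
  move=> F FP totF; set U := \bigcup_(X in F) X.
  have sub X x : F X -> (X `|` T0) x -> (U `|` T0) x.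
    by move=> FX [Xx|]; [left; exists X|right].
  have two x y : (U `|` T0) x -> (U `|` T0) y -> (T0 x /\ T0 y) \/
      exists X, [/\ F X, (X `|` T0) x & (X `|` T0) y].
    move=> [[X FX Xx]|x0] [[Y FY Yy]|y0]; [right|right|right|by left].
    - have [XY|YX] := totF _ _ FX FY.
        by exists Y; split=> //; [left; exact: XY|left].
      by exists X; split=> //; [left|left; exact: YX].
    - by exists X; split=> //; [left|right].
    - by exists Y; split=> //; [right|left].
  split; last first.
    by move=> [[X FX X1]|//]; have [_] := FP X FX; apply; left.
  split.
  - move=> x [[X FX Xx]|/(preord_sa pre0)//].
    by apply: (preord_sa (FP X FX).1); left.
  - by move=> x xs; right; exact: preord_sq.
  - move=> x y Ux Uy; have [[x0 y0]|[X [FX Xx Xy]]] := two x y Ux Uy.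
      by right; exact: preordD.
    by apply: (sub X) => //; apply: preordD => //; exact: (FP X FX).1.
  - move=> x y Ux Uy; have [[x0 y0]|[X [FX Xx Xy]]] := two x y Ux Uy.
      by right; exact: preordM.
    by apply: (sub X) => //; apply: preordM => //; exact: (FP X FX).1.
exists (M `|` T0); split=> // x xs nx.
apply: contrapT => nMx; apply: (maxM (adjoin (M `|` T0) x)).
  split; first by move=> y My; apply: adjoin_sub => //; left.
  by move=> h; apply: nMx; left; apply: h; exact: adjoin_mem.
have adjE : adjoin (M `|` T0) x `|` T0 = adjoin (M `|` T0) x.
  by apply/setUidPl => y y0; apply: adjoin_sub => //; right.
by split; rewrite adjE; [exact: (adjoin_preordering preM xs)|exact: nx].
Qed.

Section character_of_preordering.
Variables (T : set A) (preT : preordering T) (nT : ~ T (-1)).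
Hypothesis maxT : forall x, selfadj x -> ~ adjoin T x (-1) -> T x.

Lemma preord_rc r : 0 <= r -> T (rc A r).
Proof. by move=> r0; apply: preord_sos => //; exact: sos_rc. Qed.

Lemma preord_rc_ge0 r : T (rc A r) -> 0 <= r.
Proof.
move=> Tr; rewrite leNgt; apply/negP => r0; apply: nT.
have -> : -1 = rc A (- r)^-1 * rc A r.
  by rewrite -rcM -rc1 -rcN invrN mulNr mulVf// lt_eqF.
by apply: preordM => //; apply: preord_rc; rewrite invr_ge0 oppr_ge0 ltW.
Qed.

(** Otherwise -1 = p + x q = p' - x q'. Multiplying 1 + p = - x q by 1 + p' = x q' displays -1 as p
    + p' + p p' + x^2 q q', a member of [T]. *)
Lemma preord_total x : selfadj x -> T x \/ T (- x).
Proof.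
move=> xs; apply: contrapT => /not_orP[nx nNx].
have [p [q [Tp Tq pq]]] : adjoin T x (-1) by apply: contrapT => /(maxT xs).
have [p' [q' [Tp' Tq' pq']]] : adjoin T (- x) (-1).
  by apply: contrapT => /(maxT (selfadjN xs)).
apply: nT; have -> : -1 = p + p' + p * p' + x * x * (q * q').
  have h : (1 + p) * (1 + p') = - (x * x) * (q * q').
    have -> : 1 + p = - (x * q).
      have -> : x * q = -1 - p by rewrite pq; ring.
      ring.
    have -> : 1 + p' = x * q'.
      have -> : x * q' = - (- x * q') by ring.
      have -> : - x * q' = -1 - p' by rewrite pq'; ring.
      ring.
    ring.
  have -> : x * x * (q * q') = - (- (x * x) * (q * q')) by ring.
  rewrite -h; ring.
apply: preordD => //; last first.
  by apply: preordM => //; [exact: preord_sq|exact: preordM].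
by apply: preordD => //; [exact: preordD|exact: preordM].
Qed.

(* With [T] maximal the algebra is the sum of the scalars and the infinitesimals;
   the character attached to [T] takes the scalar part. *)
Definition infinitesimal x := forall e : R, 0 < e -> T (rc A e - star x * x).

(** Parallelogram identity: with |z|^2 for [star z * z], the difference e - |x + y|^2 equals 2 (e/4
    - |x|^2) + 2 (e/4 - |y|^2) + |x - y|^2. *)
Lemma infinitesimalD x y : infinitesimal x -> infinitesimal y -> infinitesimal (x + y).
Proof.
move=> xi yi e e0; have e40 : 0 < e / 4 by rewrite divr_gt0.
have -> : rc A e - star (x + y) * (x + y) =
  ((rc A (e / 4) - star x * x) + (rc A (e / 4) - star x * x)) +
  ((rc A (e / 4) - star y * y) + (rc A (e / 4) - star y * y)) +
  star (x - y) * (x - y).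
  have -> : rc A e = rc A (e / 4) + rc A (e / 4) + rc A (e / 4) + rc A (e / 4).
    by rewrite -!rcD; congr rc; lra.
  rewrite starD starJB; ring.
have [Tx Ty] := (xi _ e40, yi _ e40).
apply: preordD => //; last by apply: preord_sos => //; exact: sos_hs.
by apply: preordD => //; exact: preordD.
Qed.

Lemma preord_bound x r : selfadj x -> cnorm x < r -> T (rc A r - x).
Proof. by move=> xs xr; have [w ws <-] := square_1sub xs xr; exact: preord_sq. Qed.

(** Infinitesimals form an ideal because [star x * x] is bounded by a scalar. *)
Lemma infinitesimalM x y : infinitesimal y -> infinitesimal (x * y).
Proof.
move=> yi e e0; pose M := cnorm (star x * x) + 1.
have M0 : 0 < M by rewrite ltr_wpDl// cnorm_ge0.
have -> : rc A e - star (x * y) * (x * y) =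
   (rc A M - star x * x) * (star y * y) + rc A M * (rc A (e / M) - star y * y).
  have -> : rc A e = rc A M * rc A (e / M) by rewrite -rcM mulrC divfK// gt_eqF.
  rewrite starJM; ring.
apply: preordD => //; apply: preordM => //.
- apply: preord_bound; last by rewrite ltrDl.
  by apply: sos_sa; exact: sos_hs.
- by apply: preord_sos => //; exact: sos_hs.
- by apply: preord_rc; exact: ltW.
- by apply: yi; rewrite divr_gt0.
Qed.

Lemma infinitesimalN x : infinitesimal x -> infinitesimal (- x).
Proof. by move=> xi; rewrite -mulN1r; exact: infinitesimalM. Qed.

Lemma infinitesimalJ x : infinitesimal x -> infinitesimal (star x).
Proof. by move=> xi e e0; rewrite starK mulrC; exact: xi. Qed.

(** Since -1 is not in [T], only the scalar 0 is infinitesimal; this makes scalar parts unique. *)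
Lemma infinitesimal_sc k : infinitesimal (sc A k) -> k = 0.
Proof.
case: k => a b ki; have q0 : a ^+ 2 + b ^+ 2 = 0.
  apply/eqP; rewrite eq_le addr_ge0 ?sqr_ge0// andbT.
  apply/ler_addgt0Pr => e e0; rewrite add0r -subr_ge0; apply: preord_rc_ge0.
  rewrite rcB; have := ki e e0; rewrite star_sc -scM.
  congr (T (_ - sc _ _)); apply/eqP; rewrite eq_complex /=.
  by apply/andP; split; apply/eqP; ring.
have a0 : a = 0 by have := sqr_ge0 a; have := sqr_ge0 b; nra.
have b0 : b = 0 by have := sqr_ge0 a; have := sqr_ge0 b; nra.
by rewrite a0 b0.
Qed.

(** The scalar r is the Dedekind cut of [x] with respect to [T]. For d > 0, totality places [x]
    below r + d and a member of the cut near r places it above r - d; with d^2 = e the product of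
    the two differences is e - (x - r)^2. *)
Lemma selfadj_scalar x : selfadj x -> exists r, infinitesimal (x - rc A r).
Proof.
move=> xs; pose E := [set r | T (x - rc A r)].
pose M := cnorm x + 1.
have xM : cnorm x < M by rewrite ltrDl.
have EM r : E r -> r <= M.
  move=> Er; rewrite -subr_ge0; apply: preord_rc_ge0.
  have -> : rc A (M - r) = (rc A M - x) + (x - rc A r) by rewrite rcB; ring.
  by apply: preordD => //; exact: preord_bound.
have E0 : has_sup E.
  split; last by exists M => r; exact: EM.
  exists (- M); rewrite /E/= rcN.
  have -> : x - - rc A M = rc A M - (- x) by ring.
  by apply: preord_bound; [exact: selfadjN|rewrite cnormN].
exists (sup E) => e e0; set r := sup E.
have d0 : 0 < Num.sqrt e by rewrite sqrtr_gt0.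
set d := Num.sqrt e in d0 *.
have -> : rc A e - star (x - rc A r) * (x - rc A r) =
   (rc A d - (x - rc A r)) * (rc A d + (x - rc A r)).
  rewrite starJB xs rc_sa -(rc_sqrt A (ltW e0)) -/d; ring.
apply: preordM => //.
  have -> : rc A d - (x - rc A r) = rc A (r + d) - x by rewrite rcD; ring.
  have [//|Tn] : T (rc A (r + d) - x) \/ T (- (rc A (r + d) - x)).
    by apply: preord_total; apply: selfadjB => //; exact: rc_sa.
  have : E (r + d) by rewrite /E/=; rewrite opprB in Tn.
  move/(sup_ubound E0.2); rewrite -/r gerDl leNgt d0//.
have [s Es rs] := sup_adherent d0 E0.
have -> : rc A d + (x - rc A r) = (x - rc A s) + rc A (s - (r - d)).
  by rewrite !rcB; ring.
apply: preordD => //; apply: preord_rc; rewrite subr_ge0 ltW//.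
Qed.

Lemma scalar_part a : exists k, infinitesimal (a - sc A k).
Proof.
have [x [y [xs ys ->]]] := selfadj_decomposition a.
have [r xr] := selfadj_scalar xs; have [s ys'] := selfadj_scalar ys.
exists (r%:C + 'i%C * s%:C).
have -> : x + 'i%C *: y - sc A (r%:C + 'i%C * s%:C) =
  (x - rc A r) + sc A 'i%C * (y - rc A s).
  by rewrite -sc_mul scD scM; ring.
by apply: infinitesimalD => //; exact: infinitesimalM.
Qed.

Lemma preordering_character : exists chi : A -> R[i],
  character chi /\
  forall x r, T x -> chi x = r%:C -> 0 <= r.
Proof.
have /choice[chi chiP] := scalar_part.
have chiE x k : infinitesimal (x - sc A k) -> chi x = k.
  move=> xk; apply/eqP; rewrite -subr_eq0; apply/eqP/infinitesimal_sc.
  have -> : sc A (chi x - k) = (x - sc A k) + - (x - sc A (chi x)).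
    by rewrite scB; ring.
  by apply: infinitesimalD => //; exact: infinitesimalN.
exists chi; split; last first.
  move=> x q Tx xq; rewrite leNgt; apply/negP => q0.
  have xi := chiP x; rewrite xq in xi.
  have xs := preord_sa preT Tx.
  (* Adding x^2 - 2 q x, which lies in [T] as q < 0, to q^2/2 - (x - q)^2 leaves the negative scalar
     - q^2/2. *)
  have e0 : 0 < q ^+ 2 / 2 by rewrite divr_gt0// exprn_even_gt0//= lt_eqF.
  have := xi _ e0; rewrite starJB xs rc_sa => Te.
  have : T (rc A (q ^+ 2 / 2 - q ^+ 2)).
    have -> : rc A (q ^+ 2 / 2 - q ^+ 2) =
      (rc A (q ^+ 2 / 2) - (x - rc A q) * (x - rc A q)) +
      (x * x + rc A (- q) * (x + x)).
      have -> : rc A (q ^+ 2 / 2 - q ^+ 2) = rc A (q ^+ 2 / 2) - rc A q * rc A q.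
        by rewrite rcB -rcM expr2.
      by rewrite rcN; ring.
    apply: preordD => //; apply: preordD => //; first exact: preord_sq.
    by apply: preordM => //; [apply: preord_rc; rewrite oppr_ge0 ltW|exact: preordD].
  by move/preord_rc_ge0; rewrite -/(rc A) => h; move: e0; lra.
split.
- move=> k x y; apply: chiE.
  have -> : k *: x + y - sc A (k * chi x + chi y) =
    sc A k * (x - sc A (chi x)) + (y - sc A (chi y)).
    by rewrite scD scM -sc_mul; ring.
  by apply: infinitesimalD => //; exact: infinitesimalM.
- apply: chiE; rewrite sc1 subrr => e e0; rewrite mulr0 subr0.
  by apply: preord_rc; exact: ltW.
- move=> x y; apply: chiE.
  have -> : x * y - sc A (chi x * chi y) =
    y * (x - sc A (chi x)) + sc A (chi x) * (y - sc A (chi y)) by rewrite scM; ring.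
  by apply: infinitesimalD => //; exact: infinitesimalM.
- move=> x; apply: chiE; rewrite -star_sc -starJB.
  exact: infinitesimalJ.
Qed.

End character_of_preordering.

(* With [a = b^* b] and [r^2 < c < |a|], adjoin [a - c] to the sums of squares. Were
   [-1 = p + (a - c) q], then [a^n <= c^(n+1) q] for all [n], contradicting
   [|a^(2^k)| = |a|^(2^k)]. *)
Lemma comalg_character_ex b r : 0 <= r -> r < cnorm b ->
  exists chi : A -> R[i], character chi /\ r < complex.Re `|chi b|.
Proof.
move=> r0 rb; pose a : A := star b * b.
have sa : sos a := sos_hs b.
have a_sa : selfadj a := sos_sa sa.
have an : cnorm a = cnorm b ^+ 2 := cnormJM b.
pose c := (r ^+ 2 + cnorm b ^+ 2) / 2.
have rb2 : r ^+ 2 < cnorm b ^+ 2 by rewrite ltr_pXn2r// nnegrE// cnorm_ge0.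
have rc2 : r ^+ 2 < c by rewrite /c; lra.
have ca : c < cnorm a by rewrite an /c; lra.
have c0 : 0 < c by rewrite (le_lt_trans _ rc2)// sqr_ge0.
have a0 : 0 < cnorm a := lt_trans c0 ca.
have x_sa : selfadj (a - rc A c) by apply: selfadjB => //; exact: rc_sa.
have preT := adjoin_preordering sos_preordering x_sa.
have [[p [q [sp sq pq]]]|T [preTT subT nT maxT]] := @maximal_preordering _ preT.
  (* The relation reads c q = 1 + p + a q: a factor c is traded for a factor a, up to sums of
     squares. *)
  have sq1 n : sos (rc A (c ^+ n) * q - a ^+ n * q).
    elim: n => [|n IH]; first by rewrite !expr0 rc1 subrr; exact: sos0.
    have -> : rc A (c ^+ n.+1) * q - a ^+ n.+1 * q =
      rc A (c ^+ n) * (1 + p) + a * (rc A (c ^+ n) * q - a ^+ n * q).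
      have -> : p = -1 - (a - rc A c) * q by rewrite pq; ring.
      rewrite exprSr rcM exprS; ring.
    apply: sosD; last exact: sosM.
    apply: sosM; first by apply: sos_rc; rewrite exprn_ge0// ltW.
    by apply: sosD => //; rewrite -(rc1 A); exact: sos_rc.
  have sa_n n : sos (a ^+ n).
    elim: n => [|n IH]; first by rewrite expr0 -(rc1 A); exact: sos_rc.
    by rewrite exprS; exact: sosM.
  have le_n n : cnorm (a ^+ n) <= c ^+ n * (c * cnorm q).
    have -> : c ^+ n * (c * cnorm q) = cnorm ((c ^+ n.+1)%:C *: q).
      by rewrite cnormZr ger0_norm ?exprn_ge0 ?(ltW c0)// exprSr mulrA.
    rewrite -rc_mul.
    have -> : rc A (c ^+ n.+1) * q = a ^+ n +
      (rc A c * (rc A (c ^+ n) * q - a ^+ n * q) + a ^+ n * (a * q + p)).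
      have -> : p = -1 - (a - rc A c) * q by rewrite pq; ring.
      rewrite exprS rcM; ring.
    apply: sos_mono => //; apply: sosD; apply: sosM => //.
      by apply: sos_rc; exact: ltW.
    by apply: sosD => //; exact: sosM.
  (* The C*-identity gives the norms of squares only, hence the exponents 2^k; the contradiction
     comes from (c / |a|)^(2^k) tending to 0. *)
  have pow k : cnorm (a ^+ (2 ^ k)%N) = cnorm a ^+ (2 ^ k)%N.
    elim: k => [|k IH]; first by rewrite !expr1.
    rewrite expnSr !exprM [(a ^+ (2 ^ k)%N) ^+ 2]expr2 cnorm_sa_sq ?IH//.
    exact: sos_sa.
  have K0 : 0 <= c * cnorm q by rewrite mulr_ge0 ?cnorm_ge0// ltW.
  have t0 : 0 <= c / cnorm a by rewrite divr_ge0// ltW.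
  have t1 : c / cnorm a < 1 by rewrite ltr_pdivrMr// mul1r.
  have [N h] := geometric_lt K0 t0 t1 ltr01.
  have key (K C Z : R) : 0 < Z -> Z <= C * K -> K * (C / Z) < 1 -> False.
    move=> Z0 ZK; rewrite mulrA ltr_pdivrMr// mul1r mulrC => /(le_lt_trans ZK).
    by rewrite ltxx.
  apply: (key (c * cnorm q) (c ^+ (2 ^ N)%N) (cnorm a ^+ (2 ^ N)%N)).
  - by rewrite exprn_gt0.
  - by rewrite -pow le_n.
  - by rewrite -expr_div_n h// ltnW// ltn_expl.
have [chi [[chiL chi1 chiM chiJ] chi_ge0]] := preordering_character preTT nT maxT.
exists chi; split=> //.
have Tx : T (a - rc A c).
  by apply: subT; apply: adjoin_mem; exact: sos_preordering.
have chi_x : chi (a - rc A c) = - c%:C + (chi b)^*%C * chi b.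
  have -> : a - rc A c = (- c%:C) *: (1 : A) + a by rewrite scaleNr addrC.
  by rewrite chiL chi1 mulr1 chiM chiJ.
case E : (chi b) => [u v].
have /(chi_ge0 _ _ Tx) uvc : chi (a - rc A c) = (u ^+ 2 + v ^+ 2 - c)%:C.
  rewrite chi_x E; apply/eqP; rewrite eq_complex /=.
  by apply/andP; split; apply/eqP; ring.
rewrite normc_def /= -[r]ger0_norm// -sqrtr_sqr ltr_sqrt.
  by rewrite (lt_le_trans rc2)// -subr_ge0.
by rewrite (lt_le_trans c0)// -subr_ge0.
Qed.

End gelfand.

Lemma character_ex (R : realType) (A : cstarAlgType R) (b : A) (r : R) :
  commutative_cstar A -> 0 <= r -> r < cnorm b ->
  exists chi : A -> R[i], character chi /\ r < complex.Re `|chi b|.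
Proof. by move=> cA; exact: (@comalg_character_ex R A cA b r). Qed.

(** * Finite-dimensional commutative algebras *)

Section scalars.
Variable R : realType.
Local Notation C := (R[i])^o.

Lemma conjc_mul (x y : R[i]) : (x * y)^*%C = y^*%C * x^*%C.
Proof. by rewrite rmorphM mulrC. Qed.

Lemma Re_norm_ge_Re (z : R[i]) : `|complex.Re z| <= complex.Re `|z|.
Proof.
case: z => a b; rewrite normc_def /= -sqrtr_sqr ler_wsqrtr// lerDl sqr_ge0//.
Qed.

Lemma Re_norm_ge_Im (z : R[i]) : `|complex.Im z| <= complex.Re `|z|.
Proof.
case: z => a b; rewrite normc_def /= -sqrtr_sqr ler_wsqrtr// lerDr sqr_ge0//.
Qed.

Lemma Re_norm_le (z : R[i]) : complex.Re `|z| <= `|complex.Re z| + `|complex.Im z|.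
Proof.
case: z => a b; rewrite normc_def /=.
rewrite -[leRHS]ger0_norm ?addr_ge0// -sqrtr_sqr ler_wsqrtr//.
rewrite sqrrD !real_normK ?num_real// lerD2r lerDl.
by rewrite mulrn_wge0// mulr_ge0.
Qed.

Lemma real_geometric_cvg (u : nat -> R) : (forall n, `|u n.+1 - u n| <= 2^-1 ^+ n) ->
  exists l, forall e : R, 0 < e -> exists N, forall n, (N <= n)%N -> `|u n - l| < e.
Proof.
move=> uB.
have : cvgn u.
  have -> : u = (fun n => u 0%N + series (fun k => u k.+1 - u k) n).
    apply/funext => n; rewrite /series/= telescope_sumr// addrC subrK//.
  apply: is_cvgD; first exact: is_cvg_cst.
  apply: normed_cvg; apply: (series_le_cvg _ _ uB) => [n|n|]; rewrite ?exprn_ge0//.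
  have := @is_cvg_geometric_series R 1 2^-1.
  rewrite ger0_norm ?invr_ge0// => /(_ _)/[!invf_lt1]//.
  rewrite (_ : GRing.exp 2^-1 = geometric 1 2^-1); first by apply; rewrite ltr1n.
  by apply/funext => n; rewrite /geometric/= mul1r.
move=> /cvg_ex[l /cvgrPdist_lt ul]; exists l => e e0.
have [N _ h] := ul e e0; exists N => n Nn; rewrite distrC; exact: h.
Qed.

Let complete (u : nat -> C) : (forall n, setT (u n)) ->
  (forall n, complex.Re `|(u n.+1 - u n : R[i])| <= 2^-1 ^+ n) ->
  exists2 l, setT l & forall e : R, 0 < e ->
    exists N, forall n, (N <= n)%N -> complex.Re `|(u n - l : R[i])| < e.
Proof.
move=> _ uB.
have ReB (x y : R[i]) : complex.Re (x - y) = complex.Re x - complex.Re y by exact: raddfB.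
have ImB (x y : R[i]) : complex.Im (x - y) = complex.Im x - complex.Im y by exact: raddfB.
have [n|a ha] := @real_geometric_cvg (fun n => complex.Re (u n : R[i])).
  by rewrite -ReB (le_trans (Re_norm_ge_Re _)).
have [n|b hb] := @real_geometric_cvg (fun n => complex.Im (u n : R[i])).
  by rewrite -ImB (le_trans (Re_norm_ge_Im _)).
exists (a +i* b)%C => // e e0; have e20 : 0 < e / 2 by rewrite divr_gt0.
have [N1 h1] := ha _ e20; have [N2 h2] := hb _ e20.
exists (maxn N1 N2) => n; rewrite geq_max => /andP[/h1 hn1 /h2 hn2].
rewrite (le_lt_trans (Re_norm_le _))// ReB ImB/= (splitr e) ltrD//.
Qed.

Lemma Re_normD (x y : R[i]) :
  complex.Re `|x + y| <= complex.Re `|x| + complex.Re `|y|.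
Proof.
by have := ler_normD x y; rewrite -[ `|x + y|]RRe_real ?normr_real//
  -[ `|x|]RRe_real ?normr_real// -[ `|y|]RRe_real ?normr_real// -rmorphD lecR.
Qed.

Lemma Re_normJ (x : R[i]) : complex.Re `|x^*%C| = complex.Re `|x|.
Proof. by case: x => a b; rewrite !normc_def /= sqrrN. Qed.

Let eq_le_trans_refl (a b : R) : a = b -> a <= b. Proof. by move=> ->. Qed.

Let pre : pre_cstar R := @PreCstar R C 1 (fun x y : R[i] => x * y)
  (fun x : R[i] => x^*%C) setT (fun x : R[i] => complex.Re `|x|)
  (@mulrA R[i]) (@mul1r R[i]) (@mulr1 R[i]) (@mulrDl R[i]) (@mulrDr R[i])
  (fun k x y => esym (mulrA (k : R[i]) x y)) (fun k x y => mulrCA (x : R[i]) k y)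
  (@conjcK R) (fun x y : R[i] => rmorphD (@conjc R) x y)
  (fun k x : R[i] => rmorphM (@conjc R) k x)
  conjc_mul Logic.I (fun _ _ _ _ => Logic.I) (fun _ _ _ => Logic.I) Logic.I
  (fun _ _ _ _ => Logic.I) (fun _ _ => Logic.I) (fun x _ => Re_norm_ge0 (x : R[i]))
  (fun x y _ _ => Re_normD x y) (fun k x _ => Re_normM k (x : R[i]))
  (fun x y _ _ => eq_le_trans_refl (Re_normM (x : R[i]) y))
  (fun x _ => Re_normJ x)
  (fun x _ => etrans (Re_normM x^*%C (x : R[i])) (f_equal (fun r => r * _) (Re_normJ x)))
  complete.

(** The scalars as a C*-algebra, with the modulus as norm. Being a separation, its carrier is a
    subtype, and [c] is the identification with [R[i]]. *)
Lemma scalars_ex : exists (B : cstarAlgType R) (c : R[i] -> B),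
  [/\ forall k x y, c (k * x + y) = k *: c x + c y, c 1 = 1,
      forall x y, c (x * y) = c x * c y, forall x, c x^*%C = star (c x) &
      (forall x, cnorm (c x) = complex.Re `|x|) /\ forall b, exists x, c x = b].
Proof.
exists (sep_alg pre), (@sepq R pre); split.
- move=> k x y; rewrite -(@sepqZ R pre k x)//; exact: (@sepqD R pre).
- exact: (@sepq1 R pre).
- by move=> x y; exact: (@sepqM R pre).
- by move=> x; exact: (@sepqJ R pre).
- split=> [x|b]; first exact: (@cnorm_sepq R pre).
  by have [x _ <-] := @sepq_surj R pre b; exists x.
Qed.

End scalars.

Section characters.
Variables (R : realType) (A : cstarAlgType R).
Implicit Types (chi : A -> R[i]) (x y : A).

Lemma character0 chi : character chi -> chi 0 = 0.
Proof.
move=> [L _ _ _]; have := L 1 0 0; rewrite scale1r addr0 mul1r => /eqP.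
by rewrite -subr_eq0 opprD addrA subrr sub0r oppr_eq0 => /eqP.
Qed.

Lemma characterD chi x y : character chi -> chi (x + y) = chi x + chi y.
Proof. by move=> [L _ _ _]; rewrite -[x in LHS]scale1r L mul1r. Qed.

Lemma characterZ chi k x : character chi -> chi (k *: x) = k * chi x.
Proof.
by move=> ch; have [L _ _ _] := ch; rewrite -[k *: x]addr0 L character0// addr0.
Qed.

Lemma characterB chi x y : character chi -> chi (x - y) = chi x - chi y.
Proof.
by move=> ch; rewrite -scaleN1r characterD// characterZ// mulN1r.
Qed.

Lemma character_sum chi (I : Type) (s : seq I) (P : pred I) (F : I -> A) :
  character chi -> chi (\sum_(i <- s | P i) F i) = \sum_(i <- s | P i) chi (F i).
Proof.
by move=> ch; apply: (big_morph chi) => [x y|]; [exact: characterD|exact: character0].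
Qed.

Lemma character_prod chi (I : Type) (s : seq I) (P : pred I) (F : I -> A) :
  character chi -> chi (\prod_(i <- s | P i) F i) = \prod_(i <- s | P i) chi (F i).
Proof. by move=> [_ c1 cM _]; apply: (big_morph chi). Qed.

(** Through [scalars_ex] a character is a *-homomorphism, hence contractive. *)
Lemma character_le chi x : character chi -> complex.Re `|chi x| <= cnorm x.
Proof.
move=> [L c1 cM cJ]; have [B [c [cL cc1 ccM ccJ [cn _]]]] := scalars_ex R.
have [||||f fE] := @starhom_ex R A B (fun x => c (chi x)).
- by move=> k y z; rewrite L cL.
- by rewrite c1.
- by move=> y z; rewrite cM ccM.
- by move=> y; rewrite cJ ccJ.
by rewrite -cn -fE starhom_contractive.
Qed.

Hypothesis cA : commutative_cstar A.

Lemma character_separation x y : (forall chi, character chi -> chi x = chi y) -> x = y.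
Proof.
move=> h; apply/eqP; rewrite -subr_eq0 -cnorm_eq0 eq_le cnorm_ge0 andbT leNgt.
apply/negP => n0; have [chi [ch]] := character_ex cA (lexx 0) n0.
by rewrite characterB// h// subrr normr0 ltxx.
Qed.

(** Lagrange interpolation with the characters as nodes: [e k] is a product of elements with value 1
    at [chi k] and 0 at one other character. *)
Lemma character_dual m (chi : 'I_m -> A -> R[i]) : injective chi ->
  (forall k, character (chi k)) ->
  exists e : 'I_m -> A, forall k l, chi l (e k) = (l == k)%:R.
Proof.
move=> inj ch.
have /choice[b bP] : forall p : 'I_m * 'I_m, exists b : A,
    p.1 != p.2 -> chi p.1 b = 1 /\ chi p.2 b = 0.
  move=> [k l] /=; have [->|kl] := eqVneq k l; first by exists 0.
  have [a ka] : exists a, chi k a != chi l a.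
    apply: contrapT => h; move/eqP: kl; apply; apply: inj; apply/funext => a.
    by apply: contrapT => /eqP na; apply: h; exists a.
  exists ((chi k a - chi l a)^-1 *: (a - chi l a *: (1 : A))) => _.
  have c1 j : chi j 1 = 1 by have [] := ch j.
  rewrite !characterZ// !characterB// !characterZ// !c1 !mulr1 subrr mulr0.
  by rewrite mulVf// subr_eq0.
exists (fun k => \prod_(l | k != l) b (k, l)) => k l.
rewrite character_prod//; have [->|lk] := eqVneq l k.
  by rewrite big1// => j kj; have [] := bP (k, j) kj.
rewrite (bigD1 l) /=; last by rewrite eq_sym.
by have [_ ->] := bP (k, l) (ltac:(by rewrite eq_sym)); rewrite mul0r.
Qed.

(** The identity matrix of size m, with entries [chi l (e k)], factors through dimension n. *)
Lemma characters_le_dim n (v : 'I_n -> A) m (chi : 'I_m -> A -> R[i]) :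
  (forall x, exists c : 'I_n -> R[i], x = \sum_(i < n) c i *: v i) ->
  injective chi -> (forall k, character (chi k)) -> (m <= n)%N.
Proof.
move=> span inj ch; have [e eE] := character_dual inj ch.
have /choice[c cE] : forall k, exists c : 'I_n -> R[i], e k = \sum_(i < n) c i *: v i.
  by move=> k; exact: span.
pose M := \matrix_(k < m, i < n) c k i; pose N := \matrix_(i < n, l < m) chi l (v i).
have MN : M *m N = 1%:M.
  apply/matrixP => k l; rewrite !mxE eq_sym -(eE k l) cE character_sum//.
  by apply: eq_bigr => i _; rewrite !mxE characterZ.
have := mxrankM_maxl M N; rewrite MN mxrank1 => /leq_trans; apply.
exact: rank_leq_col.
Qed.

(** The dimension bounds the number of characters, so a largest family of distinct ones exists and
    exhausts them. As characters separate points, each identity is checked by applying every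
    [chi k]; the projections are the interpolating elements. *)
Lemma finite_dimensional_structure : finite_dimensional A ->
  exists m (chi : 'I_m -> A -> R[i]) (e : 'I_m -> A),
  [/\ forall k, character (chi k), forall k, projection (e k),
      forall k l, k != l -> e k * e l = 0, \sum_k e k = 1 &
      forall x, x = \sum_k chi k x *: e k].
Proof.
move=> [n [v span]].
pose P m := `[< exists chi : 'I_m -> A -> R[i],
  injective chi /\ forall k, character (chi k) >].
have P0 : exists m, P m.
  by exists 0%N; apply/asboolP; exists (fun _ _ => 0); split=> -[].
have Pn m : P m -> (m <= n)%N.
  by move=> /asboolP[chi [inj ch]]; exact: (characters_le_dim span inj ch).
case: (ex_maxnP P0 Pn) => m /asboolP[chi [inj ch]] maxm.
have all_chi psi : character psi -> exists k, psi = chi k.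
  move=> cpsi; apply: contrapT => npsi.
  have := maxm m.+1; rewrite ltnn => /(_ _)/negP; apply => //.
  apply/asboolP; exists (fun k => if unlift ord0 k is Some j then chi j else psi).
  split=> [k l|k]; last by case: unliftP.
  case: unliftP => [k' ->|->]; case: unliftP => [l' ->|->] // h.
  - by rewrite (inj _ _ h).
  - by case: npsi; exists k'.
  - by case: npsi; exists l'.
have [e eE] := character_dual inj ch.
have sep x y : (forall k, chi k x = chi k y) -> x = y.
  by move=> h; apply: character_separation => psi /all_chi[k ->].
have chiM k x y : chi k (x * y) = chi k x * chi k y by have [] := ch k.
exists m, chi, e; split=> //.
- move=> k; split.
    apply: sep => l; have [_ _ _ ->] := ch l; rewrite eE.
    by case: eqP => _; apply/eqP; rewrite eq_complex /= ?oppr0 !eqxx.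
  apply: sep => l; rewrite chiM eE.
  by case: eqP => _; rewrite ?mulr1 ?mulr0.
- move=> k l kl; apply: sep => j; rewrite chiM !eE character0//.
  case: (eqVneq j k) => [->|_]; last by rewrite mul0r.
  by rewrite (negPf kl) mulr0.
- apply: sep => l; rewrite character_sum//; have [_ -> _ _] := ch l.
  rewrite (bigD1 l)//= eE eqxx big1 ?addr0// => k kl.
  by rewrite eE eq_sym (negPf kl).
- move=> x; apply: sep => l; rewrite character_sum// (bigD1 l)//=.
  rewrite characterZ// eE eqxx mulr1 big1 ?addr0// => k kl.
  by rewrite characterZ// eE eq_sym (negPf kl) mulr0.
Qed.

End characters.

(** * Lifting projections and homomorphisms *)

Section hom_metric_lemmas.
Variables (R : realType) (A B L : cstarAlgType R).

Lemma hom_dist_isometric (f : starHom B L) (g h : starHom A B) : isometric f ->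
  hom_dist (starhom_comp f g) (starhom_comp f h) = hom_dist g h.
Proof.
move=> fi; congr ereal_sup; apply: eq_imagel => a _.
by rewrite /= -starhomBE isometric_cnorm.
Qed.

End hom_metric_lemmas.

Section hom_colimit.
Variables (R : realType) (A : cstarAlgType R).
Context d (I : porderType d) (D : cstar_diagram R I).
Hypothesis dirI : directed_poset I.
Variables (L : cstarAlgType R) (leg : forall i, starHom (D i) L).
Hypotheses (legE : cstar_cocone leg) (leg_iso : forall i, isometric (leg i)).

Let t (i j : I) (ij : (i <= j)%O) (f : cmet_hom A (D i)) : cmet_hom A (D j) :=
  starhom_comp (dmap D ij) f.

Let legh i (f : cmet_hom A (D i)) : cmet_hom A L := starhom_comp (leg i) f.

Let legh_t (i j : I) (ij : (i <= j)%O) f : legh (t ij f) = legh f.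
Proof. by apply/starhomP => a; exact: legE. Qed.

Let legh_iso i (f g : cmet_hom A (D i)) : cdist (legh f) (legh g) = cdist f g.
Proof. exact: hom_dist_isometric. Qed.

Lemma dense_hom_colimit :
  (forall (f : starHom A L) (e : R), 0 < e ->
     exists i (g : starHom A (D i)), (hom_dist (starhom_comp (leg i) g) f < e%:E)%E) ->
  cmet_colimit (X := fun i => cmet_hom A (D i))
    (fun i j ij f => starhom_comp (dmap D ij) f)
    (fun i (f : cmet_hom A (D i)) => starhom_comp (leg i) f : cmet_hom A L).
Proof. exact: (isometric_dense_colimit dirI legh_t legh_iso). Qed.

(* The colimit in CMet is the closure of the homomorphisms factoring through a leg. *)
Definition factorable : set (starHom A L) := [set f | forall e : R, 0 < e ->
  exists i (g : starHom A (D i)), (hom_dist (starhom_comp (leg i) g) f < e%:E)%E].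

Let H := {f : starHom A L | factorable f}.
Let distH (f g : H) : \bar R := hom_dist (sval f) (sval g).

Let distH_eq0 (f g : H) : distH f g = 0%E <-> f = g.
Proof.
rewrite /distH hom_dist_eq0; split=> [|->//]; case: f g => [f ff] [g fg] /= E.
exact: eq_exist.
Qed.

Let distH_complete (u : nat -> H) :
  (forall e : R, 0 < e -> exists N, forall m n, (N <= m)%N -> (N <= n)%N ->
     (distH (u m) (u n) < e%:E)%E) ->
  exists l, forall e : R, 0 < e -> exists N, forall n, (N <= n)%N ->
     (distH (u n) l < e%:E)%E.
Proof.
move=> cu; have [l ul] := hom_dist_complete cu.
have fl : factorable l.
  move=> e e0; have e20 : 0 < e / 2 by rewrite divr_gt0.
  have [N uN] := ul _ e20; have [i [g gu]] := svalP (u N) _ e20.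
  exists i, g; rewrite (le_lt_trans (hom_dist_triangle _ (sval (u N)) _))//.
  by rewrite [e]splitr EFinD lteD// uN.
by exists (exist _ l fl).
Qed.

Let cmetH : cmet R := @CMet R H distH (fun f g => hom_dist_ge0 (sval f) (sval g))
  distH_eq0 (fun f g => hom_dist_sym (sval f) (sval g))
  (fun f g h => hom_dist_triangle (sval f) (sval g) (sval h)) distH_complete.

(** [cmetH] is a colimit by density, so generation makes the canonical map to hom(A, L) invertible.
    Its inverse sends [f] to a factorable homomorphism whose approximations also approximate [f],
    the canonical map being nonexpansive. *)
Lemma generated_factorable (P : cstarAlgType R -> Prop) : aleph0_generated P A ->
  (forall i, P (D i)) -> (forall (i j : I) (ij : (i <= j)%O), isometric (dmap D ij)) ->
  cstar_colimit P leg -> forall f, factorable f.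
Proof.
move=> gA PD D_iso colim f.
have fact i (g : starHom A (D i)) : factorable (starhom_comp (leg i) g).
  move=> e e0; exists i, g.
  by rewrite (_ : hom_dist _ _ = 0%E) ?lte_fin//; exact/hom_dist_eq0.
pose hleg i (g : cmet_hom A (D i)) : cmetH := exist factorable _ (fact i g).
have colimH : cmet_colimit t hleg.
  apply: isometric_dense_colimit => //.
  - by move=> i j ij g; apply: eq_exist; exact: legh_t.
  - by move=> [g fg] e e0; have [i [g' gg']] := fg e e0; exists i, g'.
have [u [uE [nu [v [_ _ vK]]]]] := gA _ _ _ dirI PD D_iso _ _ colim _ _ colimH.
move=> e e0; have [i [g gv]] := svalP (v f) e e0; exists i, g.
apply: le_lt_trans gv; have := nu (hleg i g) (v f).
by rewrite uE vK.
Qed.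

End hom_colimit.

Section orthogonal_projections.
Variables (R : realType) (A : cstarAlgType R).

Lemma cnorm_projection_le1 (p : A) : projection p -> cnorm p <= 1.
Proof.
move=> [ps pp]; have := cnorm_sa_sq ps; rewrite pp => h.
have := cnorm_ge0 p; nra.
Qed.

Lemma projection_compl (p : A) : projection p -> projection (1 - p).
Proof.
move=> [ps pp]; split; first exact: selfadjB (selfadj1 A) ps.
by rewrite mulrBr mulr1 mulrBl mul1r pp subrr subr0.
Qed.

Lemma projection_sum m (p : 'I_m -> A) : (forall k, projection (p k)) ->
  (forall k l, k != l -> p k * p l = 0) -> projection (\sum_k p k).
Proof.
move=> pp po; split.
  by rewrite /selfadj star_sum; apply: eq_bigr => k _; have [] := pp k.
rewrite mulr_suml; apply: eq_bigr => k _.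
rewrite mulr_sumr (bigD1 k)//= (pp k).2 big1 ?addr0// => l lk.
by rewrite po// eq_sym.
Qed.

Lemma projection_sum_mul m (p : 'I_m -> A) k : (forall k, projection (p k)) ->
  (forall k l, k != l -> p k * p l = 0) -> p k * (\sum_l p l) = p k.
Proof.
move=> pp po; rewrite mulr_sumr (bigD1 k)//= (pp k).2 big1 ?addr0// => l lk.
by rewrite po// eq_sym.
Qed.

Lemma projection_starhom (B : cstarAlgType R) (f : starHom A B) p :
  projection p -> projection (f p).
Proof.
by move=> [ps pp]; split; [rewrite /selfadj -starhomJE ps|rewrite -starhomME pp].
Qed.

End orthogonal_projections.

Section lifting_projections.
Variable R : realType.
Context d (I : porderType d) (D : cstar_diagram R I).
Hypothesis dirI : directed_poset I.
Variables (L : cstarAlgType R) (leg : forall i, starHom (D i) L).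
Hypotheses (legE : cstar_cocone leg) (leg_iso : forall i, isometric (leg i)).
Hypothesis leg_dense : forall y, leg_closure leg y.

Lemma leg_dense_sa (y : L) (e : R) : selfadj y -> 0 < e ->
  exists i (x : D i), selfadj x /\ cnorm (leg i x - y) < e.
Proof.
move=> ys e0; have [i [x xy]] := leg_dense y e0.
pose h := (2^-1 : R)%:C.
exists i, (h *: (x + star x)); split.
  by apply: selfadjZ; rewrite /selfadj starD starK addrC.
have -> : leg i (h *: (x + star x)) - y =
    h *: ((leg i x - y) + star (leg i x - y)).
  rewrite -{1}[y]half_add -/h starhomZE starhomDE starhomJE -scalerBr starJB ys.
  by rewrite opprD addrACA.
rewrite cnormZr ger0_norm ?invr_ge0// ltr_pdivrMl// mulr_natl mulr2n.
by rewrite (le_lt_trans (cnormD _ _))// cnormJ ltrD.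
Qed.

(** Used with [a] and [b] the complements of the sums of the lifted and of the given projections. As
    |x| <= 2, the three terms of the splitting contribute 2 s, s and s. *)
Lemma corner_bound (a b x q : L) (s : R) : cnorm a <= 1 -> cnorm b <= 1 ->
  cnorm q <= 1 -> b * q * b = q -> 0 <= s -> s <= 1 ->
  cnorm (a - b) <= s -> cnorm (x - q) <= s -> cnorm (a * x * a - q) <= 4 * s.
Proof.
move=> a1 b1 q1 bqb s0 s1 ab xq.
have -> : a * x * a - q = (a - b) * x * a + (b * (x - q) * a + b * q * (a - b)).
  have -> : (a - b) * x * a = a * x * a - b * x * a by rewrite !mulrBl.
  have -> : b * (x - q) * a = b * x * a - b * q * a by rewrite mulrBr mulrBl.
  have -> : b * q * (a - b) = b * q * a - q by rewrite mulrBr bqb.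
  by rewrite subrKA subrKA.
have x2 : cnorm x <= 2.
  rewrite -(subrK q x) (le_trans (cnormD _ _))//; lra.
have h1 : cnorm ((a - b) * x * a) <= s * 2 * 1.
  by apply: cnormM_le => //; exact: cnormM_le.
have h2 : cnorm (b * (x - q) * a) <= 1 * s * 1.
  by apply: cnormM_le => //; exact: cnormM_le.
have h3 : cnorm (b * q * (a - b)) <= 1 * 1 * s.
  by apply: cnormM_le => //; exact: cnormM_le.
rewrite (le_trans (cnormD _ _))//.
have := cnormD (b * (x - q) * a) (b * q * (a - b)); lra.
Qed.

(** The defect of [y] is at most (1 + s) s + s + s <= 4 s <= 1/16, as [near_projection] requires.
    The correction moves by at most 8 * 4 s and [y] is itself s away from [q], whence 33. *)
Lemma near_projection_lift i (y : D i) (q : L) (s : R) : selfadj y -> projection q ->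
  cnorm (leg i y - q) <= s -> s <= 1 / 64 ->
  exists p, [/\ projection p, cnorm (leg i p - q) <= 33 * s &
    forall z, z * y = 0 -> z * p = 0].
Proof.
move=> ys qp yq s64; have q1 := cnorm_projection_le1 qp.
have s0 : 0 <= s by rewrite (le_trans (cnorm_ge0 _) yq).
have yn : cnorm y <= 1 + s.
  rewrite -(isometric_cnorm _ (@leg_iso i)) -(subrK q (leg i y)).
  by rewrite (le_trans (cnormD _ _))// addrC lerD.
have yy : cnorm (y * y - y) <= 4 * s.
  rewrite -(isometric_cnorm _ (@leg_iso i)) starhomBE starhomME.
  have -> : leg i y * leg i y - leg i y =
      (leg i y * (leg i y - q) + (leg i y - q) * q) - (leg i y - q).
    rewrite mulrBr mulrBl addrA subrK qp.2 opprB addrA subrK//.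
  have h1 : cnorm (leg i y * (leg i y - q)) <= (1 + s) * s.
    by apply: cnormM_le => //; rewrite isometric_cnorm.
  have h2 : cnorm ((leg i y - q) * q) <= s * 1 by exact: cnormM_le.
  rewrite (le_trans (cnorm_leB _ _))//.
  have := cnormD (leg i y * (leg i y - q)) ((leg i y - q) * q); nra.
have [||p [pp py pz]] := @near_projection R (D i) y ys.
- by rewrite (le_trans yn)//; lra.
- by rewrite (le_trans yy)//; lra.
exists p; split=> //.
rewrite (le_trans (cnorm_triangle _ (leg i y) _))//.
rewrite -starhomBE isometric_cnorm//; lra.
Qed.

(* The lift of [q ord0] is compressed by [1 - P], with [P] the sum of the projections
   lifted from the others, before it is corrected to a projection orthogonal to [P]. *)
Lemma lift_projections m (q : 'I_m -> L) (e : R) : 0 < e ->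
  (forall k, projection (q k)) -> (forall k l, k != l -> q k * q l = 0) ->
  exists i (p : 'I_m -> D i), [/\ forall k, projection (p k),
    forall k l, k != l -> p k * p l = 0 & forall k, cnorm (leg i (p k) - q k) < e].
Proof.
elim: m => [|m IH] in q e * => e0 qp qo.
  by have [i0] := dirI.1; exists i0, (fun=> 0); split=> -[].
(* Compression costs a factor 4, so 4 s <= 1/64 is the tolerance of [near_projection_lift], and its
   result is within 33 * 4 s = 132 s < e because s <= e/144. *)
pose s := Num.min (1 / 64 / 4) (e / 12 / 12).
have s0 : 0 < s by rewrite lt_min; apply/andP; split; lra.
have s1 : s <= 1 / 64 / 4 by rewrite ge_min lexx.
have s2 : s <= e / 12 / 12 by rewrite ge_min lexx orbT.
(* Small enough for the errors of the m earlier lifts to add up to at most s. *)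
pose r := s / m.+1%:R.
have r0 : 0 < r by rewrite divr_gt0.
have mr : m%:R * r <= s.
  rewrite /r mulrCA ler_piMr ?(ltW s0)// ler_pdivrMr// mul1r ler_nat//.
have rs : r <= s by rewrite ler_pdivrMr// ler_peMr ?(ltW s0)// ler1n.
pose q' k := q (lift ord0 k).
have q'p k : projection (q' k) by exact: qp.
have q'o k l : k != l -> q' k * q' l = 0.
  by move=> kl; apply: qo; rewrite (inj_eq lift_inj).
have [i [p [pp po pq]]] := IH q' r r0 q'p q'o.
have [j [x [xs xq]]] := leg_dense_sa (qp ord0).1 s0.
have [k [ik jk]] := dirI.2 i j.
pose p' l := dmap D ik (p l); pose x' := dmap D jk x.
have p'p l : projection (p' l).
  exact: projection_starhom.
have p'o l l' : l != l' -> p' l * p' l' = 0.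
  by move=> ll; rewrite /p' -starhomME po// starhom0E.
pose P := \sum_l p' l; pose Q := \sum_l q' l.
have Pp : projection P := projection_sum p'p p'o.
have Qp : projection Q := projection_sum q'p q'o.
have x's : selfadj x' by rewrite /selfadj -starhomJE xs.
pose y := (1 - P) * x' * (1 - P).
have cPs := projection_compl Pp.
have ys : selfadj y by rewrite /selfadj !starJM cPs.1 x's mulrA.
have legP : projection (1 - leg k P).
  rewrite -(starhom1E (leg k)) -starhomBE.
  exact: projection_starhom.
have Qq : Q * q ord0 = 0.
  by rewrite mulr_suml big1// => l _; apply: qo; rewrite eq_sym neq_lift.
have qQ : q ord0 * Q = 0.
  by rewrite mulr_sumr big1// => l _; apply: qo; rewrite neq_lift.
have yq : cnorm (leg k y - q ord0) <= 4 * s.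
  rewrite !starhomME starhomBE starhom1E; apply: (corner_bound (b := 1 - Q)).
  - exact: cnorm_projection_le1.
  - by apply: cnorm_projection_le1; exact: projection_compl.
  - exact: cnorm_projection_le1.
  - by rewrite mulrBl mul1r Qq subr0 mulrBr mulr1 qQ subr0.
  - exact: ltW.
  - by rewrite (le_trans s1)//; lra.
  - rewrite opprB addrC addrA subrK -cnormN opprB /P /Q starhom_sumE -sumrB.
    rewrite (le_trans (cnorm_sum _ _ _))//.
    apply: le_trans mr; rewrite mulr_natl -[m in _ *+ m]card_ord -sumr_const.
    by apply: ler_sum => l _; rewrite ltW// /p' legE pq.
  - by rewrite /x' legE ltW.
have [|p0 [p0p p0q p0z]] := near_projection_lift ys (qp ord0) yq; first by lra.
have p'p0 l : p' l * p0 = 0.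
  have pP : p' l * P = p' l := projection_sum_mul l p'p p'o.
  have pP0 : p' l * (1 - P) = 0 by rewrite mulrBr mulr1 pP subrr.
  by apply: p0z; rewrite /y !mulrA pP0 !mul0r.
have p0p' l : p0 * p' l = 0.
  by rewrite -[LHS]starK starJM p0p.1 (p'p l).1 p'p0 star0.
exists k, (fun l => if unlift ord0 l is Some l' then p' l' else p0); split.
- by move=> l; case: unliftP => [l' _|_].
- move=> l l'; case: unliftP => [a ->|->]; case: unliftP => [b ->|->] //.
  by rewrite (inj_eq lift_inj) => /p'o.
- move=> l; case: unliftP => [l' ->|->].
    rewrite /p' legE (lt_le_trans (pq l'))// (le_trans rs)// (le_trans s2)//.
    lra.
  by rewrite (le_lt_trans p0q)//; lra.
Qed.

End lifting_projections.

(** * Finite-dimensional algebras are generated *)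

Section finite_dimensional_generated.
Variables (R : realType) (P : cstarAlgType R -> Prop) (SP : stable_class P).
Variables (A : cstarAlgType R) (cA : commutative_cstar A).

Lemma finite_dimensional_aleph0_generated :
  finite_dimensional A -> aleph0_generated P A.
Proof.
move=> fdA d I D dirI PD D_iso L leg colim H hleg colimH.
have [m [chi [e [ch ep eo e1 xE]]]] := finite_dimensional_structure cA fdA.
have [PL legE _] := colim.
have leg_iso := colimit_isometric SP dirI PD D_iso colim.
have leg_dense := colimit_dense SP dirI colim.
apply: cmet_colimit_iso colimH _.
apply: dense_hom_colimit => // f r r0.
(* The m errors sum to at most 1/2, which forces the lifted projections to sum to 1, and to at most
   r/2, which bounds the distance between the homomorphisms. *)
pose s := Num.min (1 / 2) (r / 2) / m.+1%:R.
have s0 : 0 < s by rewrite divr_gt0// lt_min !divr_gt0.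
have ms : m%:R * s <= Num.min (1 / 2) (r / 2).
  rewrite /s mulrCA ler_piMr//; first by rewrite le_min !divr_ge0// ltW.
  by rewrite ler_pdivrMr// mul1r ler_nat.
have fe k : projection (f (e k)).
  exact: projection_starhom.
have fo k l : k != l -> f (e k) * f (e l) = 0.
  by move=> kl; rewrite -starhomME eo// starhom0E.
have [i [p [pp po pf]]] := lift_projections dirI legE leg_iso leg_dense s0 fe fo.
(* The complement of the sum is a projection of norm below 1, hence 0; this makes the lift
   unital. *)
have p1 : \sum_k p k = 1.
  apply/eqP; rewrite eq_sym -subr_eq0; apply/eqP/cnorm_projection.
    by apply: projection_compl; exact: projection_sum.
  rewrite -(isometric_cnorm _ (leg_iso i)) starhomBE starhom1E -(starhom1E f) -e1.
  rewrite !starhom_sumE -sumrB (le_lt_trans (cnorm_sum _ _ _))//.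
  apply: (@le_lt_trans _ _ (m%:R * s)).
    rewrite mulr_natl -[m in _ *+ m]card_ord -sumr_const.
    by apply: ler_sum => k _; rewrite cnormB ltW.
  by rewrite (le_lt_trans ms)// gt_min; apply/orP; left; lra.
have chL k c x y : chi k (c *: x + y) = c * chi k x + chi k y by have [] := ch k.
have chM k x y : chi k (x * y) = chi k x * chi k y by have [] := ch k.
have [||||g gE] := @starhom_ex R A (D i) (fun x => \sum_k chi k x *: p k).
- move=> c x y; rewrite scaler_sumr -big_split; apply: eq_bigr => k _ /=.
  by rewrite chL scalerDl scalerA.
- rewrite -p1; apply: eq_bigr => k _; have [_ -> _ _] := ch k.
  by rewrite scale1r.
- move=> x y; rewrite mulr_suml; apply: eq_bigr => k _.
  rewrite mulr_sumr (bigD1 k)//= big1 => [|l lk]; last first.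
    by rewrite -scaleAl -scaleAr po ?scaler0// eq_sym.
  by rewrite addr0 -scaleAl -scaleAr (pp k).2 scalerA chM.
- move=> x; rewrite star_sum; apply: eq_bigr => k _.
  by have [_ _ _ ->] := ch k; rewrite starZ (pp k).1.
exists i, g; apply: (@le_lt_trans _ _ (m%:R * s)%:E); last first.
  rewrite lte_fin (le_lt_trans ms)// gt_min; apply/orP; right; lra.
apply: hom_dist_le => a a1.
rewrite /= gE {2}(xE a) !starhom_sumE -sumrB (le_trans (cnorm_sum _ _ _))//.
rewrite mulr_natl -[m in _ *+ m]card_ord -sumr_const; apply: ler_sum => k _.
rewrite !starhomZE -scalerBr cnormZ -[leRHS]mul1r ler_pM ?cnorm_ge0 ?Re_norm_ge0//.
  rewrite (le_trans (character_le _ (ch k)))//.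
  by rewrite -norm_le_cnorm.
exact: ltW.
Qed.

End finite_dimensional_generated.

(** * Finite-partition algebras *)

Section spanning.
Variables (K : fieldType) (V : lmodType K) (n : nat) (f : V -> 'rV[K]_n).
Hypotheses (fL : forall k x y, f (k *: x + y) = k *: f x + f y) (f_inj : injective f).

(** A longest family with linearly independent images spans, by injectivity of [f]. *)
Lemma finite_span : exists m (v : 'I_m -> V),
  forall x, exists c : 'I_m -> K, x = \sum_(i < m) c i *: v i.
Proof.
have f0 : f 0 = 0.
  have := fL 1 0 0; rewrite !scale1r addr0 => /eqP.
  by rewrite -subr_eq0 opprD addrA subrr sub0r oppr_eq0 => /eqP.
have fZ k x : f (k *: x) = k *: f x by rewrite -[k *: x]addr0 fL f0 addr0.
have fD x y : f (x + y) = f x + f y by rewrite -[x in LHS]scale1r fL scale1r.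
have f_sum (I : Type) (r : seq I) (F : I -> V) :
    f (\sum_(i <- r) F i) = \sum_(i <- r) f (F i).
  exact: (big_morph f fD f0).
pose M m (v : 'I_m -> V) : 'M[K]_(m, n) := \matrix_(i < m) f (v i).
pose P m := `[< exists v : 'I_m -> V, row_free (M m v) >].
have P0 : exists m, P m.
  by exists 0%N; apply/asboolP; exists (fun=> 0); rewrite /row_free flatmx0 mxrank0.
have Pn m : P m -> (m <= n)%N.
  by move=> /asboolP[v /eqP <-]; exact: rank_leq_col.
case: (ex_maxnP P0 Pn) => m /asboolP[v vfree] maxm.
exists m, v => x.
have [/submxP[c cE]|nsub] := boolP (f x <= M m v)%MS.
  exists (fun i => c 0 i); apply: f_inj; rewrite f_sum cE mulmx_sum_row.
  by apply: eq_bigr => i _; rewrite fZ rowK.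
exfalso; have : P m.+1; last by move/maxm; rewrite ltnn.
apply/asboolP; exists (fun i => if unlift ord0 i is Some j then v j else x).
set w := fun i => _; rewrite /row_free eqn_leq rank_leq_row.
apply: leq_trans (rank_ltmx (_ : (M m v < M m.+1 w)%MS)).
  by rewrite (eqP vfree).
have xw : (f x <= M m.+1 w)%MS.
  by have := row_sub ord0 (M m.+1 w); rewrite rowK /w unlift_none.
rewrite ltmxE; apply/andP; split.
  apply/row_subP => i; have := row_sub (lift ord0 i) (M m.+1 w).
  by rewrite !rowK /w liftK.
by apply: contra nsub => /(submx_trans xw).
Qed.

End spanning.

Section finite_partitions.
Variables (R : realType) (C : cstarAlgType R) (c : R[i] -> C).
Hypotheses (cL : forall k x y, c (k * x + y) = k *: c x + c y) (c1 : c 1 = 1)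
  (cM : forall x y, c (x * y) = c x * c y) (cJ : forall x, c x^*%C = star (c x))
  (cn : forall x, cnorm (c x) = complex.Re `|x|) (c_surj : forall b, exists x, c x = b).
Variable X : Type.

Let FF : Filter (globally [set: X]) := globally_filter _.

Definition ell_infty : cstarAlgType R := redprod (fun _ : X => C) FF.

Local Notation V := (dprod (fun _ : X => C : lmodType R[i])).
Local Notation bnd := (@rp_mem R X (fun=> C) (globally [set: X])).

Lemma rp_inj (x y : V) : bnd x -> bnd y -> rp FF x = rp FF y -> x = y.
Proof.
move=> xb yb xy; apply/functional_extensionality_dep => s; apply/eqP.
have xyb : bnd (x - y) by apply: rp_memD => //; rewrite -scaleN1r; exact: rp_memZ.
rewrite -subr_eq0 -cnorm_eq0 eq_le cnorm_ge0 andbT; apply/ler_addgt0Pr => e e0.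
have [_] := rp_norm_near_add FF xyb e0.
by rewrite -cnorm_rp// rpB// xy subrr cnorm0 => /(_ s Logic.I).
Qed.

Lemma rp_cnorm_ge (x : V) s : bnd x -> cnorm (x s) <= cnorm (rp FF x).
Proof.
move=> xb; rewrite cnorm_rp//; apply/ler_addgt0Pr => e e0.
by have [_] := rp_norm_near_add FF xb e0; apply.
Qed.

Lemma rp_cnorm_le (x : V) r : 0 <= r ->
  (forall s, cnorm (x s) <= r) -> cnorm (rp FF x) <= r.
Proof.
move=> r0 xr; have xb : bnd x by exists r => s _; exact: xr.
by rewrite cnorm_rp//; apply: rp_norm_le; split=> // s _; exact: xr.
Qed.

Implicit Type F : {fset (set X)}.

(** A partition is encoded by a finite set [F] of subsets generating it, so that a common refinement
    is just a union and the index poset is ordered by inclusion. *)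
Definition same_atom F (s t : X) := forall U, U \in F -> (U s <-> U t).

Definition atomic F : set ell_infty := [set b | exists x : V,
  [/\ bnd x, rp FF x = b & forall s t, same_atom F s t -> x s = x t]].

Lemma atomic_subalgebra F : exists B : cstarAlgType R,
  exists i : starHom B ell_infty,
  isometric i /\ forall x, atomic F x <-> exists b, i b = x.
Proof.
apply: subalgebra_ex.
- exists (fun=> 1); split=> //; exact: rp_mem1.
- move=> _ _ [x [xb <- xF]] [y [yb <- yF]]; exists (x + y); split.
  + exact: rp_memD.
  + exact: rpD.
  + by move=> s t st; rewrite /GRing.add/= /dprod_add (xF s t)// (yF s t).
- move=> k _ [x [xb <- xF]]; exists (k *: x); split.
  + exact: rp_memZ.
  + exact: rpZ.
  + by move=> s t st; rewrite /GRing.scale/= /dprod_scale (xF s t).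
- move=> _ _ [x [xb <- xF]] [y [yb <- yF]]; exists (rp_mul x y); split.
  + exact: rp_memM.
  + exact: rpM.
  + by move=> s t st; rewrite /rp_mul (xF s t)// (yF s t).
- move=> _ [x [xb <- xF]]; exists (rp_star x); split.
  + exact: rp_memJ.
  + exact: rpJ.
  + by move=> s t st; rewrite /rp_star (xF s t).
(* Norm convergence is uniform in the point, so two values of the limit in one atom differ by at
   most 2 e. *)
- move=> u l uF ul; have [x xb xl] := rp_surj l; exists x; split=> // s t st.
  apply: cnorm_eps_eq; exists 2 => // e e0; have [N uN] := ul e e0.
  have [y [yb yE yF]] := uF N.
  have yx r : cnorm (y r - x r) <= e.
    have yxb : bnd (y - x) by apply: rp_memD => //; rewrite -scaleN1r; exact: rp_memZ.
    apply: le_trans (rp_cnorm_ge r yxb) _.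
    by rewrite rpB// yE xl ltW// uN.
  rewrite (le_trans (cnorm_triangle _ (y s) _))// mulr_natl mulr2n lerD//.
    by rewrite cnormB.
  by rewrite (yF s t).
Qed.

Definition partition_alg F : cstarAlgType R := sval (cid (atomic_subalgebra F)).

Definition partition_incl F : starHom (partition_alg F) ell_infty :=
  sval (cid (svalP (cid (atomic_subalgebra F)))).

Lemma partition_inclP F : isometric (@partition_incl F) /\
  forall x, atomic F x <-> exists b, @partition_incl F b = x.
Proof. exact: svalP (cid (svalP (cid (atomic_subalgebra F)))). Qed.

Lemma atomic_mono F G : (F `<=` G)%fset -> atomic F `<=` atomic G.
Proof.
move=> /fsubsetP FG _ [x [xb <- xF]]; exists x; split=> // s t st.
by apply: xF => U /FG; exact: st.
Qed.



Lemma partition_hom_ex F G : (F `<=` G)%fset ->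
  exists g : starHom (partition_alg F) (partition_alg G),
  forall a, @partition_incl G (g a) = @partition_incl F a.
Proof.
move=> FG; have [Fi Fa] := partition_inclP F; have [Gi Ga] := partition_inclP G.
apply: lift_isometric => // a; apply/Ga; apply: (atomic_mono FG); apply/Fa.
by exists a.
Qed.

Lemma atom_of_nat (k : X -> nat) N : (forall s, (k s < N)%N) ->
  exists F : {fset (set X)}, forall s t, same_atom F s t -> k s = k t.
Proof.
move=> kN; exists [fset [set s | k s = n] | n in iota 0 N]%fset => s t st.
have kin : [set s' | k s' = k s] \in [fset [set s | k s = n] | n in iota 0 N]%fset.
  by apply/imfsetP; exists (k s) => //=; rewrite mem_iota kN.
by have [h _] := st _ kin; apply/esym; exact: h.
Qed.

(** The atom of [s] is determined by the subset [tau s] of [F]; one point is chosen for each subset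
    that occurs, that is for each nonempty atom. *)
Lemma atom_points F : exists n (p : 'I_n -> X), forall s, exists i, same_atom F s (p i).
Proof.
pose tau (s : X) : {set F} := [set U | `[< val U s >]]%SET.
pose J : pred {set F} := fun G => `[< exists s, tau s = G >].
have /choice[p pE] : forall i : 'I_#|J|, exists s, tau s = enum_val i.
  by move=> i; have /asboolP := enum_valP i.
exists #|J|, p => s.
have Js : tau s \in J by apply/asboolP; exists s.
exists (enum_rank_in Js (tau s)) => U UF.
have := pE (enum_rank_in Js (tau s)); rewrite enum_rankK_in// => /setP/(_ [` UF]%fset).
rewrite /tau !inE/= => h; split=> h'; apply/asboolP.
  by rewrite h; exact/asboolP.
by rewrite -h; exact/asboolP.
Qed.

Definition fset_index : Type := {fset (set X)}.

HB.instance Definition _ := Choice.on fset_index.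

Let fsub_anti : antisymmetric (fun F G : fset_index => (F `<=` G)%fset).
Proof. by move=> F G /andP[FG GF]; apply/eqP; rewrite eqEfsubset FG GF. Qed.

HB.instance Definition _ := Order.Le_isPOrder.Build (Order.Disp tt tt) fset_index
  (@fsubset_refl (set X)) fsub_anti (fun G F H => @fsubset_trans (set X) G F H).

Lemma fset_index_directed : directed_poset fset_index.
Proof.
split; first exact: inhabits (fset0 : fset_index).
by move=> F G; exists (F `|` G)%fset; split; [exact: fsubsetUl|exact: fsubsetUr].
Qed.

Definition partition_hom (F G : fset_index) (FG : (F <= G)%O) :=
  sval (cid (@partition_hom_ex F G FG)).

Lemma partition_homE (F G : fset_index) (FG : (F <= G)%O) a :
  @partition_incl G (partition_hom FG a) = @partition_incl F a.
Proof. exact: (svalP (cid (@partition_hom_ex F G FG))). Qed.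

Lemma partition_incl_inj F : injective (@partition_incl F).
Proof. exact/isometric_inj/(partition_inclP F).1. Qed.

Let hom_id (F : fset_index) (F_F : (F <= F)%O) a : partition_hom F_F a = a.
Proof. by apply: partition_incl_inj; rewrite partition_homE. Qed.

Let hom_comp (F G H : fset_index) (FG : (F <= G)%O) (GH : (G <= H)%O)
  (FH : (F <= H)%O) a : partition_hom GH (partition_hom FG a) = partition_hom FH a.
Proof. by apply: partition_incl_inj; rewrite !partition_homE. Qed.

Definition partition_diagram : cstar_diagram R fset_index :=
  CStarDiagram hom_id hom_comp.

Lemma partition_hom_isometric (F G : fset_index) (FG : (F <= G)%O) :
  isometric (partition_hom FG).
Proof.
move=> a; rewrite -(partition_inclP F).1 -(partition_inclP G).1.
by rewrite partition_homE.
Qed.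

Lemma partition_dense (b : ell_infty) :
  leg_closure (D := partition_diagram) (fun F => @partition_incl F) b.
Proof.
move=> e e0; have [x xb <-] := rp_surj b.
have /choice[z zE] := fun s => c_surj (x s).
have [r [r0 xr]] := rp_memP FF xb.
have zr s : complex.Re `|z s| <= r by rewrite -cn zE; exact: xr.
(* Real and imaginary parts are discretized with mesh h, so that [x] varies by at most 2 h < e on an
   atom. They lie in [-r, r], which bounds the number of cells by [N]. *)
pose h := e / 3; have h0 : 0 < h by rewrite divr_gt0.
pose N := (Num.truncn ((r + r) / h)).+1.
have grid (w : X -> R) : (forall s, `|w s| <= r) ->
    exists F : {fset (set X)}, forall s t, same_atom F s t -> `|w s - w t| <= h.
  move=> wr; pose k s := Num.truncn ((w s + r) / h).
  have w0 s : 0 <= (w s + r) / h.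
    rewrite divr_ge0 ?(ltW h0)//; have := wr s; rewrite ler_norml => /andP[]; lra.
  have [|F FP] := @atom_of_nat k N.
    move=> s; rewrite ltnS /k le_truncn// ler_pM2r ?invr_gt0// lerD2r.
    by have := wr s; rewrite ler_norml => /andP[].
  exists F => s t /FP kst.
  have /andP[s1 s2] := truncn_itv (w0 s); have /andP[t1 t2] := truncn_itv (w0 t).
  rewrite -/(k s) in s1 s2; rewrite -/(k t) -kst in t1 t2.
  rewrite ler_pdivlMr// in s1; rewrite ler_pdivlMr// in t1.
  rewrite ltr_pdivrMr// -natr1 in s2; rewrite ltr_pdivrMr// -natr1 in t2.
  rewrite ler_norml; apply/andP; split; lra.
have [|F1 F1P] := grid (fun s => complex.Re (z s)).
  by move=> s; rewrite (le_trans (Re_norm_ge_Re _)).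
have [|F2 F2P] := grid (fun s => complex.Im (z s)).
  by move=> s; rewrite (le_trans (Re_norm_ge_Im _)).
pose F := (F1 `|` F2)%fset.
have FP s t : same_atom F s t -> cnorm (x s - x t) <= h + h.
  move=> st; have cB : x s - x t = c (z s - z t).
    have -> : z s - z t = -1 * z t + z s by rewrite mulN1r addrC.
    by rewrite cL scaleN1r !zE addrC.
  rewrite cB cn (le_trans (Re_norm_le _))// raddfB [complex.Im _]raddfB.
  by apply: lerD; [apply: F1P|apply: F2P] => U UF; apply: st; rewrite inE UF ?orbT.
(* [y s] is the value of [x] at some point of the atom of [s]; it is chosen from the set of such
   values alone, so [y] is constant on atoms. *)
pose y : V := fun s => xget 0 [set x t | t in same_atom F s].
have yx s : cnorm (y s - x s) <= h + h.
  rewrite /y; case: xgetP => [_ _ [t st <-]|/(_ (x s)) []].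
    by rewrite cnormB FP.
  by exists s.
have yb : bnd y.
  exists (h + h + r) => s _; rewrite /= -(subrK (x s) (y s)).
  rewrite (le_trans (cnormD _ _))// lerD//; exact: xr.
have ya : atomic F (rp FF y).
  exists y; split=> // s t st; congr xget; apply/seteqP.
  by split=> _ [u su <-]; exists u => // U UF; have := su U UF; have := st U UF; tauto.
have [a aE] := ((partition_inclP F).2 _).1 ya.
exists F, a; rewrite [partition_incl F a]aE -rpB//.
rewrite (le_lt_trans (rp_cnorm_le (r := h + h) _ _))//; first by rewrite addr_ge0// ltW.
by rewrite /h; lra.
Qed.


(** After [g], evaluation at one point per atom is an injective linear map into row vectors. *)
Lemma partition_finite_dimensional (A : cstarAlgType R) F
  (g : starHom A (partition_alg F)) : injective g -> finite_dimensional A.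
Proof.
move=> g_inj; have [n [p pP]] := atom_points F.
have /choice[Y YP] : forall a, exists y : V, [/\ bnd y,
    rp FF y = partition_incl F (g a) & forall s t, same_atom F s t -> y s = y t].
  by move=> a; apply/(partition_inclP F).2; exists (g a).
have Yb a : bnd (Y a) by have [] := YP a.
have YE a : rp FF (Y a) = partition_incl F (g a) by have [] := YP a.
have Yat a s t : same_atom F s t -> Y a s = Y a t by have [_ _] := YP a; apply.
have /choice[c' c'K] := c_surj.
have c'L k b b' : c' (k *: b + b') = k * c' b + c' b'.
  have h : c (c' (k *: b + b') - (k * c' b + c' b')) = 0.
    have -> : c' (k *: b + b') - (k * c' b + c' b') =
      -1 * (k * c' b + c' b') + c' (k *: b + b') by rewrite mulN1r addrC.
    by rewrite !cL !c'K scaleN1r addNr.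
  apply/eqP; rewrite -subr_eq0 -normr_eq0 -[X in X == 0]RRe_real ?normr_real//.
  by rewrite -cn h cnorm0.
have YL k a b : Y (k *: a + b) = k *: Y a + Y b.
  have kYb : bnd (k *: Y a) by exact: rp_memZ.
  apply: rp_inj => //; first exact: rp_memD.
  by rewrite rpD// rpZ// !YE starhomDE starhomZE starhomDE starhomZE.
pose f a : 'rV[R[i]]_n := \row_j c' (Y a (p j)).
have fL k x y : f (k *: x + y) = k *: f x + f y.
  by apply/rowP => j; rewrite !mxE YL -c'L.
have f_inj : injective f.
  move=> a b fab; apply: g_inj; apply: (@partition_incl_inj F); rewrite -!YE.
  congr rp; apply/functional_extensionality_dep => s; have [j sj] := pP s.
  rewrite (Yat a s _ sj) (Yat b s _ sj) -[LHS]c'K -[RHS]c'K.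
  by have /rowP/(_ j) := fab; rewrite !mxE => ->.
exact: finite_span fL f_inj.
Qed.

End finite_partitions.

(** * Generated commutative algebras are finite-dimensional *)

Lemma aleph0_generated_finite_dimensional (R : realType)
  (P : cstarAlgType R -> Prop) (SP : stable_class P) (A : cstarAlgType R) :
  commutative_cstar A -> aleph0_generated P A -> finite_dimensional A.
Proof.
move=> cA gA; have [C [c [cL c1 cM cJ [cn c_surj]]]] := scalars_ex R.
have cC : commutative_cstar C.
  move=> x y; have [k <-] := c_surj x; have [l <-] := c_surj y.
  by rewrite !cmulE -!cM mulrC.
pose X := {chi : A -> R[i] | character chi}.
pose L := ell_infty C X.
pose G (F : fset_index X) := partition_alg C F.
have PL : P L by apply: (stable_redprod SP) => _; exact: (stable_commutative SP).
have PG F : P (G F) by exact: (stable_isometric SP (partition_inclP C F).1).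
pose D := partition_diagram C X.
pose leg F : starHom (D F) L := partition_incl C F.
have legE : cstar_cocone leg by move=> F F' FF' a; exact: partition_homE.
have leg_iso F : isometric (leg F) := (partition_inclP C F).1.
have leg_dense : forall b, leg_closure leg b by exact: partition_dense.
have dirX := fset_index_directed X.
have colim := isometric_dense_cstar_colimit dirX PL legE leg_iso leg_dense.
pose ev (a : A) : dprod (fun _ : X => C : lmodType R[i]) := fun chi => c (sval chi a).
have ev_bnd a : rp_mem (globally [set: X]) (ev a).
  exists (cnorm a) => chi _ /=; rewrite /ev cn.
  exact: character_le (svalP chi).
pose FF : Filter (globally [set: X]) := globally_filter _.
have [||||f fE] := @starhom_ex R A L (fun a => rp FF (ev a)).
- move=> k x y; rewrite -rpZ// -rpD//; last exact: rp_memZ.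
  congr rp; apply/functional_extensionality_dep => chi.
  by have [chiL _ _ _] := svalP chi; rewrite /ev chiL cL.
- rewrite -rp1; congr rp; apply/functional_extensionality_dep => chi.
  by have [_ chi1 _ _] := svalP chi; rewrite /ev chi1 c1.
- move=> x y; rewrite -rpM//; congr rp; apply/functional_extensionality_dep => chi.
  by have [_ _ chiM _] := svalP chi; rewrite /ev chiM cM.
- move=> x; rewrite -rpJ//; congr rp; apply/functional_extensionality_dep => chi.
  by have [_ _ _ chiJ] := svalP chi; rewrite /ev chiJ cJ.
(* Every [chi a] is a coordinate of [f a], while [character_ex] provides characters whose value at
   [a] exceeds any given nonnegative number below [cnorm a]. *)
have f_iso : isometric f.
  apply: cnorm_isometric => a; apply/eqP; rewrite eq_le starhom_contractive/= leNgt.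
  apply/negP => fa; have [chi [ch]] := character_ex cA (cnorm_ge0 (f a)) fa.
  rewrite ltNge => /negP; apply; rewrite -cn fE.
  exact: (rp_cnorm_ge (exist _ chi ch : X) (ev_bnd a)).
have half0 : 0 < 1 / 2 :> R by lra.
have [F [g gf]] := generated_factorable dirX legE leg_iso gA PG
  (@partition_hom_isometric R C X) colim f half0.
apply: (partition_finite_dimensional cL cn c_surj (g := g)) => a b gab.
apply/eqP; rewrite -subr_eq0 -cnorm_eq0; apply/negP => /negP ab0.
have abs : 0 < cnorm (a - b) by rewrite lt_neqAle eq_sym ab0 cnorm_ge0.
pose y := (cnorm (a - b))^-1%:C *: (a - b).
have y1 : cnorm y = 1 by rewrite cnormZr ger0_norm ?invr_ge0 ?cnorm_ge0// mulVf.
have gy : g y = 0 by rewrite starhomZE starhomBE gab subrr scaler0.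
have := hom_dist_ub (starhom_comp (leg F) g) f (cnorm_le1 (_ : cnorm y <= 1)).
rewrite y1 lexx => /(_ isT); rewrite /= gy starhom0E sub0r cnormN isometric_cnorm// y1.
move=> /le_lt_trans/(_ gf); rewrite lte_fin; lra.
Qed.

Theorem proposition3p3 (R : realType) (A : cstarAlgType R) :
  commutative_cstar A ->
  (aleph0_generated (@unital_cstar R) A <-> finite_dimensional A) /\
  (aleph0_generated (@commutative_cstar R) A <-> finite_dimensional A).
Proof.
move=> cA; split; split.
- exact: (aleph0_generated_finite_dimensional (stable_unital R) cA).
- exact: (finite_dimensional_aleph0_generated (stable_unital R) cA).
- exact: (aleph0_generated_finite_dimensional (stable_commutative_cstar R) cA).
- exact: (finite_dimensional_aleph0_generated (stable_commutative_cstar R) cA).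
Qed.
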